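(* There are universal constants $c,C,C'>0$ such that the following holds. Let $\mathcal{A}$ be a finite nonempty set of complex $m\times n$ matrices. Suppose that $\xi_1,\ldots,\xi_n$ are independent, real-valued, mean-zero, subgaussian random variables, let $\xi=(\xi_1,\ldots,\xi_n)$ and set $\|\xi\|_{\psi_2}=\max_i\|\xi_i\|_{\psi_2}$. For any $1\leq p<\infty$, $$\Big(\mathbb{E}\sup_{A\in\mathcal{A}}\Big|\|A\xi\|_2^2-\mathbb{E}\|A\xi\|_2^2\Big|^p\Big)^{1/p}\leq C'\|\xi\|_{\psi_2}^2\Big(\gamma_{2,p}^2(\mathcal{A},d_\infty)+\bar\Delta_2(\mathcal{A})\gamma_{2,p}(\mathcal{A},d_\infty)+\sqrt p\,\bar\Delta_4^2(\mathcal{A})+p\,\bar\Delta_\infty^2(\mathcal{A})\Big).$$ As a consequence, for any $u\geq 1$, $$\mathbb{P}\Big(\sup_{A\in\mathcal{A}}\Big|\|A\xi\|_2^2-\mathbb{E}\|A\xi\|_2^2\Big|> C\|\xi\|_{\psi_2}^2\Big(\gamma_2^2(\mathcal{A},d_\infty)+\bar\Delta_2(\mathcal{A})\gamma_2(\mathcal{A},d_\infty)\Big)+c\|\xi\|_{\psi_2}^2\Big(\sqrt u\,\bar\Delta_4^2(\mathcal{A})+u\,\bar\Delta_\infty^2(\mathcal{A})\Big)\Big)\leq e^{-u}.$$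
   Context: For a random variable $X$, $\|X\|_{\psi_2}=\inf\{a>0:\mathbb{E}\exp(|X|^2/a^2)-1\leq 1\}$; $X$ is subgaussian if $\|X\|_{\psi_2}<\infty$. $\|\cdot\|_2$ on vectors is the Euclidean norm. For an $m\times n$ matrix $A$, $\|A\|_{S^q}=(\mathrm{Tr}(A^*A)^{q/2})^{1/q}$ for $1\leq q<\infty$ is the Schatten norm, and $\|A\|_{S^\infty}$ is the operator norm $\ell^2_n\to\ell^2_m$. Set $d_\infty(A_1,A_2)=\|A_1-A_2\|_{S^\infty}$, and $\bar\Delta_q(\mathcal{A})=\sup_{A\in\mathcal{A}}\|A\|_{S^q}$ for $1\leq q\leq\infty$. A sequence $(\mathcal{A}_n)_{n\geq 0}$ of nonempty subsets of $\mathcal{A}$ is admissible if $|\mathcal{A}_0|=1$ and $|\mathcal{A}_n|\leq 2^{2^n}$ for $n\geq 1$. With $d(A,\mathcal{A}_n)=\inf_{B\in\mathcal{A}_n}d(A,B)$, set $\gamma_2(\mathcal{A},d)=\inf\sup_{A\in\mathcal{A}}\sum_{n\geq 0}2^{n/2}d(A,\mathcal{A}_n)$ and, for $1\leq p<\infty$ and $l=\lfloor\log_2 p\rfloor$, $\gamma_{2,p}(\mathcal{A},d)=\inf\sup_{A\in\mathcal{A}}\sum_{n\geq l}2^{n/2}d(A,\mathcal{A}_n)$, the infima being over admissible sequences. Powers such as $\gamma_2^2(\mathcal{A},d)$, $\bar\Delta_4^2(\mathcal{A})$ mean squares of the corresponding quantities. *)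

(* Defs.v *)
From HB Require Import structures.
From mathcomp Require Import all_boot all_order all_algebra.
From mathcomp Require Import spectral complex.
From mathcomp Require Import all_classical all_reals all_analysis.
Import Order.TTheory GRing.Theory Num.Theory.
Import numFieldNormedType.Exports.

Set Implicit Arguments.
Unset Strict Implicit.
Unset Printing Implicit Defensive.

Local Open Scope classical_set_scope.
Local Open Scope ring_scope.
Local Open Scope complex_scope.
Local Open Scope sesquilinear_scope.

Section matrix_norms.
Variable R : realType.

(* The Euclidean norm on C^n. The library norm on matrices is the sup norm. *)
Definition norm2 n (x : 'cV[R[i]]_n) : R :=
  Num.sqrt (\sum_(i < n) Normc.normc (x i 0) ^+ 2).

Definition opnorm m n (A : 'M[R[i]]_(m, n)) : R :=
  sup [set norm2 (A *m x) | x in [set x : 'cV[R[i]]_n | norm2 x <= 1]].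

(* The power M^r, by functional calculus on an orthonormal eigenbasis, of a
   positive semidefinite Hermitian M. The eigenvalues of such an M are real and
   nonnegative, hence the real part. *)
Definition psdmx_powR n (M : 'M[R[i]]_n) (r : R) : 'M[R[i]]_n :=
  invmx (spectralmx M) *m
  diag_mx (map_mx (fun z : R[i] => (complex.Re z `^ r)%:C) (spectral_diag M)) *m
  spectralmx M.

Definition schatten (q : R) m n (A : 'M[R[i]]_(m, n)) : R :=
  complex.Re (\tr (psdmx_powR (A ^t* *m A) (q / 2))) `^ q^-1.

Definition d_infty m n (A B : 'M[R[i]]_(m, n)) : R := opnorm (A - B).

Definition Delta_bar (q : R) m n (cA : set 'M[R[i]]_(m, n)) : R :=
  sup [set schatten q A | A in cA].

Definition Delta_bar_infty m n (cA : set 'M[R[i]]_(m, n)) : R :=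
  sup [set opnorm A | A in cA].

End matrix_norms.

Section gamma_functionals.
Variables (R : realType) (T : Type).

Definition admissible (cA : set T) (cAn : nat -> set T) : Prop :=
  [/\ forall k, cAn k `<=` cA,
      forall k, cAn k !=set0,
      (cAn 0%N #= `I_1)%card &
      forall k, (1 <= k)%N -> (cAn k #<= `I_(2 ^ (2 ^ k)))%card].

Definition dist_to (d : T -> T -> R) (x : T) (B : set T) : R :=
  inf [set d x y | y in B].

(* The series may diverge for some admissible sequences, so that the values
   are extended reals. *)
Definition gamma2_from (l : nat) (cA : set T) (d : T -> T -> R) : \bar R :=
  ereal_inf [set
    ereal_sup [set
      (\sum_(l <= k <oo) (2 `^ (k%:R / 2) * dist_to d x (cAn k))%:E)%E
      | x in cA]
    | cAn in admissible cA].

Definition gamma2 (cA : set T) (d : T -> T -> R) : \bar R :=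
  gamma2_from 0 cA d.

Definition gamma2p (p : R) (cA : set T) (d : T -> T -> R) : \bar R :=
  gamma2_from (Num.truncn (ln p / ln 2)) cA d.

End gamma_functionals.

Section random_variables.
Context d (T : measurableType d) (R : realType) (P : probability T R).

Definition psi2_norm (X : T -> R) : \bar R :=
  ereal_inf [set a%:E | a in [set a : R | 0 < a /\
    ('E_P[(fun w => expR (`|X w| ^+ 2 / a ^+ 2) : R)] - 1 <= 1)%E]].

Definition subgaussian (X : T -> R) : Prop := (psi2_norm X < +oo)%E.

Definition psi2_norm_vec n (xi : 'I_n -> {RV P >-> R}) : \bar R :=
  \big[maxe/0%E]_(i < n) psi2_norm (xi i).

Definition independent_RVs n (xi : 'I_n -> {RV P >-> R}) : Prop :=
  forall (J : {set 'I_n}) (B : 'I_n -> set R),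
    (forall i, measurable (B i)) ->
    P (\bigcap_(i in [set` J]) (xi i @^-1` B i)) =
    (\prod_(i in J) P (xi i @^-1` B i))%E.

Definition rvec n (xi : 'I_n -> {RV P >-> R}) (w : T) : 'cV[R[i]]_n :=
  \col_(i < n) (xi i w)%:C.

(* For a finite nonempty cA and subgaussian xi, the supremum and all the
   expectations are finite. *)
Definition sup_deviation m n (cA : set 'M[R[i]]_(m, n))
    (xi : 'I_n -> {RV P >-> R}) (w : T) : R :=
  sup [set `| norm2 (A *m rvec xi w) ^+ 2
             - fine 'E_P[(fun w' => norm2 (A *m rvec xi w') ^+ 2)] |
      | A in cA].

End random_variables.

(* Main.v *)
(* Complex m x n matrices act here on a real vector, so that they may be replaced
   by real 2m x n matrices with norms that are no larger, and the variables are
   rescaled so that E exp(X_i^2) <= 2.  All bounds are for moments of order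
   r = 2^(l+1), which is comparable to p when l = floor(log2 p).

   A squared norm ||A x_I||^2 is a diagonal part sum_i |A e_i|^2 x_i^2 plus an
   average, over subsets J, of bilinear forms <A x_(I n J), A x_(I \ J)>.
   Conditionally on one of the two blocks such a form is a linear combination of
   independent variables, so that its increments in A satisfy a Khintchine
   inequality with constant d_infty times the supremum N_J of the norms
   ||A x_J||; generic chaining from level l bounds the form by gamma_(2,p) N_J
   plus a maximum over at most 2^(2^l) <= 2^r matrices, which costs only a
   constant factor in the r-th moment.  Applied to the family extended by the
   zero matrix this bounds the moments of N_J^2 by a small multiple of
   themselves, which is absorbed: N_J is of order Delta_2 + gamma_(2,p) +
   sqrt r Delta_infty.  The diagonal part is chained in the same way, with
   Bernstein increments split into at most q large coefficients and the rest.
   For the single matrices at level l, Bernstein's inequality and the bootstrap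
   applied to A^T A produce sqrt r Delta_4^2 + r Delta_infty^2.

   For a finite family gamma_2 is finite, and the tail bound is Markov's
   inequality for p = u. *)
Require Import Defs.
From HB Require Import structures.
From mathcomp Require Import all_boot all_order all_algebra.
From mathcomp Require Import spectral complex.
From mathcomp Require Import all_classical all_reals all_analysis.
From mathcomp Require Import measurable_realfun.
From mathcomp Require Import zify ring lra.
Import Order.TTheory GRing.Theory Num.Theory.
Import numFieldNormedType.Exports.

Set Implicit Arguments.
Unset Strict Implicit.
Unset Printing Implicit Defensive.

Local Open Scope classical_set_scope.
Local Open Scope ring_scope.
Local Open Scope complex_scope.

(** * Independent copies *)

(** Decoupling splits one vector into two blocks of its own coordinates, with no second vector, so
    conditioning becomes Fubini after resampling some coordinates. The price is that block norms
    reappear on the right. The self-bounding estimate must therefore hold for all subsets [I] at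
    once; it is closed by iterating an affine recursion for r-th moments, which starts from an a
    priori finite bound, however crude.

    A chained quantity is a deterministic weight times [W] times a random norm. Chaining delivers
    [W] with moments of order 2r, so that Cauchy-Schwarz gives the product moments of order r.
    Exponents that are powers of two let Jensen's inequality follow from repeated squaring.

    Estimates are stated for r-th powers, with constants independent of r, n and the family: a sum
    costs a factor 2 in place of Minkowski's inequality, and a maximum over 2^r members costs
    another factor 2.

    The psi_2 norm and the gamma functional are infima that may not be attained. Strict bounds K + e
    and g + e are used, and e tends to 0 at the end. *)

Section grouping.
Context d (T : measurableType d) (R : realType) (P : probability T R) (n : nat).
Variable X : 'I_n -> T -> R.
Hypothesis mX : forall i, measurable_fun setT (X i).
Hypothesis indX : forall (J : {set 'I_n}) (B : 'I_n -> set R),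
  (forall i, measurable (B i)) ->
  P (\bigcap_(i in [set` J]) (X i @^-1` B i)) =
  (\prod_(i in J) P (X i @^-1` B i))%E.

Let tup (w : T) : n.-tuple R := [tuple X i w | i < n].

Let mix (I : {set 'I_n}) (w : T * T) : n.-tuple R :=
  [tuple if i \in I then X i w.1 else X i w.2 | i < n].

Let mtup : measurable_fun setT tup.
Proof.
apply/measurable_fun_tnthP => i.
by rewrite (_ : _ \o _ = X i)//; apply/funext => w /=; rewrite tnth_mktuple.
Qed.

Let mmix I : measurable_fun setT (mix I).
Proof.
apply/measurable_fun_tnthP => i.
have [iI|iI] := boolP (i \in I).
  rewrite (_ : _ \o _ = X i \o fst); first exact: measurableT_comp.
  by apply/funext => w /=; rewrite tnth_mktuple iI.
rewrite (_ : _ \o _ = X i \o snd); first exact: measurableT_comp.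
by apply/funext => w /=; rewrite tnth_mktuple (negbTE iI).
Qed.

Let box (B : 'I_n -> set R) : set (n.-tuple R) :=
  [set t | forall i, B i (tnth t i)].

Let boxes : set (set (n.-tuple R)) :=
  [set A | exists B, (forall i, measurable (B i)) /\ A = box B].

Let measurable_boxes : measurable = <<s boxes >>.
Proof.
apply/seteqP; split.
  apply: smallest_sub; first exact: smallest_sigma_algebra.
  move=> A; rewrite -bigcup_seq => -[i _ [C mC <-]].
  rewrite setTI; apply: sub_sigma_algebra.
  exists (fun j => if j == i then C else setT); split.
    by move=> j; case: ifP.
  apply/seteqP; split => [t Ct j|t /(_ i)]; last by rewrite eqxx.
  by case: eqP => // ->.
apply: smallest_sub; first exact: sigma_algebra_measurable.
move=> _ [B [mB ->]].
rewrite (_ : box B = \bigcap_(i in [set: 'I_n]) ((@tnth n R)^~ i @^-1` B i)).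
  apply: fin_bigcap_measurable => // i _.
  by have := measurable_tnth i measurableT (mB i); rewrite setTI.
by apply/seteqP; split => [t Bt i _|t Bt i]; [exact: Bt|exact: Bt].
Qed.

Let prob_box B : (forall i, measurable (B i)) ->
  P (tup @^-1` box B) = (\prod_i P (X i @^-1` B i))%E.
Proof.
move=> mB; have := indX [set: 'I_n]%SET mB.
rewrite (eq_bigl xpredT); last by move=> i; rewrite inE.
move=> <-; congr (P _); apply/seteqP; split => [w Bw i _|w Bw i].
  by have := Bw i; rewrite tnth_mktuple.
by rewrite tnth_mktuple; apply: Bw; rewrite /= inE.
Qed.

(** The event is a rectangle: coordinates in [I] constrain only the first point and the others only
    the second, so independence is used once on each factor. *)
Let prob_mix I B : (forall i, measurable (B i)) ->
  (P \x P)%E (mix I @^-1` box B) = (\prod_i P (X i @^-1` B i))%E.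
Proof.
move=> mB.
rewrite (_ : mix I @^-1` box B =
  (\bigcap_(i in [set` I]) (X i @^-1` B i)) `*`
  (\bigcap_(i in [set` ~: I]) (X i @^-1` B i))); last first.
  apply/seteqP; split => [[w1 w2] Bw|[w1 w2] [/= B1 B2] i].
    by split => i /= iI; have := Bw i; rewrite tnth_mktuple ?iI//;
      move: iI; rewrite inE => /negbTE ->.
  rewrite tnth_mktuple; case: ifPn => iI; [exact: B1|apply: B2].
  by rewrite /= inE.
have mI (J : {set 'I_n}) : measurable (\bigcap_(i in [set` J]) (X i @^-1` B i)).
  apply: fin_bigcap_measurable => // i _.
  by have := mX i measurableT (mB i); rewrite setTI.
rewrite product_measure1E; [|exact: mI..].
rewrite [RHS](bigID (mem I))/=; congr (_ * _)%E; first exact: indX.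
by rewrite [LHS]indX//; apply: eq_bigl => i; rewrite inE.
Qed.

(* The law of the vector is a product measure. *)
Lemma integral_indep_copy (I : {set 'I_n}) (f : n.-tuple (R) -> \bar R) :
  measurable_fun setT f -> (forall t, 0 <= f t)%E ->
  (\int[P]_w f [tuple X i w | i < n] =
   \int[P]_w2 \int[P]_w1
     f [tuple if i \in I then X i w1 else X i w2 | i < n])%E.
Proof.
move=> mf f0.
have tupm := isMeasurableFun.Build _ _ _ _ _ mtup.
pose tupM : {mfun T >-> n.-tuple (R)} := HB.pack tup tupm.
have mixm := isMeasurableFun.Build _ _ _ _ _ (@mmix I).
pose mixM : {mfun (T * T)%type >-> n.-tuple (R)} := HB.pack (mix I) mixm.
transitivity (\int[distribution P tupM]_t f t)%E.
  by rewrite ge0_integral_pushforward.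
have -> : (\int[P]_w2 \int[P]_w1
     f [tuple if i \in I then X i w1 else X i w2 | i < n])%E =
   (\int[(P \x P)%E]_z f (mix I z))%E.
  rewrite (fubini_tonelli1 (f \o mix I)) ?fubini_tonelli//.
  - exact: measurableT_comp.
  - by move=> x; exact: f0.
  - exact: measurableT_comp.
  - by move=> x; exact: f0.
transitivity (\int[pushforward (P \x P)%E mixM]_t f t)%E; last first.
  by rewrite ge0_integral_pushforward.
apply: eq_measure_integral => A mA _.
(* Both laws are probabilities, and the boxes form an intersection-stable generator on which
   independence makes them agree. *)
apply: (measure_unique boxes (fun=> setT) measurable_boxes) => //.
- move=> _ _ [B1 [mB1 ->]] [B2 [mB2 ->]].
  exists (fun i => B1 i `&` B2 i); split; first by move=> i; exact: measurableI.
  apply/seteqP; split => [t [h1 h2] i|t h]; first by split.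
  by split => i; have [] := h i.
- move=> _; exists (fun=> setT); split => //.
  by apply/seteqP; split => t.
- by rewrite bigcup_const.
- by move=> _ [B [mB ->]]; rewrite /= /distribution /pushforward prob_box// prob_mix.
- by move=> _; rewrite /= /distribution /pushforward preimage_setT probability_setT ltry.
Qed.

End grouping.

(** * Moment bounds for subexponential variables *)

Section expectation_bounds.
Context d (T : measurableType d) (R : realType) (P : probability T R).
Implicit Types f g h : T -> R.

(** Measurability, sign and bound travel together: the integral of a nonnegative function always
    exists in the extended reals, so moment bounds add, scale and compare without separate
    integrability conditions. *)
Definition Ele f (c : R) : Prop :=
  [/\ measurable_fun setT f, forall w, 0 <= f w &
      (\int[P]_w (f w)%:E <= c%:E)%E].

Lemma Ele_ge0 f c : Ele f c -> 0 <= c.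
Proof.
case=> mf f0 fc; rewrite -lee_fin; apply: le_trans fc.
by apply: integral_ge0 => w _; rewrite lee_fin.
Qed.

Lemma Ele_le f g a b : measurable_fun setT g -> (forall w, 0 <= g w) ->
  (forall w, g w <= f w) -> a <= b -> Ele f a -> Ele g b.
Proof.
move=> mg g0 gf ab [mf f0 fa]; split => //.
apply: (@le_trans _ _ a%:E); last by rewrite lee_fin.
apply: le_trans fa; apply: ge0_le_integral => //.
- by move=> w _; rewrite lee_fin.
- exact/measurable_EFinP.
- exact/measurable_EFinP.
- by move=> w _; rewrite lee_fin.
Qed.

Lemma Ele_weak f a b : a <= b -> Ele f a -> Ele f b.
Proof. by move=> ab [mf f0 fa]; apply: (@Ele_le f f a b) => //; split. Qed.

Lemma EleD f g a b : Ele f a -> Ele g b -> Ele (fun w => f w + g w) (a + b).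
Proof.
move=> [mf f0 fa] [mg g0 gb]; split.
- exact: measurable_funD.
- by move=> w; rewrite addr_ge0.
- under eq_integral do rewrite EFinD.
  rewrite ge0_integralD//.
  + by rewrite EFinD; apply: leeD.
  + by move=> w _; rewrite lee_fin.
  + exact/measurable_EFinP.
  + by move=> w _; rewrite lee_fin.
  + exact/measurable_EFinP.
Qed.

Lemma EleZ k f a : 0 <= k -> Ele f a -> Ele (fun w => k * f w) (k * a).
Proof.
move=> k0 [mf f0 fa]; split.
- by apply: measurable_funM.
- by move=> w; rewrite mulr_ge0.
- under eq_integral do rewrite EFinM.
  rewrite ge0_integralZl_EFin//.
  + by rewrite EFinM; apply: lee_wpmul2l.
  + by move=> w _; rewrite lee_fin.
  + exact/measurable_EFinP.
Qed.

Lemma Ele_cst c : 0 <= c -> Ele (fun=> c) c.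
Proof.
move=> c0; split => //.
rewrite integral_cst// [X in (_ * X)%E](_ : _ = 1%E) ?mule1//.
exact: probability_setT.
Qed.

Lemma Ele_sum (I : Type) (s : seq I) (Q : pred I) (f : I -> T -> R) (a : I -> R) :
  (forall i, Q i -> Ele (f i) (a i)) ->
  Ele (fun w => \sum_(i <- s | Q i) f i w) (\sum_(i <- s | Q i) a i).
Proof.
move=> fa; elim: s => [|i s ih].
  rewrite big_nil (_ : (fun _ => _) = fun=> 0); first exact: Ele_cst.
  by apply/funext => w; rewrite big_nil.
rewrite big_cons; case: ifPn => Qi.
  rewrite (_ : (fun _ => _) = fun w => f i w + \sum_(j <- s | Q j) f j w).
    by apply: EleD => //; exact: fa.
  by apply/funext => w; rewrite big_cons Qi.
rewrite (_ : (fun _ => _) = fun w => \sum_(j <- s | Q j) f j w)//.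
by apply/funext => w; rewrite big_cons (negbTE Qi).
Qed.

(** The centred term [Y] integrates to zero. This removes the linear Taylor term in the Laplace
    transform bounds. *)
Lemma Ele_center f g Y c : measurable_fun setT f -> (forall w, 0 <= f w) ->
  P.-integrable setT (EFin \o Y) -> (\int[P]_w (Y w)%:E = 0)%E ->
  (forall w, f w <= Y w + g w) -> Ele g c -> Ele f c.
Proof.
move=> mf f0 iY Y0 fYg [mg g0 gc]; split => //.
have ig : P.-integrable setT (EFin \o g).
  apply/integrableP; split; first exact/measurable_EFinP.
  under eq_integral do rewrite /= ger0_norm//.
  by apply: le_lt_trans gc _; exact: ltry.
have mY : measurable_fun setT Y by case/integrableP: iY => /measurable_EFinP.
have le1 : (\int[P]_w (f w)%:E <= \int[P]_w (Y w + g w)%:E)%E.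
  apply: ge0_le_integral => //.
  - by move=> w _; rewrite lee_fin.
  - exact/measurable_EFinP.
  - exact/measurable_EFinP/measurable_funD.
  - by move=> w _; rewrite lee_fin.
apply: (le_trans le1).
have := integralD_EFin measurableT iY ig.
by rewrite [X in _ = (X + _)%E]Y0 add0e => ->.
Qed.

End expectation_bounds.

(** * Elementary inequalities for the exponential *)

Section exponential_inequalities.
Variable R : realType.
Implicit Types x y : R.

(** Everything follows from 1 + y <= e^y: it gives e^y - 1 <= y e^y, hence e^x - 1 - x <= x (e^x -
    1), and the last factor is again bounded to first order. *)
Lemma expR_le_quad x : expR x <= 1 + x + x ^+ 2 * expR `|x|.
Proof.
have E1 y : expR y - 1 <= y * expR y.
  have := expR_ge1Dx (- y); rewrite expRN => h.
  have p := expR_gt0 y.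
  have : (1 - y) * expR y <= 1.
    have := ler_wpM2r (ltW p) h; rewrite mulVf// gt_eqF//.
  by lra.
have [x0|x0] := leP 0 x.
  rewrite ger0_norm//; have := E1 x; have := expR_gt0 x.
  move=> p h; have : x * (expR x - 1) <= x * (x * expR x) by rewrite ler_wpM2l.
  by rewrite expr2; lra.
have := expR_ge1Dx x; have : 1 <= expR `|x| by rewrite -expR0 ler_expR.
have := E1 x; move: (expR x) (expR `|x|) => e e' h1 h2 h3.
have : 0 <= x ^+ 2 * (e' - 1) by rewrite mulr_ge0 ?sqr_ge0 ?subr_ge0.
have : 0 <= - x * (- x - (1 - e)) by rewrite mulr_ge0//; lra.
by rewrite expr2; lra.
Qed.

Lemma sqr_le_expR x : 0 <= x -> x ^+ 2 <= 2 * expR x.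
Proof.
move=> x0; have := expR_ge1Dxn 1 x0.
by rewrite (_ : 2`!%:R = 2)//; lra.
Qed.

Lemma expr_le_fact_expR x n : 0 <= x -> x ^+ n <= n`!%:R * expR x.
Proof.
move=> x0; case: n => [|n].
  by rewrite expr0 fact0 mul1r -expR0 ler_expR.
rewrite mulrC -ler_pdivrMr ?ltr0n ?fact_gt0//.
by apply: le_trans (expR_ge1Dxn n x0); rewrite lerDr.
Qed.

Lemma fact_le_expn n : (n`! <= n ^ n)%N.
Proof.
suff H m : (m <= n -> m`! <= n ^ m)%N by exact: H.
elim: m => [//|m ih mn]; rewrite factS expnS leq_mul// ih//.
exact: ltnW.
Qed.

(** This converts Laplace transforms at two opposite points into a moment of order n. The two-sided
    sum replaces e^|x|, which does not factor over independent variables. *)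
Lemma norm_exprn_le_expR x n :
  `|x| ^+ n <= n%:R ^+ n * (expR x + expR (- x)).
Proof.
apply: le_trans (expr_le_fact_expR n (normr_ge0 x)) _.
apply: ler_pM; rewrite ?expR_ge0 ?ler0n//.
  by rewrite -natrX ler_nat fact_le_expn.
by case: ger0P => _; rewrite ?lerDl ?lerDr expR_ge0.
Qed.

Lemma expR_half_le2 : expR (2^-1 : R) <= 2.
Proof.
have := expR_ge1Dx (- 2^-1 : R); rewrite expRN => h.
have p := expR_gt0 (2^-1 : R).
have := ler_wpM2r (ltW p) h; rewrite mulVf ?gt_eqF//; lra.
Qed.

Lemma expR1_le4 : expR (1 : R) <= 4.
Proof.
rewrite (_ : 1 = 2^-1 + 2^-1 :> R); last by lra.
rewrite expRD; have := expR_half_le2; have := expR_gt0 (2^-1 : R); move=> *; nra.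
Qed.

Lemma expR1_ge2 : 2 <= expR (1 : R).
Proof. by have := expR_ge1Dx (1 : R); lra. Qed.

End exponential_inequalities.

(** * Laplace transforms of a variable and of its centred square *)

Section subgaussian_mgf.
Context d (T : measurableType d) (R : realType) (P : probability T R).
Variable X : T -> R.
Hypothesis mX : measurable_fun setT X.
Hypothesis sX : Ele P (fun w => expR (X w ^+ 2)) 2.
Hypothesis iX : P.-integrable setT (EFin \o X).
Hypothesis X0 : (\int[P]_w (X w)%:E = 0)%E.

Let mexp (f : T -> R) : measurable_fun setT f ->
  measurable_fun setT (fun w => expR (f w)).
Proof. by move=> mf; apply: measurableT_comp => //; exact: measurable_expR. Qed.

Let integrable_scale k (Y : T -> R) : P.-integrable setT (EFin \o Y) ->
  P.-integrable setT (EFin \o (fun w => k * Y w)).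
Proof.
move=> iY; rewrite (_ : _ \o _ = fun w => (k%:E * (Y w)%:E)%E)//.
exact: integrableZl.
Qed.

Let integral_scale0 k (Y : T -> R) : P.-integrable setT (EFin \o Y) ->
  (\int[P]_w (Y w)%:E = 0)%E -> (\int[P]_w (k * Y w)%:E = 0)%E.
Proof.
move=> iY Y0.
under eq_integral do rewrite EFinM.
by rewrite integralZl// Y0 mule0.
Qed.

(** For [|l| <= 1] the linear Taylor term has mean zero and the quadratic one is at most 4 l^2
    exp(X^2), which gives 1 + 8 l^2. For larger [l], l X <= l^2/4 + X^2, and the factor 2 is
    absorbed since 2 <= e and l^2 >= 1. *)
Lemma subgaussian_mgf l :
  Ele P (fun w => expR (l * X w)) (expR (8 * l ^+ 2)).
Proof.
have mlX : measurable_fun setT (fun w => expR (l * X w)).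
  by apply: mexp; exact: measurable_funM.
have [l1|l1] := leP `|l| 1.
  apply: (@Ele_weak _ _ _ _ _ (1 + 4 * l ^+ 2 * 2)).
    by apply: le_trans (expR_ge1Dx _); lra.
  apply: (@Ele_center _ _ _ _ _
      (fun w => 1 + 4 * l ^+ 2 * expR (X w ^+ 2)) (fun w => l * X w)) => //.
  - exact: integrable_scale.
  - exact: integral_scale0.
  - move=> w; apply: le_trans (expR_le_quad _) _.
    suff : (l * X w) ^+ 2 * expR `|l * X w| <= 4 * l ^+ 2 * expR (X w ^+ 2) by lra.
    rewrite exprMn (_ : 4 * _ * _ = l ^+ 2 * (4 * expR (X w ^+ 2))); last by ring.
    rewrite -[leLHS]mulrA; apply: ler_wpM2l; first exact: sqr_ge0.
    have h1 : expR `|l * X w| <= expR (2^-1 + X w ^+ 2 / 2).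
      rewrite ler_expR normrM.
      apply: (@le_trans _ _ `|X w|); first by rewrite ler_piMl.
      have := sqr_ge0 (`|X w| - 1); rewrite -(real_normK (num_real (X w))).
      by set y := `|X w|; move=> *; nra.
    have h2 : X w ^+ 2 <= 4 * expR (X w ^+ 2 / 2) / 2.
      have h : 0 <= X w ^+ 2 / 2 by rewrite divr_ge0 ?sqr_ge0.
      by have := expR_ge1Dx (X w ^+ 2 / 2); lra.
    apply: le_trans (ler_pM (sqr_ge0 _) (expR_ge0 _) h2 h1) _.
    rewrite [in leRHS](_ : X w ^+ 2 = X w ^+ 2 / 2 + X w ^+ 2 / 2); last by lra.
    rewrite !expRD; set a := expR (_ / 2).
    have := expR_half_le2 R; have : 0 <= a by exact: expR_ge0.
    move=> a0 h; have : 0 <= a * a by rewrite mulr_ge0.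
    by move=> *; nra.
  - by apply: EleD; [exact: Ele_cst|apply: EleZ => //; rewrite mulr_ge0// sqr_ge0].
apply: (@Ele_le _ _ _ _ (fun w => expR (l ^+ 2 / 4) * expR (X w ^+ 2)) _
   (expR (l ^+ 2 / 4) * 2)) => //.
- move=> w; rewrite -expRD ler_expR.
  by have := sqr_ge0 (l / 2 - X w); move=> *; nra.
- have l2 : 1 <= l ^+ 2.
    by rewrite -(real_normK (num_real l)) expr_ge1// ltW.
  apply: (@le_trans _ _ (expR (l ^+ 2 / 4) * expR 1)).
    by rewrite ler_wpM2l ?expR_ge0 ?expR1_ge2.
  by rewrite -expRD ler_expR; lra.
- by apply: EleZ => //; exact: expR_ge0.
Qed.

Definition second_moment : R := fine (\int[P]_w (X w ^+ 2)%:E)%E.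

Let mX2 : measurable_fun setT (fun w => X w ^+ 2).
Proof. exact: measurable_funX. Qed.

Lemma second_moment_Ele : Ele P (fun w => X w ^+ 2) 1.
Proof.
split => //; first by move=> w; exact: sqr_ge0.
have : Ele P (fun w => 1 + X w ^+ 2) 2.
  apply: Ele_le sX => //.
  - by apply: measurable_funD.
  - by move=> w; rewrite addr_ge0// sqr_ge0.
  - by move=> w; exact: expR_ge1Dx.
move=> [_ _]; under eq_integral do rewrite EFinD.
rewrite ge0_integralD//; last 2 first.
- by move=> w _; rewrite lee_fin sqr_ge0.
- exact/measurable_EFinP.
rewrite integral_cst// [X in (_ * X + _)%E](_ : _ = 1%E); last exact: probability_setT.
rewrite mule1; case: (integral _ _ _) => [r| |]; rewrite ?leNye//.
by rewrite -EFinD !lee_fin; lra.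
Qed.

Lemma second_momentE : (\int[P]_w (X w ^+ 2)%:E = second_moment%:E)%E.
Proof.
rewrite /second_moment fineK//.
have [_ h0 h1] := second_moment_Ele.
rewrite ge0_fin_numE.
  by apply: le_lt_trans h1 _; exact: ltry.
by apply: integral_ge0 => w _; rewrite lee_fin.
Qed.

Lemma second_moment_ge0 : 0 <= second_moment.
Proof.
rewrite -lee_fin -second_momentE.
by apply: integral_ge0 => w _; rewrite lee_fin sqr_ge0.
Qed.

Lemma second_moment_le1 : second_moment <= 1.
Proof. by rewrite -lee_fin -second_momentE; case: second_moment_Ele. Qed.

Lemma sqr_center_integrable :
  P.-integrable setT (EFin \o (fun w => X w ^+ 2 - second_moment)).
Proof.
rewrite (_ : _ \o _ = (fun w => (X w ^+ 2)%:E - (cst second_moment%:E) w)%E)//.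
apply: integrableB => //.
- apply/integrableP; split; first exact/measurable_EFinP.
  under eq_integral do rewrite /= ger0_norm ?sqr_ge0//.
  by rewrite second_momentE ltry.
- by apply: finite_measure_integrable_cst.
Qed.

Lemma sqr_center_integral : (\int[P]_w (X w ^+ 2 - second_moment)%:E = 0)%E.
Proof.
have -> : (\int[P]_w (X w ^+ 2 - second_moment)%:E =
    \int[P]_w (X w ^+ 2)%:E - \int[P]_w second_moment%:E)%E.
  apply: (@integralB_EFin _ _ _ _ _ (fun w => X w ^+ 2)
    (cst second_moment)) => //.
  - apply/integrableP; split; first exact/measurable_EFinP.
    under eq_integral do rewrite /= ger0_norm ?sqr_ge0//.
    by rewrite second_momentE ltry.
  - exact: finite_measure_integrable_cst.
rewrite second_momentE integral_cst//.
rewrite [X in (_ - _ * X)%E](_ : _ = 1%E); last exact: probability_setT.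
by rewrite mule1 subee.
Qed.

(** Only exp(X^2) itself is integrable, which limits [b]. Writing z for the centred square, half of
    the weight e^|z| pays for e^|bz| and the other half for z^2; then |z| <= 1 + X^2 because the
    second moment lies in [0, 1]. *)
Lemma subexponential_mgf b : `|b| <= 2^-1 ->
  Ele P (fun w => expR (b * (X w ^+ 2 - second_moment))) (expR (64 * b ^+ 2)).
Proof.
move=> b1.
have mZ : measurable_fun setT (fun w => X w ^+ 2 - second_moment).
  exact: measurable_funB.
apply: (@Ele_weak _ _ _ _ _ (1 + 32 * b ^+ 2 * 2)).
  by apply: le_trans (expR_ge1Dx _); lra.
apply: (@Ele_center _ _ _ _ _ (fun w => 1 + 32 * b ^+ 2 * expR (X w ^+ 2))
    (fun w => b * (X w ^+ 2 - second_moment))) => //.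
- by apply: mexp; exact: measurable_funM.
- exact/integrable_scale/sqr_center_integrable.
- exact/integral_scale0/sqr_center_integral/sqr_center_integrable.
- move=> w; set z := X w ^+ 2 - second_moment.
  apply: le_trans (expR_le_quad _) _.
  suff : (b * z) ^+ 2 * expR `|b * z| <= 32 * b ^+ 2 * expR (X w ^+ 2) by lra.
  rewrite exprMn (_ : 32 * _ * _ = b ^+ 2 * (32 * expR (X w ^+ 2))); last by ring.
  rewrite -[leLHS]mulrA; apply: ler_wpM2l; first exact: sqr_ge0.
  have h1 : expR `|b * z| <= expR (`|z| / 2).
    by rewrite ler_expR normrM mulrC ler_wpM2l.
  have h2 : z ^+ 2 <= 8 * expR (`|z| / 2).
    have h : 0 <= `|z| / 2 by rewrite divr_ge0.
    have := sqr_le_expR h; rewrite -(real_normK (num_real z)).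
    by set y := `|z|; set E := expR _; move=> *; nra.
  apply: le_trans (ler_pM (sqr_ge0 _) (expR_ge0 _) h2 h1) _.
  rewrite -mulrA -expRD.
  have h3 : expR (`|z| / 2 + `|z| / 2) <= expR (1 + X w ^+ 2).
    rewrite ler_expR (_ : `|z| / 2 + _ = `|z|); last by lra.
    have s1 := second_moment_le1; have s0 := second_moment_ge0.
    have x0 := sqr_ge0 (X w); rewrite ler_norml /z.
    by apply/andP; split; lra.
  have : 8 * expR (`|z| / 2 + `|z| / 2) <= 8 * expR (1 + X w ^+ 2).
    by rewrite ler_wpM2l.
  move=> /le_trans; apply; rewrite expRD.
  have := expR1_le4 R; have := expR_ge0 (X w ^+ 2).
  by set E := expR (_ ^+ 2); set e := expR 1; move=> *; nra.
- by apply: EleD; [exact: Ele_cst|apply: EleZ => //; rewrite mulr_ge0// sqr_ge0].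
Qed.

End subgaussian_mgf.

(** * Khintchine and Bernstein moments *)

Lemma Ele_ext d (T : measurableType d) (R : realType) (P : probability T R)
  (f g : T -> R) (a b : R) : f =1 g -> a = b -> Ele P f a -> Ele P g b.
Proof. by move=> /funext -> ->. Qed.

Section independent_subgaussian.
Context d (T : measurableType d) (R : realType) (P : probability T R) (n : nat).
Variable X : 'I_n -> T -> R.

Definition independent_family := forall (J : {set 'I_n}) (B : 'I_n -> set R),
  (forall i, measurable (B i)) ->
  P (\bigcap_(i in [set` J]) (X i @^-1` B i)) =
  (\prod_(i in J) P (X i @^-1` B i))%E.

Hypothesis mX : forall i, measurable_fun setT (X i).
Hypothesis indX : independent_family.

Definition tup (w : T) : n.-tuple R := [tuple X i w | i < n].

(** Resampling the coordinates in [I] preserves the law. A bound with the other coordinates frozen,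
    uniform in their values, then integrates to the same bound. *)
Lemma Ele_condition (I : {set 'I_n}) (f : n.-tuple R -> R) (c : R) :
  measurable_fun setT f -> (forall t, 0 <= f t) -> 0 <= c ->
  (forall w2, Ele P
    (fun w1 => f [tuple if i \in I then X i w1 else X i w2 | i < n]) c) ->
  Ele P (fun w => f (tup w)) c.
Proof.
move=> mf f0 c0 fc; split => //.
  apply: measurableT_comp => //; apply/measurable_fun_tnthP => i.
  rewrite (_ : _ \o _ = X i)//.
  by apply/funext => w /=; rewrite tnth_mktuple.
rewrite (integral_indep_copy mX indX I (f := EFin \o f)).
- have [_ _] := Ele_cst P c0; apply: le_trans.
  apply: ge0_le_integral => //.
  + by move=> w2 _; apply: integral_ge0 => w1 _; rewrite lee_fin.
  + pose F (z : T * T) := (f [tuple if i \in I then X i z.2 else X i z.1 | i < n])%:E.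
    apply: (@measurable_fun_fubini_tonelli_F _ _ _ _ _ P F).
    * apply/measurable_EFinP/measurableT_comp => //.
      apply/measurable_fun_tnthP => i.
      have [iI|iI] := boolP (i \in I).
        rewrite (_ : _ \o _ = X i \o snd); first exact: measurableT_comp.
        by apply/funext => w /=; rewrite tnth_mktuple iI.
      rewrite (_ : _ \o _ = X i \o fst); first exact: measurableT_comp.
      by apply/funext => w /=; rewrite tnth_mktuple (negbTE iI).
    * by move=> z; rewrite lee_fin.
  + by move=> w2 _; case: (fc w2).
- exact/measurable_EFinP.
- by move=> t; rewrite lee_fin.
Qed.

(** Induction on the cardinality of [I]: resampling the single coordinate [i0] makes its factor come
    out of the inner integral. *)
Lemma Ele_indep_prod (g : 'I_n -> R -> R) (c : 'I_n -> R) (I : {set 'I_n}) :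
  (forall i, measurable_fun setT (g i)) -> (forall i x, 0 <= g i x) ->
  (forall i, i \in I -> Ele P (fun w => g i (X i w)) (c i)) ->
  Ele P (fun w => \prod_(i in I) g i (X i w)) (\prod_(i in I) c i).
Proof.
move=> mg g0; move: {2}#|I| (erefl #|I|) => k; elim: k I => [|k ih] I.
  move=> /cards0_eq -> _; apply: (@Ele_ext _ _ _ _ (fun=> 1) _ 1).
  - by move=> w; rewrite big_set0.
  - by rewrite big_set0.
  - exact: Ele_cst.
move=> cI gc; have /card_gt0P[i0 i0I] : (0 < #|I|)%N by rewrite cI.
have ihI : Ele P (fun w => \prod_(i in I :\ i0) g i (X i w))
    (\prod_(i in I :\ i0) c i).
  apply: ih => [|i]; last by rewrite in_setD1 => /andP[_]; exact: gc.
  by have := cardsD1 i0 I; rewrite i0I cI add1n => -[].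
have c0 i : i \in I -> 0 <= c i by move=> iI; exact: Ele_ge0 (gc _ iI).
pose f (t : n.-tuple R) := \prod_(i in I) g i (tnth t i).
have mt i : measurable_fun setT (fun t : n.-tuple R => g i (tnth t i)).
  by apply: measurableT_comp => //; exact: measurable_tnth.
have mf : measurable_fun setT f.
  rewrite /f (_ : (fun _ => _) =
    fun t => \prod_(i <- enum I) g i (tnth t i)); last first.
    by apply/funext => t; rewrite big_enum.
  by apply: measurable_prod => i _.
have f0 t : 0 <= f t by apply: prodr_ge0.
have [m0 p0 i0le] := gc _ i0I.
rewrite (big_setD1 i0 i0I)/=.
have mtup : measurable_fun setT tup.
  apply/measurable_fun_tnthP => i.
  by rewrite (_ : _ \o _ = X i)//; apply/funext => w /=; rewrite tnth_mktuple.
suff : Ele P (fun w => f (tup w)) (c i0 * \prod_(i in I :\ i0) c i).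
  apply: Ele_ext => // w; apply: eq_bigr => i _.
  by rewrite tnth_mktuple.
split => //; first exact: measurableT_comp.
rewrite (integral_indep_copy mX indX [set i0]%SET (f := EFin \o f)); last 2 first.
- exact/measurable_EFinP.
- by move=> t; rewrite lee_fin.
have [mr r0 rle] := EleZ (c0 _ i0I) ihI.
apply: le_trans rle.
have E w2 : (\int[P]_w1 (EFin \o f)
      [tuple if i \in [set i0]%SET then X i w1 else X i w2 | i < n] =
    (\prod_(i in I :\ i0) g i (X i w2))%:E *
    \int[P]_w1 (g i0 (X i0 w1))%:E)%E.
  rewrite -ge0_integralZl_EFin//.
  - apply: eq_integral => w1 _.
    rewrite /= /f (big_setD1 i0 i0I)/= tnth_mktuple inE eqxx -EFinM mulrC.
    congr ((_ * _)%:E); apply: eq_bigr => i.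
    by rewrite in_setD1 tnth_mktuple inE => /andP[/negbTE ->].
  - by move=> w1 _; rewrite lee_fin.
  - exact/measurable_EFinP.
  - by apply: prodr_ge0.
under eq_integral do rewrite E.
have [mq q0 _] := ihI.
apply: ge0_le_integral => //.
- move=> w _; apply: mule_ge0; first by rewrite lee_fin prodr_ge0.
  by apply: integral_ge0 => w1 _; rewrite lee_fin.
- apply: emeasurable_funM => //; exact/measurable_EFinP.
- exact/measurable_EFinP.
- move=> w _; rewrite EFinM [leRHS]muleC; apply: lee_wpmul2l => //.
  by rewrite lee_fin prodr_ge0.
Qed.

Hypothesis sX : forall i, Ele P (fun w => expR (X i w ^+ 2)) 2.
Hypothesis iX : forall i, P.-integrable setT (EFin \o X i).
Hypothesis X0 : forall i, (\int[P]_w (X i w)%:E = 0)%E.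

Local Notation v i := (second_moment P (X i)).

Let mexpR (f : R -> R) : measurable_fun setT f ->
  measurable_fun setT (fun x => expR (f x)).
Proof. by move=> mf; apply: measurableT_comp => //; exact: measurable_expR. Qed.

Lemma mgf_linear (I : {set 'I_n}) (c : 'I_n -> R) :
  Ele P (fun w => expR (\sum_(i in I) c i * X i w))
        (expR (8 * \sum_(i in I) c i ^+ 2)).
Proof.
rewrite mulr_sumr expR_sum.
apply: (@Ele_ext _ _ _ _ (fun w => \prod_(i in I) expR (c i * X i w))) => //.
  by move=> w; rewrite expR_sum.
apply: (@Ele_indep_prod (fun i x => expR (c i * x))) => //.
- by move=> i; apply: mexpR; exact: measurable_funM.
- by move=> i _; exact: subgaussian_mgf.
Qed.

Lemma mgf_centered_squares (I : {set 'I_n}) (b : 'I_n -> R) :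
  (forall i, i \in I -> `|b i| <= 2^-1) ->
  Ele P (fun w => expR (\sum_(i in I) b i * (X i w ^+ 2 - v i)))
        (expR (64 * \sum_(i in I) b i ^+ 2)).
Proof.
move=> b1; rewrite mulr_sumr expR_sum.
apply: (@Ele_ext _ _ _ _
    (fun w => \prod_(i in I) expR (b i * (X i w ^+ 2 - v i)))) => //.
  by move=> w; rewrite expR_sum.
apply: (@Ele_indep_prod (fun i x => expR (b i * (x ^+ 2 - v i)))) => //.
- by move=> i; apply: mexpR; apply: measurable_funM => //; exact: measurable_funB.
- by move=> i iI; apply: subexponential_mgf => //; exact: b1.
Qed.

Lemma mgf_sum_squares (I : {set 'I_n}) :
  Ele P (fun w => expR (\sum_(i in I) X i w ^+ 2)) (2 ^+ #|I|).
Proof.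
rewrite -prodr_const.
apply: (@Ele_ext _ _ _ _ (fun w => \prod_(i in I) expR (X i w ^+ 2))) => //.
  by move=> w; rewrite expR_sum.
apply: (@Ele_indep_prod (fun i x => expR (x ^+ 2))) => //.
- by move=> i; apply: mexpR.
Qed.

(** Since x^q <= q^q e^x, the only loss is 2^|I|, which is at most 2^q for so few summands; the q-th
    root is of order q, independently of n. *)
Lemma moment_sum_squares (I : {set 'I_n}) (q : nat) : (#|I| <= q)%N ->
  Ele P (fun w => (\sum_(i in I) X i w ^+ 2) ^+ q) ((2 * q%:R) ^+ q).
Proof.
move=> Iq; rewrite exprMn mulrC.
apply: (Ele_le _ _ _ _ (EleZ (k := q%:R ^+ q) _ (mgf_sum_squares I))).
- apply: measurable_funX.
  rewrite (_ : (fun _ => _) = fun w => \sum_(i <- enum I) X i w ^+ 2).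
    by apply: measurable_sum => i; exact: measurable_funX.
  by apply/funext => w; rewrite big_enum.
- by move=> w; apply/exprn_ge0/sumr_ge0 => i _; exact: sqr_ge0.
- move=> w; apply: le_trans (expr_le_fact_expR _ _) _.
    by apply: sumr_ge0 => i _; exact: sqr_ge0.
  by rewrite ler_wpM2r ?expR_ge0// -natrX ler_nat fact_le_expn.
- by rewrite ler_wpM2l ?exprn_ge0// ler_eXn2l// ltr1n.
- by rewrite exprn_ge0.
Qed.

(** The factors are 2 from rescaling by 2B, 2 from the two-sided exponential, and e^16 from the
    exponent 16 r. *)
Definition bernstein_const : R := 4 * expR 16.

Lemma bernstein_const_gt0 : 0 < bernstein_const.
Proof. by rewrite mulr_gt0// expR_gt0. Qed.

Let msum (I : {set 'I_n}) (f : 'I_n -> T -> R) :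
  (forall i, measurable_fun setT (f i)) ->
  measurable_fun setT (fun w => \sum_(i in I) f i w).
Proof.
move=> mf; rewrite (_ : (fun _ => _) = fun w => \sum_(i <- enum I) f i w).
  exact: measurable_sum.
by apply/funext => w; rewrite big_enum.
Qed.

(** The Laplace transform is taken at r / (2B). The bound on the single coefficients keeps the
    scaled ones in the range 1/2, and the bound on their squares keeps the exponent below 16 r,
    whose r-th root is a constant. *)
Lemma bernstein_moment (I : {set 'I_n}) (b : 'I_n -> R) (B : R) (r : nat) :
  (0 < r)%N -> 0 <= B ->
  (forall i, i \in I -> r%:R * `|b i| <= B) ->
  r%:R * (\sum_(i in I) b i ^+ 2) <= B ^+ 2 ->
  Ele P (fun w => `|\sum_(i in I) b i * (X i w ^+ 2 - v i)| ^+ r)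
        ((bernstein_const * B) ^+ r).
Proof.
move=> r0 B0 bB bB2.
have mU : measurable_fun setT
    (fun w => `|\sum_(i in I) b i * (X i w ^+ 2 - v i)| ^+ r).
  apply: measurable_funX; apply: measurableT_comp => //.
  apply: msum => i; apply: measurable_funM => //; apply: measurable_funB => //.
  exact: measurable_funX.
have U0 w : 0 <= `|\sum_(i in I) b i * (X i w ^+ 2 - v i)| ^+ r.
  by rewrite exprn_ge0.
have rR : 0 < r%:R :> R by rewrite ltr0n.
(* The rescaling divides by [B]; if [B] is 0, all coefficients vanish. *)
move: B0; rewrite le_eqVlt => /predU1P[B0|B0].
  have b0 i : i \in I -> b i = 0.
    move=> iI; have := bB i iI; rewrite -B0 pmulr_rle0// normr_le0.
    by move/eqP.
  apply: (Ele_le mU U0 _ _ (Ele_cst P (lexx 0))); last first.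
    by rewrite exprn_ge0// -B0 mulr0.
  move=> w; rewrite big1 ?normr0 ?expr0n ?gtn_eqF//.
  by move=> i iI; rewrite b0// mul0r.
pose be i := r%:R * b i / (2 * B).
have be1 i : i \in I -> `|be i| <= 2^-1.
  move=> iI; rewrite /be normrM normrM (ger0_norm (ltW rR)).
  rewrite [`|(2 * B)^-1|]ger0_norm; last by rewrite invr_ge0 mulr_ge0// ltW.
  by rewrite ler_pdivrMr ?mulr_gt0// mulrA mulVf// mul1r; exact: bB.
have be2 : 64 * \sum_(i in I) be i ^+ 2 <= 16 * r%:R.
  rewrite (eq_bigr (fun i => (r%:R / (2 * B)) ^+ 2 * b i ^+ 2)); last first.
    by move=> i _; rewrite /be -exprMn; congr (_ ^+ 2); ring.
  rewrite -mulr_sumr; move: bB2; set S := \sum_(i in I) _ => bB2.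
  have h : r%:R * (r%:R * S) / (4 * B ^+ 2) <= r%:R / 4.
    rewrite ler_pdivrMr; last by rewrite mulr_gt0// exprn_gt0.
    rewrite (_ : r%:R / 4 * _ = r%:R * B ^+ 2); last by field.
    by rewrite ler_wpM2l// ltW.
  have -> : (r%:R / (2 * B)) ^+ 2 * S = r%:R * (r%:R * S) / (4 * B ^+ 2).
    by field; rewrite gt_eqF.
  by move: h; lra.
have P1 := mgf_centered_squares be1.
have P2 : Ele P (fun w => expR (\sum_(i in I) - be i * (X i w ^+ 2 - v i)))
        (expR (64 * \sum_(i in I) be i ^+ 2)).
  have := @mgf_centered_squares I (fun i => - be i).
  rewrite (eq_bigr (fun i => be i ^+ 2)); last by move=> i _; rewrite sqrrN.
  by apply=> i iI; rewrite normrN; exact: be1.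
apply: (Ele_le mU U0 _ _ (EleZ (k := (2 * B) ^+ r) _ (EleD P1 P2))).
- move=> w; set u := \sum_(i in I) _.
  have E : \sum_(i in I) be i * (X i w ^+ 2 - v i) = r%:R * u / (2 * B).
    rewrite /u mulr_sumr mulr_suml; apply: eq_bigr => i _.
    by rewrite /be; ring.
  under [X in _ + expR X]eq_bigr do rewrite mulNr.
  rewrite sumrN E; set y := _ / _.
  have yE : `|u| = 2 * B / r%:R * `|y|.
    rewrite /y normrM normrM (ger0_norm (ltW rR)) [`|_^-1|]ger0_norm.
      by field; rewrite !gt_eqF.
    by rewrite invr_ge0 mulr_ge0// ltW.
  rewrite yE exprMn expr_div_n -mulrA.
  apply: ler_wpM2l; first by rewrite exprn_ge0// mulr_ge0// ltW.
  by rewrite mulrC ler_pdivrMr ?exprn_gt0// mulrC norm_exprn_le_expR.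
- rewrite (_ : bernstein_const * B = (2 * B) * (2 * expR 16)); last first.
    by rewrite /bernstein_const; ring.
  rewrite [leRHS]exprMn; apply: ler_wpM2l; first by rewrite exprn_ge0// mulr_ge0// ltW.
  have h : expR (64 * \sum_(i in I) be i ^+ 2) <= expR 16 ^+ r.
    by rewrite -expRM_natr ler_expR.
  have h2 : 2 <= 2 ^+ r :> R by rewrite -[leLHS]expr1 ler_eXn2l// ltr1n.
  rewrite exprMn.
  have h3 : 2 * expR 16 ^+ r <= 2 ^+ r * expR 16 ^+ r :> R.
    by rewrite ler_wpM2r// exprn_ge0// expR_ge0.
  by move: h h3; lra.
- by rewrite exprn_ge0// mulr_ge0// ltW.
Qed.

Definition khintchine_const : R := 2 * expR 8.

(** The coefficients may be random but depend only on coordinates outside [I]. Freezing these leaves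
    a linear form with fixed coefficients, whose Laplace transform is taken at plus and minus sqrt
    q. *)
Lemma khintchine_moment (I : {set 'I_n}) (c : 'I_n -> n.-tuple R -> R) (q : nat) :
  (0 < q)%N ->
  (forall i, measurable_fun setT (c i)) ->
  (forall i (t t' : n.-tuple R), i \in I ->
    (forall j, j \notin I -> tnth t j = tnth t' j) -> c i t = c i t') ->
  (forall t, \sum_(i in I) c i t ^+ 2 <= 1) ->
  Ele P (fun w => `|\sum_(i in I) c i (tup w) * X i w| ^+ q)
        ((khintchine_const * Num.sqrt q%:R) ^+ q).
Proof.
move=> q0 mc cI c1.
have qR : 0 < q%:R :> R by rewrite ltr0n.
have sq0 : 0 < Num.sqrt q%:R :> R by rewrite sqrtr_gt0.
pose f (t : n.-tuple R) := `|\sum_(i in I) c i t * tnth t i| ^+ q.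
apply: (@Ele_ext _ _ _ _ (fun w => f (tup w))) => //.
  move=> w; rewrite /f; congr (`|_| ^+ q); apply: eq_bigr => i _.
  by rewrite tnth_mktuple.
have mf : measurable_fun setT f.
  apply: measurable_funX; apply: measurableT_comp => //.
  rewrite (_ : (fun _ => _) =
    fun t : n.-tuple R => \sum_(i <- enum I) c i t * tnth t i); last first.
    by apply/funext => w; rewrite big_enum.
  apply: measurable_sum => i; apply: measurable_funM => //.
  exact: measurable_tnth.
apply: (@Ele_condition I) => //.
- by move=> t; rewrite exprn_ge0.
- by rewrite exprn_ge0// !mulr_ge0// expR_ge0.
move=> w2.
pose a i := Num.sqrt q%:R * c i (tup w2).
have a2 : 8 * \sum_(i in I) a i ^+ 2 <= 8 * q%:R.
  apply: ler_wpM2l => //.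
  rewrite (eq_bigr (fun i => q%:R * c i (tup w2) ^+ 2)); last first.
    by move=> i _; rewrite /a exprMn sqr_sqrtr// ltW.
  by rewrite -mulr_sumr -[leRHS]mulr1 ler_wpM2l// ltW.
have P1 := mgf_linear I a.
have P2 : Ele P (fun w => expR (\sum_(i in I) - a i * X i w))
        (expR (8 * \sum_(i in I) a i ^+ 2)).
  have := @mgf_linear I (fun i => - a i).
  by rewrite (eq_bigr (fun i => a i ^+ 2))// => i _; rewrite sqrrN.
have E w1 : f [tuple if i \in I then X i w1 else X i w2 | i < n] =
    `|\sum_(i in I) c i (tup w2) * X i w1| ^+ q.
  rewrite /f; congr (`|_| ^+ q); apply: eq_bigr => i iI.
  rewrite tnth_mktuple iI; congr (_ * _); apply: cI => // j jI.
  by rewrite !tnth_mktuple (negbTE jI).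
apply: (Ele_le _ _ _ _ (EleZ (k := Num.sqrt q%:R ^+ q) _ (EleD P1 P2))).
- rewrite (_ : (fun _ => _) =
    fun w1 => `|\sum_(i in I) c i (tup w2) * X i w1| ^+ q); last exact/funext.
  apply: measurable_funX; apply: measurableT_comp => //.
  by apply: msum => i; exact: measurable_funM.
- by move=> w1; rewrite exprn_ge0.
- move=> w1; rewrite E; set u := \sum_(i in I) _.
  have E1 : \sum_(i in I) a i * X i w1 = Num.sqrt q%:R * u.
    by rewrite /u mulr_sumr; apply: eq_bigr => i _; rewrite /a mulrA.
  under [X in _ + expR X]eq_bigr do rewrite mulNr.
  rewrite sumrN E1; set y := Num.sqrt _ * _.
  have yE : `|u| = Num.sqrt q%:R / q%:R * `|y|.
    rewrite /y normrM [`|Num.sqrt _|]ger0_norm//.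
    have : Num.sqrt q%:R ^+ 2 = q%:R :> R by rewrite sqr_sqrtr// ltW.
    by move: sq0; set s := Num.sqrt _ => sq0 <-; field; rewrite gt_eqF.
  rewrite yE exprMn expr_div_n -mulrA.
  apply: ler_wpM2l; first by rewrite exprn_ge0// ltW.
  by rewrite mulrC ler_pdivrMr ?exprn_gt0// mulrC norm_exprn_le_expR.
- rewrite exprMn [leRHS]mulrC; apply: ler_wpM2l; first by rewrite exprn_ge0.
  have h : expR (8 * \sum_(i in I) a i ^+ 2) <= expR 8 ^+ q.
    by rewrite -expRM_natr ler_expR.
  have h2 : 2 <= 2 ^+ q :> R by rewrite -[leLHS]expr1 ler_eXn2l// ltr1n.
  rewrite exprMn.
  have h3 : 2 * expR 8 ^+ q <= 2 ^+ q * expR 8 ^+ q :> R.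
    by rewrite ler_wpM2r// exprn_ge0// expR_ge0.
  by move: h h3; lra.
- by rewrite exprn_ge0.
Qed.

End independent_subgaussian.

(** * Generic chaining *)

Lemma measurable_bigmaxr d (T : measurableType d) (R : realType) (I : eqType)
    (s : seq I) (h : I -> T -> R) :
  (forall i, i \in s -> measurable_fun setT (h i)) ->
  measurable_fun setT (fun w => \big[Num.max/0]_(i <- s) h i w).
Proof.
elim: s => [mh|i s ih mh].
  under eq_fun do rewrite big_nil.
  exact: measurable_cst.
under eq_fun do rewrite big_cons.
apply: measurable_maxr; first by apply: mh; rewrite mem_head.
by apply: ih => j js; apply: mh; rewrite inE js orbT.
Qed.

Lemma le_bigmaxr_seq (R : realType) (I : eqType) (s : seq I) (h : I -> R) i :
  i \in s -> h i <= \big[Num.max/0]_(j <- s) h j.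
Proof.
elim: s => // j s ih; rewrite inE big_cons le_max => /predU1P[->|/ih ->].
  by rewrite lexx.
by rewrite orbT.
Qed.

Lemma bigmaxr_ge0 (R : realType) (I : eqType) (s : seq I) (h : I -> R) :
  0 <= \big[Num.max/0]_(j <- s) h j.
Proof.
elim: s => [|j s ih]; first by rewrite big_nil.
by rewrite big_cons le_max ih orbT.
Qed.

Lemma le_sumr_seq (R : realType) (I : eqType) (s : seq I) (h : I -> R) i :
  (forall j, 0 <= h j) -> i \in s -> h i <= \sum_(j <- s) h j.
Proof. by move=> h0 si; rewrite (big_rem i)//= lerDl sumr_ge0. Qed.

Section chaining.
Context d (T : measurableType d) (R : realType) (P : probability T R).
Variables (Th : Type) (Om : eqType) (l N : nat).
Variables (F : Om -> T -> R) (dd : Om -> Om -> R) (H : T -> R).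
Variables (Y : nat -> Om -> Om -> T -> R) (c g : R).
Variables (s : nat -> seq Om) (pi : nat -> Th -> Om).
Hypothesis lN : (l <= N)%N.
Hypothesis c0 : 0 < c.
Hypothesis dd0 : forall a b, 0 <= dd a b.
Hypothesis H0 : forall w, 0 <= H w.
Hypothesis Y0 : forall q a b w, 0 <= Y q a b w.
Hypothesis mY : forall q a b, measurable_fun setT (Y q a b).
Hypothesis Yc : forall q a b, (0 < q)%N ->
  Ele P (fun w => Y q a b w ^+ q) (c ^+ q).
Hypothesis FY : forall q a b w, (0 < q)%N ->
  `|F b w - F a w| <= dd a b * Num.sqrt q%:R * Y q a b w * H w.
Hypothesis ss : forall k, (l <= k <= N)%N -> (size (s k) <= 2 ^ (2 ^ k))%N.
Hypothesis pis : forall k t, (l <= k <= N)%N -> pi k t \in s k.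
Hypothesis pig : forall t,
  \sum_(l <= k < N) Num.sqrt (2 ^+ k) * dd (pi k t) (pi k.+1 t) <= g.

(** Level k has at most 2^(3 * 2^k) pairs. The exponent 4 * 2^k exceeds log2 of this number by 2^k,
    and the surplus makes the sum over the levels converge. *)
Let q k := (2 ^ k.+2)%N.
Let pairs k := [seq (a, b) | a <- s k, b <- s k.+1].
Let M w := \big[Num.max/0]_(k <- index_iota l N)
  \big[Num.max/0]_(p <- pairs k) Y (q k) p.1 p.2 w.

Let mM : measurable_fun setT M.
Proof.
apply: measurable_bigmaxr => k _.
by apply: measurable_bigmaxr => p _.
Qed.

Let M0 w : 0 <= M w.
Proof. exact: bigmaxr_ge0. Qed.

Let q_gt0 k : (0 < q k)%N.
Proof. by rewrite expn_gt0. Qed.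

(** The factor 2 is sqrt(q k) / sqrt(2^k); one maximum [M] serves all links, all levels and all
    points. *)
Let chain_bound t w : `|F (pi N t) w - F (pi l t) w| <= g * (2 * M w) * H w.
Proof.
rewrite -(telescope_sumr (fun k => F (pi k t) w) lN).
apply: le_trans (ler_norm_sum _ _ _) _.
apply: (@le_trans _ _ (\sum_(l <= k < N)
    (Num.sqrt (2 ^+ k) * dd (pi k t) (pi k.+1 t)) * (2 * M w * H w))).
  apply: ler_sum_nat => k /andP[lk kN].
  apply: le_trans (FY _ _ _ (q_gt0 k)) _.
  have -> : Num.sqrt (q k)%:R = 2 * Num.sqrt (2 ^+ k) :> R.
    rewrite /q natrX -[k.+2]addn2 exprD sqrtrM ?exprn_ge0// sqrtr_sqr mulrC.
    by rewrite ger0_norm.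
  rewrite (_ : _ * _ * _ * H w = Num.sqrt (2 ^+ k) * dd (pi k t) (pi k.+1 t) *
    (2 * Y (q k) (pi k t) (pi k.+1 t) w * H w)); last by ring.
  apply: ler_wpM2l; first by rewrite mulr_ge0 ?sqrtr_ge0.
  apply: ler_wpM2r => //; apply: ler_wpM2l => //.
  have kmem : k \in index_iota l N by rewrite mem_index_iota lk kN.
  have pmem : (pi k t, pi k.+1 t) \in pairs k.
    apply/allpairsP; exists (pi k t, pi k.+1 t); split => //=; apply: pis.
      by rewrite lk ltnW.
    by rewrite ltnW.
  apply: le_trans (le_bigmaxr_seq _ kmem).
  exact: (le_bigmaxr_seq (fun p => Y (q k) p.1 p.2 w) pmem).
rewrite -mulr_suml -[leRHS]mulrA; apply: ler_wpM2r => //.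
by rewrite !mulr_ge0.
Qed.

(** Truncate at L = 4c. A factor above L satisfies (Y/L)^(2^(l+2)) <= (Y/L)^(q k), because no level
    below l occurs, and the expectation of the right side is at most 4^(-q k). A union bound over
    the pairs leaves at most 2^(-k-1) per level, which telescopes. *)
Let moment_bound : Ele P (fun w => M w ^+ (2 ^ l.+2)) ((8 * c) ^+ (2 ^ l.+2)).
Proof.
set r2 := (2 ^ l.+2)%N; pose L := 4 * c.
have L0 : 0 < L by rewrite mulr_gt0.
have LL0 : 0 < L ^+ r2 by rewrite exprn_gt0.
pose Z w := L ^+ r2 * (1 + \sum_(k <- index_iota l N) \sum_(p <- pairs k)
  L ^- (q k) * Y (q k) p.1 p.2 w ^+ (q k)).
have in0 k p w : 0 <= L ^- (q k) * Y (q k) p.1 p.2 w ^+ (q k).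
  by rewrite mulr_ge0// ?invr_ge0 exprn_ge0// ltW.
have MZ w : M w ^+ r2 <= Z w.
  have Z0 : 0 <= Z w.
    rewrite mulr_ge0 ?(ltW LL0)// addr_ge0//.
    by apply: sumr_ge0 => k _; exact: sumr_ge0.
  have base : (0 : R) ^+ r2 <= Z w by rewrite expr0n gtn_eqF// expn_gt0.
  have cl x y : x ^+ r2 <= Z w -> y ^+ r2 <= Z w -> Num.max x y ^+ r2 <= Z w.
    by move=> hx hy; case: (leP x y).
  rewrite /M big_seq; apply: (big_ind (fun x => x ^+ r2 <= Z w)) => // k kmem.
  rewrite big_seq; apply: (big_ind (fun x => x ^+ r2 <= Z w)) => // p pmem.
  set y := Y _ _ _ _; have y0 : 0 <= y by exact: Y0.
  have [yL|Ly] := leP y L.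
    apply: (@le_trans _ _ (L ^+ r2)).
      by apply: lerXn2r => //; rewrite nnegrE// ltW.
    rewrite /Z ler_peMr ?(ltW LL0)// lerDl.
    by apply: sumr_ge0 => j _; exact: sumr_ge0.
  have yL1 : 1 <= y / L by rewrite ler_pdivlMr// mul1r ltW.
  apply: (@le_trans _ _ (L ^+ r2 * (y / L) ^+ r2)).
    by rewrite -exprMn mulrC divfK// gt_eqF.
  apply: ler_wpM2l; first exact: ltW.
  apply: (@le_trans _ _ ((y / L) ^+ (q k))).
    apply: ler_weXn2l => //; rewrite leq_exp2l// !ltnS.
    by move: kmem; rewrite mem_index_iota => /andP[].
  rewrite -[leLHS]add0r lerD//.
  have S0 j : 0 <= \sum_(p <- pairs j)
      L ^- (q j) * Y (q j) p.1 p.2 w ^+ (q j) by exact: sumr_ge0.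
  apply: le_trans (le_sumr_seq S0 kmem).
  rewrite expr_div_n mulrC.
  exact: (le_sumr_seq (in0 k ^~ w) pmem).
apply: (@Ele_le _ _ _ _ Z _
    (L ^+ r2 * (1 + \sum_(k <- index_iota l N) \sum_(p <- pairs k)
       L ^- (q k) * c ^+ (q k)))) => //.
- exact: measurable_funX.
- by move=> w; rewrite exprn_ge0.
- rewrite (_ : 8 * c = L * 2); last by rewrite /L; ring.
  rewrite [leRHS]exprMn ler_wpM2l ?(ltW LL0)//.
  have le2 : \sum_(k <- index_iota l N) \sum_(p <- pairs k)
       L ^- (q k) * c ^+ (q k) <= \sum_(l <= k < N) (2 ^- k - 2 ^- k.+1 : R).
    apply: ler_sum_nat => k /andP[lk kN].
    rewrite big_const_seq count_predT iter_addr_0 size_allpairs.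
    have -> : L ^- q k * c ^+ q k = 2 ^- q k * 2 ^- q k.
      rewrite -exprVn -!exprVn -!exprMn; congr (_ ^+ _).
      by rewrite /L; field; rewrite gt_eqF.
    have -> : 2 ^- k - 2 ^- k.+1 = 2 ^- k.+1 :> R.
      rewrite -!exprVn exprS; set x := _ ^+ k; lra.
    have h1 : (size (s k) * size (s k.+1))%:R <= 2 ^+ q k :> R.
      rewrite -natrX ler_nat; apply: (@leq_trans (2 ^ 2 ^ k * 2 ^ 2 ^ k.+1)).
        by apply: leq_mul; apply: ss; [rewrite lk ltnW|rewrite kN leqW].
      rewrite -expnD leq_exp2l// /q !expnS; lia.
    have h2 : 2 ^- q k <= 2 ^- k.+1 :> R.
      rewrite lef_pV2 ?posrE ?exprn_gt0// ler_eXn2l// ?ltr1n//.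
      by rewrite /q ltnW// ltnW// ltn_expl.
    rewrite -[leLHS]mulr_natr; apply: le_trans h2.
    rewrite -mulrA ler_piMr ?invr_ge0 ?exprn_ge0//.
    by rewrite mulrC ler_pdivrMr ?exprn_gt0// mul1r.
  have tel : \sum_(l <= k < N) (2 ^- k - 2 ^- k.+1 : R) = 2 ^- l - 2 ^- N.
    have := telescope_sumr (fun k => - 2 ^- k : R) lN.
    by rewrite opprK addrC => <-; apply: eq_bigr => k _; rewrite opprK addrC.
  have l1 : 2 ^- l <= 1 :> R by rewrite invf_le1 ?exprn_gt0// exprn_ege1// ler1n.
  have N0 : 0 <= 2 ^- N :> R by rewrite invr_ge0 exprn_ge0.
  have r21 : 2 <= 2 ^+ r2 :> R.
    by rewrite -[leLHS]expr1 ler_eXn2l ?ltr1n// expn_gt0.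
  by move: le2; rewrite tel; lra.
- apply: EleZ; first exact: ltW.
  apply: EleD; first exact: Ele_cst.
  apply: Ele_sum => k _; apply: Ele_sum => p _.
  apply: EleZ; first by rewrite invr_ge0 exprn_ge0// ltW.
  exact: Yc.
Qed.

(** The factor [H], common to all increments, stays outside the maximum. It can thus be a supremum
    that depends on the process being estimated, as absorption demands. *)
Lemma chaining : exists W : T -> R, [/\ forall w, 0 <= W w,
  measurable_fun setT W,
  Ele P (fun w => W w ^+ (2 ^ l.+2)) ((16 * c) ^+ (2 ^ l.+2)) &
  forall t w, `|F (pi N t) w - F (pi l t) w| <= g * W w * H w].
Proof.
exists (fun w => 2 * M w); split => //.
- by move=> w; rewrite mulr_ge0.
- exact: measurable_funM.
- apply: (@Ele_ext _ _ _ _ (fun w => 2 ^+ (2 ^ l.+2) * M w ^+ (2 ^ l.+2)) _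
    (2 ^+ (2 ^ l.+2) * (8 * c) ^+ (2 ^ l.+2))).
  + by move=> w; rewrite -exprMn.
  + by rewrite -exprMn mulrA; congr ((_ * _) ^+ _); lra.
  + by apply: EleZ => //; exact: exprn_ge0.
Qed.

End chaining.

(** * Decoupling *)

Section cauchy_schwarz.
Variable R : realType.

Lemma cauchy_schwarz_sum (I : finType) (Q : pred I) (a b : I -> R) :
  (\sum_(i | Q i) a i * b i) ^+ 2 <=
  (\sum_(i | Q i) a i ^+ 2) * (\sum_(i | Q i) b i ^+ 2).
Proof.
rewrite -subr_ge0 -(@pmulr_rge0 _ 2)//.
(* Lagrange's identity. *)
suff -> : 2 * ((\sum_(i | Q i) a i ^+ 2) * (\sum_(i | Q i) b i ^+ 2) -
    (\sum_(i | Q i) a i * b i) ^+ 2) =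
    \sum_(i | Q i) \sum_(j | Q j) (a i * b j - a j * b i) ^+ 2.
  by apply: sumr_ge0 => i _; apply: sumr_ge0 => j _; exact: sqr_ge0.
have E (f g : I -> R) : (\sum_(i | Q i) f i) * (\sum_(i | Q i) g i) =
    \sum_(i | Q i) \sum_(j | Q j) f i * g j.
  by rewrite mulr_suml; apply: eq_bigr => i _; rewrite mulr_sumr.
rewrite mulrBr mulr_natl mulr2n {1}E [X in _ + X - _]mulrC {1}E expr2 {1}E.
rewrite -big_split/= mulr_sumr -sumrB; apply: eq_bigr => i _.
rewrite -big_split/= mulr_sumr -sumrB; apply: eq_bigr => j _.
by ring.
Qed.

Lemma cauchy_schwarz_sqrt (I : finType) (Q : pred I) (a b : I -> R) :
  `|\sum_(i | Q i) a i * b i| <=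
  Num.sqrt (\sum_(i | Q i) a i ^+ 2) * Num.sqrt (\sum_(i | Q i) b i ^+ 2).
Proof.
rewrite -sqrtr_sqr -sqrtrM; last by apply: sumr_ge0 => i _; exact: sqr_ge0.
by rewrite ler_sqrt ?cauchy_schwarz_sum// mulr_ge0// sumr_ge0// => i _;
  exact: sqr_ge0.
Qed.

End cauchy_schwarz.

(** * Euclidean vectors, columns and Gram matrices *)

Section euclidean.
Variable R : realType.

Definition dotv m (u v : 'cV[R]_m) : R := \sum_i u i 0 * v i 0.
Definition nrm m (u : 'cV[R]_m) : R := Num.sqrt (dotv u u).

Lemma dotvC m (u v : 'cV[R]_m) : dotv u v = dotv v u.
Proof. by apply: eq_bigr => i _; rewrite mulrC. Qed.

Lemma dotvDl m (u v w : 'cV[R]_m) : dotv (u + v) w = dotv u w + dotv v w.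
Proof. by rewrite -big_split; apply: eq_bigr => i _; rewrite !mxE mulrDl. Qed.

Lemma dotvNl m (u v : 'cV[R]_m) : dotv (- u) v = - dotv u v.
Proof. by rewrite -sumrN; apply: eq_bigr => i _; rewrite !mxE mulNr. Qed.

Lemma dotvDr m (u v w : 'cV[R]_m) : dotv w (u + v) = dotv w u + dotv w v.
Proof. by rewrite dotvC dotvDl !(dotvC w). Qed.

Lemma dotvNr m (u v : 'cV[R]_m) : dotv u (- v) = - dotv u v.
Proof. by rewrite dotvC dotvNl dotvC. Qed.

Lemma dotv0l m (u : 'cV[R]_m) : dotv 0 u = 0.
Proof. by apply: big1 => i _; rewrite mxE mul0r. Qed.

Lemma dotv_mulmxl m n (A : 'M[R]_(m, n)) u v :
  dotv (A *m u) v = dotv u (A^T *m v).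
Proof.
rewrite /dotv.
under eq_bigr do rewrite mxE mulr_suml.
rewrite exchange_big; apply: eq_bigr => j _.
rewrite mxE mulr_sumr; apply: eq_bigr => i _.
by rewrite mxE mulrA [A i j * _]mulrC.
Qed.

Lemma dotv_ge0 m (u : 'cV[R]_m) : 0 <= dotv u u.
Proof. by apply: sumr_ge0 => i _; rewrite -expr2 sqr_ge0. Qed.

Lemma dotvE m (u : 'cV[R]_m) : dotv u u = \sum_i u i 0 ^+ 2.
Proof. by apply: eq_bigr => i _; rewrite expr2. Qed.

Lemma nrm_ge0 m (u : 'cV[R]_m) : 0 <= nrm u.
Proof. exact: sqrtr_ge0. Qed.

Lemma nrm_sqr m (u : 'cV[R]_m) : nrm u ^+ 2 = dotv u u.
Proof. by rewrite sqr_sqrtr// dotv_ge0. Qed.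

Lemma nrm0 m : nrm (0 : 'cV[R]_m) = 0.
Proof. by rewrite /nrm dotv0l sqrtr0. Qed.

Lemma nrm_eq0 m (u : 'cV[R]_m) : nrm u = 0 -> u = 0.
Proof.
move=> u0; have := nrm_sqr u; rewrite u0 expr0n/= dotvE => /esym/eqP.
rewrite psumr_eq0 => [/allP h|i _]; last exact: sqr_ge0.
apply/matrixP => i j; rewrite ord1 mxE.
by have := h i (mem_index_enum i); rewrite /= sqrf_eq0 => /eqP.
Qed.

Lemma norm_dotv_le m (u v : 'cV[R]_m) : `|dotv u v| <= nrm u * nrm v.
Proof. by rewrite /nrm !dotvE; exact: cauchy_schwarz_sqrt. Qed.

Lemma nrm_sqrB m (u v : 'cV[R]_m) :
  `|nrm u ^+ 2 - nrm v ^+ 2| <= nrm (u - v) * (nrm u + nrm v).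
Proof.
rewrite !nrm_sqr (_ : _ - _ = dotv (u - v) u + dotv (u - v) v).
  apply: le_trans (ler_normD _ _) _.
  by rewrite mulrDr lerD// norm_dotv_le.
by rewrite !dotvDl !dotvNl (dotvC v u); ring.
Qed.

(** The adjoint is tested on its own value: with z = D^T y, |z|^2 = <D z, y>, and one factor |z|
    cancels. *)
Lemma adjoint_bound m n (D : 'M[R]_(m, n)) (d : R) :
  0 <= d -> (forall x, nrm (D *m x) <= d * nrm x) ->
  forall y, nrm (D^T *m y) <= d * nrm y.
Proof.
move=> d0 Dd y; set z := D^T *m y.
have [z0|z0] := eqVneq (nrm z) 0; first by rewrite z0 mulr_ge0// nrm_ge0.
have zp : 0 < nrm z by rewrite lt_def z0 nrm_ge0.
rewrite -(ler_pM2l zp) -expr2.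
have -> : nrm z ^+ 2 = dotv (D *m z) y by rewrite nrm_sqr dotv_mulmxl.
apply: ler_normlW; apply: le_trans (norm_dotv_le _ _) _.
by rewrite mulrA [nrm z * d]mulrC ler_wpM2r ?nrm_ge0.
Qed.

Definition frob2 m n (A : 'M[R]_(m, n)) : R := \sum_i \sum_j A i j ^+ 2.

Definition colsq m n (A : 'M[R]_(m, n)) (i : 'I_n) : R := \sum_k A k i ^+ 2.

Lemma colsq_ge0 m n (A : 'M[R]_(m, n)) i : 0 <= colsq A i.
Proof. by apply: sumr_ge0 => k _; exact: sqr_ge0. Qed.

Lemma sum_colsq m n (A : 'M[R]_(m, n)) : \sum_i colsq A i = frob2 A.
Proof. by rewrite /frob2 exchange_big. Qed.

Lemma colsqE m n (A : 'M[R]_(m, n)) i :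
  colsq A i = nrm (A *m delta_mx i 0) ^+ 2.
Proof.
rewrite nrm_sqr dotvE; apply: eq_bigr => k _; congr (_ ^+ 2).
by rewrite -colE mxE.
Qed.

Lemma nrm_delta n (i : 'I_n) : nrm (delta_mx i 0 : 'cV[R]_n) = 1.
Proof.
rewrite /nrm dotvE (bigD1 i)//= mxE !eqxx expr1n big1 ?addr0 ?sqrtr1// => j ji.
by rewrite mxE (negbTE ji) expr0n.
Qed.

(** A squared column norm is |A e_i|^2, and a difference of squares factors. The bound keeps column
    norms rather than a uniform constant, so that summing squares over i produces the Frobenius
    norm. *)
Lemma colsqB m n (A B : 'M[R]_(m, n)) (d : R) i :
  (forall x, nrm ((A - B) *m x) <= d * nrm x) ->
  `|colsq A i - colsq B i| <=
  d * (Num.sqrt (colsq A i) + Num.sqrt (colsq B i)).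
Proof.
move=> /(_ (delta_mx i 0)); rewrite nrm_delta mulr1 mulmxBl => ABd.
rewrite !colsqE !sqrtr_sqr !(ger0_norm (nrm_ge0 _)).
apply: le_trans (nrm_sqrB _ _) _.
by rewrite ler_wpM2r// addr_ge0// nrm_ge0.
Qed.

Lemma colsq_le m n (A : 'M[R]_(m, n)) (d : R) i :
  0 <= d -> (forall x, nrm (A *m x) <= d * nrm x) -> colsq A i <= d ^+ 2.
Proof.
move=> d0 /(_ (delta_mx i 0)); rewrite nrm_delta mulr1 colsqE => Ad.
by rewrite lerXn2r// nnegrE// nrm_ge0.
Qed.

Lemma gram_diag m n (A : 'M[R]_(m, n)) i : (A^T *m A) i i = colsq A i.
Proof. by rewrite mxE; apply: eq_bigr => k _; rewrite mxE expr2. Qed.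

(** The squared column norms are the diagonal of the Gram matrix; this is how the S^4 norm controls
    the variance term of Bernstein's inequality. *)
Lemma sum_colsq_sqr_le m n (A : 'M[R]_(m, n)) :
  \sum_i colsq A i ^+ 2 <= frob2 (A^T *m A).
Proof.
apply: ler_sum => i _; rewrite (bigD1 i)//= gram_diag lerDl.
by apply: sumr_ge0 => j _; exact: sqr_ge0.
Qed.

End euclidean.

(** * Coordinate blocks and the average over subsets *)

Section masking.
Variables (R : realType) (n : nat).
Implicit Types (x : n.-tuple R) (I : {set 'I_n}).

Definition msk I x : 'cV[R]_n := \col_i (if i \in I then tnth x i else 0).

Lemma dotv_msk I x (u : 'cV[R]_n) :
  dotv u (msk I x) = \sum_(i in I) u i 0 * tnth x i.
Proof.
rewrite [RHS]big_mkcond; apply: eq_bigr => i _; rewrite mxE.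
by case: ifP => // _; rewrite mulr0.
Qed.

Lemma dotv_mulmx_msk m (A : 'M[R]_(m, n)) I x (y : 'cV[R]_m) :
  dotv (A *m msk I x) y = \sum_(i in I) (A^T *m y) i 0 * tnth x i.
Proof. by rewrite dotv_mulmxl dotvC dotv_msk. Qed.

Lemma eq_msk I x x' : (forall i, i \in I -> tnth x i = tnth x' i) ->
  msk I x = msk I x'.
Proof.
move=> xx'; apply/matrixP => i j; rewrite !mxE.
by case: ifP => // iI; exact: xx'.
Qed.

Lemma dotv_msk2 m (A : 'M[R]_(m, n)) I J x :
  dotv (A *m msk I x) (A *m msk J x) =
  \sum_i \sum_j (A^T *m A) i j * (tnth x i * tnth x j) *
    ((i \in I) && (j \in J))%:R.
Proof.
rewrite dotv_mulmx_msk mulmxA big_mkcond; apply: eq_bigr => i _.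
case: ifP => iI; last by rewrite big1// => j _; rewrite mulr0.
rewrite mxE mulr_suml; apply: eq_bigr => j _; rewrite [msk _ _ _ _]mxE.
by case: (j \in J); rewrite /= ?mulr1 ?mulr0 ?mul0r//; ring.
Qed.

(** Removing i is a bijection from the separating sets onto the subsets of the complement of {i, j},
    of which there are 2^(n-2). *)
Lemma card_separating_sets (i j : 'I_n) : i != j ->
  (4 * #|[set J : {set 'I_n} | (i \in J) && (j \notin J)]%SET| = 2 ^ n)%N.
Proof.
move=> ij; have n2 : (1 < n)%N.
  have := max_card [set i; j]%SET; rewrite cards2 ij card_ord; lia.
have -> : [set J : {set 'I_n} | (i \in J) && (j \notin J)]%SET =
    [set (i |: J)%SET | J in powerset (~: [set i; j]%SET)]%SET.
  apply/setP => J; rewrite inE; apply/andP/imsetP => [[iJ jJ]|[K]].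
    exists (J :\ i)%SET; last by rewrite finset.setD1K.
    rewrite inE; apply/fintype.subsetP => k; rewrite !inE => /andP[ki kJ].
    by rewrite (negbTE ki)/=; apply: contraNneq jJ => <-.
  rewrite inE => /fintype.subsetP KI ->; split; first by rewrite !inE eqxx.
  rewrite !inE negb_or eq_sym ij/=; apply/negP => /KI.
  by rewrite !inE eqxx orbT.
rewrite card_in_imset; last first.
  move=> K L; rewrite !inE => /fintype.subsetP KI /fintype.subsetP LI KL.
  have iK : i \notin K by apply/negP => /KI; rewrite !inE eqxx.
  have iL : i \notin L by apply/negP => /LI; rewrite !inE eqxx.
  by rewrite -(finset.setU1K iK) KL finset.setU1K.
rewrite card_powerset cardsCs finset.setCK cards2 ij card_ord.
by rewrite -[n in RHS](subnK n2) expnD mulnC.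
Qed.

(* The indices i <> j are separated by a quarter of all sets J. *)
Lemma decoupling m (A : 'M[R]_(m, n)) I x :
  nrm (A *m msk I x) ^+ 2 = \sum_(i in I) colsq A i * tnth x i ^+ 2 +
    4 / 2 ^+ n * \sum_(J : {set 'I_n})
      dotv (A *m msk (I :&: J) x) (A *m msk (I :\: J) x).
Proof.
have -> : \sum_(J : {set 'I_n}) dotv (A *m msk (I :&: J) x) (A *m msk (I :\: J) x)
    = \sum_i \sum_j (A^T *m A) i j * (tnth x i * tnth x j) *
      \sum_(J : {set 'I_n}) ((i \in I :&: J) && (j \in I :\: J))%:R.
  under eq_bigr do rewrite dotv_msk2.
  rewrite exchange_big; apply: eq_bigr => i _.
  by rewrite exchange_big; apply: eq_bigr => j _; rewrite -mulr_sumr.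
rewrite nrm_sqr dotv_msk2 mulr_sumr [X in _ = X + _]big_mkcond/= -big_split/=.
apply: eq_bigr => i _; rewrite [in RHS](bigD1 i)//= [LHS](bigD1 i)//=.
(* No index lies in both blocks, so the decoupled forms contain no diagonal term. *)
rewrite [X in _ = _ + _ * (_ * X + _)]big1 => [|J _]; last first.
  by rewrite !inE; case: (i \in J); rewrite ?andbF ?andbT//= ?mulr0.
rewrite mulr0 add0r; congr (_ + _).
  by rewrite gram_diag; case: (i \in I); rewrite ?mulr1 ?mulr0// expr2.
rewrite mulr_sumr; apply: eq_bigr => j ji.
rewrite [RHS]mulrCA; congr (_ * _).
have [iI|iI] := boolP (i \in I); last first.
  by rewrite big1 ?mulr0// => J _; rewrite !inE (negbTE iI).
have [jI|jI] := boolP (j \in I); last first.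
  by rewrite big1 ?mulr0// => J _; rewrite !inE (negbTE jI) !andbF.
have ij : i != j by rewrite eq_sym.
have := card_separating_sets ij => /(congr1 (fun k => k%:R : R)).
rewrite natrM natrX => E.
have -> : \sum_(J : {set 'I_n}) ((i \in I :&: J) && (j \in I :\: J))%:R =
    #|[set J : {set 'I_n} | (i \in J) && (j \notin J)]%SET|%:R :> R.
  rewrite -sum1_card natr_sum big_mkcond/= [RHS]big_mkcond/=.
  apply: eq_bigr => J _; rewrite !inE iI jI andbT/=.
  by case: ifP.
have n0 : (2 : R) ^+ n != 0 by rewrite expf_neq0.
by rewrite mulrAC E mulfV.
Qed.

End masking.

(** * The diagonal part *)

Section moment_calculus.
Context d (T : measurableType d) (R : realType) (P : probability T R).

Lemma exprD_le (x y : R) q : 0 <= x -> 0 <= y ->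
  (x + y) ^+ q <= 2 ^+ q * (x ^+ q + y ^+ q).
Proof.
move=> x0 y0; have [xy|/ltW yx] := leP x y.
  apply: (@le_trans _ _ ((2 * y) ^+ q)).
    by apply: lerXn2r; rewrite ?nnegrE ?addr_ge0 ?mulr_ge0//; lra.
  by rewrite exprMn ler_wpM2l ?exprn_ge0// lerDr exprn_ge0.
apply: (@le_trans _ _ ((2 * x) ^+ q)).
  by apply: lerXn2r; rewrite ?nnegrE ?addr_ge0 ?mulr_ge0//; lra.
by rewrite exprMn ler_wpM2l ?exprn_ge0// lerDl exprn_ge0.
Qed.

Lemma addr_expr_le (x y : R) q : (0 < q)%N -> 0 <= x -> 0 <= y ->
  x ^+ q + y ^+ q <= (x + y) ^+ q.
Proof.
move=> q0 x0 y0; case: q q0 => // q _; elim: q => [|q ih]; first by rewrite !expr1.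
rewrite exprS [y ^+ _]exprS [leRHS]exprS.
have xq : 0 <= x ^+ q.+1 by exact: exprn_ge0.
have yq : 0 <= y ^+ q.+1 by exact: exprn_ge0.
apply: (@le_trans _ _ ((x + y) * (x ^+ q.+1 + y ^+ q.+1))).
  by move: (x ^+ q.+1) (y ^+ q.+1) xq yq => u v u0 v0 {ih}; nra.
by rewrite ler_wpM2l// addr_ge0.
Qed.

(** A substitute for the triangle inequality in L^q: the factor 2 allows one to stay with q-th
    powers throughout. *)
Lemma Ele_powD (f g : T -> R) (a b : R) q : (0 < q)%N ->
  measurable_fun setT f -> measurable_fun setT g ->
  (forall w, 0 <= f w) -> (forall w, 0 <= g w) -> 0 <= a -> 0 <= b ->
  Ele P (fun w => f w ^+ q) (a ^+ q) -> Ele P (fun w => g w ^+ q) (b ^+ q) ->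
  Ele P (fun w => (f w + g w) ^+ q) ((2 * (a + b)) ^+ q).
Proof.
move=> q0 mf mg f0 g0 a0 b0 fa gb.
apply: (Ele_le _ _ _ _ (EleZ (k := 2 ^+ q) _ (EleD fa gb))).
- by apply: measurable_funX; exact: measurable_funD.
- by move=> w; rewrite exprn_ge0// addr_ge0.
- by move=> w; exact: exprD_le.
- by rewrite exprMn ler_wpM2l ?exprn_ge0//; exact: addr_expr_le.
- by rewrite exprn_ge0.
Qed.

Lemma Ele_powZ (f : T -> R) (a k : R) q : 0 <= k ->
  Ele P (fun w => f w ^+ q) (a ^+ q) ->
  Ele P (fun w => (k * f w) ^+ q) ((k * a) ^+ q).
Proof.
move=> k0 fa; rewrite exprMn.
apply: (Ele_ext _ _ (EleZ (k := k ^+ q) _ fa)) => //.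
  by move=> w; rewrite exprMn.
by rewrite exprn_ge0.
Qed.

Lemma Ele_pow_le (f g : T -> R) (a b : R) q :
  measurable_fun setT f -> (forall w, 0 <= f w <= g w) -> 0 <= a <= b ->
  Ele P (fun w => g w ^+ q) (a ^+ q) -> Ele P (fun w => f w ^+ q) (b ^+ q).
Proof.
move=> mf fg /andP[a0 ab] ga; have [f0 gf] : (forall w, 0 <= f w) /\ (forall w, f w <= g w).
  by split => w; case/andP: (fg w).
apply: (Ele_le _ _ _ _ ga).
- exact: measurable_funX.
- by move=> w; rewrite exprn_ge0.
- by move=> w; apply: lerXn2r; rewrite ?nnegrE// (le_trans (f0 w)).
- by apply: lerXn2r; rewrite ?nnegrE// (le_trans a0).
Qed.

Lemma measurable_sum_set n (I : {set 'I_n}) (f : 'I_n -> T -> R) :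
  (forall i, measurable_fun setT (f i)) ->
  measurable_fun setT (fun w => \sum_(i in I) f i w).
Proof.
move=> mf; rewrite (_ : (fun _ => _) = fun w => \sum_(i <- enum I) f i w).
  exact: measurable_sum.
by apply/funext => w; rewrite big_enum.
Qed.

End moment_calculus.

Section subgaussian_family.
Context d (T : measurableType d) (R : realType) (P : probability T R) (n : nat).

Definition subgaussian_family (X : 'I_n -> T -> R) :=
  [/\ forall i, measurable_fun setT (X i), independent_family P X,
      forall i, Ele P (fun w => expR (X i w ^+ 2)) 2,
      forall i, P.-integrable setT (EFin \o X i) &
      forall i, (\int[P]_w (X i w)%:E = 0)%E].

End subgaussian_family.

Section diagonal_increments.
Context d (T : measurableType d) (R : realType) (P : probability T R) (n : nat).
Variable X : 'I_n -> T -> R.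
Hypothesis hX : subgaussian_family P X.
Variables (m : nat) (Om : finType) (A : Om -> 'M[R]_(m, n)).
Variables (dd : Om -> Om -> R) (D2 : R).
Hypothesis dd0 : forall a b, 0 <= dd a b.
Hypothesis ddA : forall a b x, nrm ((A b - A a) *m x) <= dd a b * nrm x.
Hypothesis D20 : 0 <= D2.
Hypothesis D2A : forall a, frob2 (A a) <= D2 ^+ 2.

Local Notation v i := (second_moment P (X i)).

Definition diag_dev (a : Om) (w : T) : R :=
  \sum_i colsq (A a) i * (X i w ^+ 2 - v i).

Definition diag_sup (w : T) : R :=
  \big[Num.max/0]_(a : Om) \sum_i colsq (A a) i * X i w ^+ 2.

Let b a a' i := colsq (A a') i - colsq (A a) i.
Let B a a' := 2 * (dd a a' * D2).

(* The large coefficients of an increment: by Markov there are at most q. *)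
Let I q a a' : {set 'I_n} := [set i | B a a' < Num.sqrt q%:R * `|b a a' i|]%SET.

Let S q a a' w := \sum_(i in I q a a') X i w ^+ 2.
Let U q a a' w := \sum_(i in ~: I q a a') b a a' i * (X i w ^+ 2 - v i).

(** The first summand is the part with small coefficients divided by its natural size. In the
    second, [S / q] measures the squares on the large coefficients, and 3 covers both the means
    there and the constant in 2 sqrt t <= 1 + t. *)
Definition diag_factor (q : nat) a a' w : R :=
  `|U q a a' w| / (Num.sqrt q%:R * (dd a a' * D2)) + (3 + S q a a' w / q%:R).

(** Here 2 * [bernstein_const] comes from [B] = 2 d D2, 10 = 2 (3 + 2) from the second summand of
    the factor, and the outer 2 from adding the summands. *)
Definition diag_const : R := 2 * (2 * bernstein_const R + 10).

Let mX i : measurable_fun setT (X i). Proof. by case: hX. Qed.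

Let B0 a a' : 0 <= B a a'. Proof. by rewrite !mulr_ge0. Qed.

Let b_le a a' i :
  `|b a a' i| <= dd a a' * (Num.sqrt (colsq (A a') i) + Num.sqrt (colsq (A a) i)).
Proof. exact: colsqB. Qed.

(** By (x + y)^2 <= 2 x^2 + 2 y^2 and the two Frobenius bounds, the sum is at most 4 d^2 D2^2; hence
    the 2 in [B]. *)
Let sum_b a a' : \sum_i b a a' i ^+ 2 <= B a a' ^+ 2.
Proof.
apply: (@le_trans _ _ (\sum_i dd a a' ^+ 2 *
    (2 * colsq (A a') i + 2 * colsq (A a) i))).
  apply: ler_sum => i _; rewrite -(real_normK (num_real (b a a' i))).
  apply: le_trans (_ : (dd a a' * (Num.sqrt (colsq (A a') i) +
    Num.sqrt (colsq (A a) i))) ^+ 2 <= _).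
    by rewrite lerXn2r ?nnegrE ?mulr_ge0 ?addr_ge0 ?sqrtr_ge0.
  rewrite exprMn ler_wpM2l ?sqr_ge0//.
  have := sqr_sqrtr (colsq_ge0 (A a') i); have := sqr_sqrtr (colsq_ge0 (A a) i).
  set x := Num.sqrt _; set y := Num.sqrt _ => <- <-.
  by have := sqr_ge0 (x - y); rewrite !expr2; lra.
rewrite -mulr_sumr big_split/= -!mulr_sumr !sum_colsq /B.
have := D2A a; have := D2A a'.
move: (frob2 _) (frob2 _) => f f' h h'.
rewrite (_ : (2 * _) ^+ 2 = dd a a' ^+ 2 * (4 * D2 ^+ 2)); last by ring.
by rewrite ler_wpM2l ?sqr_ge0//; lra.
Qed.

Let card_I q a a' : (#|I q a a'| <= q)%N.
Proof.
(* If [B] is 0, all coefficients vanish and the strict inequality defining [I] leaves it empty.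
   Otherwise the count follows after dividing by [B] squared. *)
have [b00|] := eqVneq (B a a') 0.
  suff -> : I q a a' = finset.set0 by rewrite cards0.
  apply/setP => i; rewrite !inE b00; apply/negbTE; rewrite -leNgt.
  have := sum_b a a'; rewrite b00 expr0n/= => h.
  have : b a a' i ^+ 2 <= 0.
    apply: le_trans h; rewrite (bigD1 i)//= lerDl.
    by apply: sumr_ge0 => j _; exact: sqr_ge0.
  rewrite -(real_normK (num_real (b a a' i))) => hb.
  have : `|b a a' i| ^+ 2 == 0 by rewrite eq_le hb sqr_ge0.
  by rewrite sqrf_eq0 => /eqP ->; rewrite mulr0.
rewrite -(ler_nat R) => Bn0.
have BB : 0 < B a a' ^+ 2 by rewrite exprn_gt0// lt_def Bn0 B0.
rewrite -(ler_pM2r BB).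
apply: (@le_trans _ _ (\sum_(i in I q a a') q%:R * b a a' i ^+ 2)).
  rewrite mulr_natl -sumr_const; apply: ler_sum => i; rewrite inE => Bi.
  have -> : q%:R * b a a' i ^+ 2 = (Num.sqrt q%:R * `|b a a' i|) ^+ 2.
    by rewrite exprMn sqr_sqrtr// real_normK// num_real.
  by rewrite lerXn2r ?nnegrE ?B0 ?mulr_ge0 ?sqrtr_ge0// ltW.
rewrite -mulr_sumr ler_wpM2l//; apply: le_trans (sum_b a a').
rewrite [leRHS](bigID (mem (I q a a')))/= lerDl.
by apply: sumr_ge0 => j _; exact: sqr_ge0.
Qed.

Let mS q a a' : measurable_fun setT (S q a a').
Proof. by apply: measurable_sum_set => i; exact: measurable_funX. Qed.

Let S0 q a a' w : 0 <= S q a a' w.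
Proof. by apply: sumr_ge0 => i _; exact: sqr_ge0. Qed.

Let mU q a a' : measurable_fun setT (U q a a').
Proof.
apply: measurable_sum_set => i; apply: measurable_funM => //.
by apply: measurable_funB => //; exact: measurable_funX.
Qed.

Lemma diag_sup_ge a w : \sum_i colsq (A a) i * X i w ^+ 2 <= diag_sup w.
Proof.
exact: (le_bigmaxr_seq (fun a => \sum_i colsq (A a) i * X i w ^+ 2)
  (mem_index_enum a)).
Qed.

Lemma diag_sup_ge0 w : 0 <= diag_sup w. Proof. exact: bigmaxr_ge0. Qed.

Lemma measurable_diag_sup : measurable_fun setT diag_sup.
Proof.
apply: measurable_bigmaxr => a _; apply: measurable_sum => i.
by apply: measurable_funM => //; exact: measurable_funX.
Qed.

Lemma measurable_diag_dev a : measurable_fun setT (diag_dev a).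
Proof.
apply: measurable_sum => i; apply: measurable_funM => //.
by apply: measurable_funB => //; exact: measurable_funX.
Qed.

Lemma diag_factor_ge0 q a a' w : 0 <= diag_factor q a a' w.
Proof.
by rewrite addr_ge0 ?divr_ge0 ?mulr_ge0 ?sqrtr_ge0// addr_ge0// divr_ge0.
Qed.

Lemma measurable_diag_factor q a a' : measurable_fun setT (diag_factor q a a').
Proof.
apply: measurable_funD.
  by apply: measurable_funM => //; apply: measurableT_comp.
by apply: measurable_funD => //; exact: measurable_funM.
Qed.

(** Outside [I], sqrt q |b_i| <= B is exactly what makes the linear condition of Bernstein hold at
    the subgaussian scale sqrt q B. On [I] there are at most q squares, whose sum has q-th moment of
    order q^q. *)
Lemma diag_factor_moment q a a' : (0 < q)%N ->
  Ele P (fun w => diag_factor q a a' w ^+ q) (diag_const ^+ q).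
Proof.
move=> q0; have [_ indX sX iX X0] := hX.
have qR : 0 < q%:R :> R by rewrite ltr0n.
have sq : 0 <= Num.sqrt q%:R :> R by exact: sqrtr_ge0.
have bc := ltW (bernstein_const_gt0 R).
apply: Ele_powD => //.
- by apply: measurable_funM => //; apply: measurableT_comp.
- by apply: measurable_funD => //; exact: measurable_funM.
- by move=> w; rewrite divr_ge0// !mulr_ge0.
- by move=> w; rewrite addr_ge0// divr_ge0// ltW.
- by rewrite mulr_ge0.
- set k := Num.sqrt q%:R * (dd a a' * D2).
  have k0 : 0 <= k by rewrite !mulr_ge0.
  have : Ele P (fun w => `|U q a a' w| ^+ q)
      ((bernstein_const R * (Num.sqrt q%:R * B a a')) ^+ q).
    apply: bernstein_moment => //.
    + by rewrite mulr_ge0.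
    + move=> i; rewrite !inE -leNgt => h.
      rewrite (_ : q%:R * _ = Num.sqrt q%:R * (Num.sqrt q%:R * `|b a a' i|)).
        by rewrite ler_wpM2l.
      by rewrite mulrA -expr2 sqr_sqrtr// ltW.
    + rewrite exprMn (sqr_sqrtr (ltW qR)) ler_wpM2l ?(ltW qR)//.
      apply: le_trans (sum_b a a').
      rewrite [leRHS](bigID (mem (~: I q a a')))/= lerDl.
      by apply: sumr_ge0 => j _; exact: sqr_ge0.
  move/(Ele_powZ (k := k^-1)); rewrite invr_ge0 => /(_ k0).
  apply: Ele_pow_le.
  + by apply: measurable_funM => //; apply: measurableT_comp.
  + by move=> w; rewrite mulrC lexx andbT mulr_ge0// invr_ge0.
  + have -> : k^-1 * (bernstein_const R * (Num.sqrt q%:R * B a a')) =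
        (k^-1 * k) * (2 * bernstein_const R) by rewrite /k /B; ring.
    rewrite !mulr_ge0 ?invr_ge0//= ler_piMl ?mulr_ge0//.
    have [->|kn0] := eqVneq k 0; first by rewrite mulr0.
    by rewrite mulVf.
- rewrite (_ : 10 = 2 * (3 + 2)); last by lra.
  apply: Ele_powD => //.
  + exact: measurable_funM.
  + by move=> w; rewrite divr_ge0// ltW.
  + by apply: Ele_cst; exact: exprn_ge0.
  + have := moment_sum_squares mX indX sX (card_I q a a').
    move/(Ele_powZ (k := q%:R^-1)); rewrite invr_ge0 => /(_ (ltW qR)).
    apply: Ele_pow_le.
    * exact: measurable_funM.
    * by move=> w; rewrite mulrC lexx andbT mulr_ge0// invr_ge0 ltW.
    * by rewrite mulrCA mulVf ?gt_eqF// mulr1 lexx ler0n.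
Qed.

(** On the large coefficients Bernstein would grow like q instead of sqrt q. There the sum is
    estimated without cancellation: Cauchy-Schwarz produces sqrt([diag_sup]), a quantity absorbed
    later. *)
Lemma diag_increment q a a' w : (0 < q)%N ->
  `|diag_dev a' w - diag_dev a w| <=
  dd a a' * Num.sqrt q%:R * diag_factor q a a' w *
  (D2 + Num.sqrt (diag_sup w)).
Proof.
move=> q0; have [_ indX sX iX X0] := hX.
have qR : 0 < q%:R :> R by rewrite ltr0n.
have sq : 0 < Num.sqrt q%:R :> R by rewrite sqrtr_gt0.
have V0 : 0 <= Num.sqrt (diag_sup w) by exact: sqrtr_ge0.
have -> : diag_dev a' w - diag_dev a w =
    U q a a' w + \sum_(i in I q a a') b a a' i * (X i w ^+ 2 - v i).
  rewrite /diag_dev -sumrB [LHS](bigID (mem (~: I q a a')))/=; congr (_ + _).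
    by apply: eq_bigr => i _; rewrite /b mulrBl.
  by apply: eq_big => i; rewrite ?inE ?negbK// => _; rewrite /b mulrBl.
set u := U q a a' w; set d' := dd a a'.
have d0 : 0 <= d' by exact: dd0.
(* The second moment lies in [0, 1], so |X^2 - v| <= 1 + X^2. *)
have hS : `|\sum_(i in I q a a') b a a' i * (X i w ^+ 2 - v i)| <=
    \sum_(i in I q a a') 1 * `|b a a' i| +
    \sum_(i in I q a a') `|b a a' i| * X i w ^+ 2.
  rewrite -big_split/=; apply: le_trans (ler_norm_sum _ _ _) _.
  apply: ler_sum => i _; rewrite normrM mul1r -{2}[`|b _ _ _|]mulr1 -mulrDr ler_wpM2l//.
  have := second_moment_ge0 (mX i) (sX i); have := second_moment_le1 (mX i) (sX i).
  by have := sqr_ge0 (X i w); rewrite ler_norml => *; apply/andP; split; lra.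
have hS1 : \sum_(i in I q a a') 1 * `|b a a' i| <= Num.sqrt q%:R * B a a'.
  apply: ler_normlW; apply: le_trans (cauchy_schwarz_sqrt _ _ _) _.
  apply: ler_pM; rewrite ?sqrtr_ge0//.
    rewrite ler_sqrt// (eq_bigr (fun=> 1)) => [|i _]; last by rewrite expr1n.
    by rewrite sumr_const ler_nat card_I.
  rewrite -[leRHS](ger0_norm (B0 a a')) -sqrtr_sqr ler_sqrt ?sqr_ge0//.
  apply: le_trans (sum_b a a').
  rewrite [leRHS](bigID (mem (I q a a')))/= -[leLHS]addr0 lerD//.
    by apply: ler_sum => i _; rewrite real_normK ?num_real.
  by apply: sumr_ge0 => j _; exact: sqr_ge0.
have hc a1 : \sum_(i in I q a a') Num.sqrt (colsq (A a1) i) * X i w ^+ 2 <=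
    Num.sqrt (diag_sup w) * Num.sqrt (S q a a' w).
  apply: ler_normlW.
  rewrite (eq_bigr (fun i => (Num.sqrt (colsq (A a1) i) * X i w) * X i w));
    last by move=> i _; rewrite expr2 mulrA.
  apply: le_trans (cauchy_schwarz_sqrt _ _ _) _.
  apply: ler_wpM2r; first exact: sqrtr_ge0.
  rewrite ler_sqrt ?diag_sup_ge0//; apply: le_trans (diag_sup_ge a1 w).
  rewrite [leRHS](bigID (mem (I q a a')))/= -[leLHS]addr0 lerD//.
    by apply: ler_sum => i _; rewrite exprMn sqr_sqrtr ?colsq_ge0.
  by apply: sumr_ge0 => j _; rewrite mulr_ge0 ?colsq_ge0 ?sqr_ge0.
have hS2 : \sum_(i in I q a a') `|b a a' i| * X i w ^+ 2 <=
    d' * (2 * (Num.sqrt (diag_sup w) * Num.sqrt (S q a a' w))).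
  apply: (@le_trans _ _ (\sum_(i in I q a a') d' *
    (Num.sqrt (colsq (A a') i) * X i w ^+ 2 + Num.sqrt (colsq (A a) i) * X i w ^+ 2))).
    by apply: ler_sum => i _; rewrite -mulrDl [leRHS]mulrA ler_wpM2r ?sqr_ge0.
  rewrite -mulr_sumr big_split/= ler_wpM2l//.
  by have := hc a; have := hc a'; lra.
have uE : `|u| = (d' * Num.sqrt q%:R * D2) *
    (`|u| / (Num.sqrt q%:R * (d' * D2))).
  (* For a zero denominator the quotient is 0, and the identity holds because all coefficients
     vanish. *)
  have [k0|k0] := eqVneq (d' * D2) 0; last first.
    have [d'0 D'0] : d' != 0 /\ D2 != 0.
      by move: k0; rewrite mulf_eq0 negb_or => /andP.
    by field; rewrite d'0 D'0 gt_eqF.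
  rewrite [d' * _ * D2]mulrAC k0 !mul0r; apply/eqP; rewrite normr_eq0 /u /U; apply/eqP.
  apply: big1 => i _; suff -> : b a a' i = 0 by rewrite mul0r.
  have := sum_b a a'; rewrite /B k0 mulr0 expr0n/= => h.
  have : b a a' i ^+ 2 <= 0.
    apply: le_trans h; rewrite (bigD1 i)//= lerDl.
    by apply: sumr_ge0 => j _; exact: sqr_ge0.
  move=> hb; have : b a a' i ^+ 2 == 0 by rewrite eq_le hb sqr_ge0.
  by rewrite sqrf_eq0 => /eqP.
apply: le_trans (ler_normD _ _) _.
rewrite /diag_factor -/u -/d'.
set t := S q a a' w / q%:R.
have t0 : 0 <= t by rewrite divr_ge0// ltW.
have sS : Num.sqrt (S q a a' w) = Num.sqrt q%:R * Num.sqrt t.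
  by rewrite -sqrtrM ?ltW// /t mulrC divfK// gt_eqF.
have st : 2 * Num.sqrt t <= 1 + t.
  have := sqr_sqrtr t0; have := sqr_ge0 (Num.sqrt t - 1).
  by set y := Num.sqrt t; rewrite !expr2; lra.
move: hS2; rewrite sS => hS2.
have u0 : 0 <= `|u| / (Num.sqrt q%:R * (d' * D2)).
  by rewrite divr_ge0// !mulr_ge0// ltW.
move: hS1; rewrite /B -/d' => hS1.
move: uE u0; set x := `|u| / _; set V := Num.sqrt (diag_sup w) => uE u0.
move: sq hS1 hS2 uE; set s := Num.sqrt q%:R => sq hS1 hS2 uE.
have lin (e r D W z t' y s1 s2 s3 : R) : s1 <= r * (2 * (e * D)) ->
    s2 <= e * (2 * (W * (r * y))) -> s3 <= s1 + s2 ->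
    e * r * W * (2 * y) <= e * r * W * (1 + t') ->
    e * r * D * z + s3 <= e * r * (D * z + D * 2 + W * (1 + t')).
  by move=> *; lra.
rewrite uE; apply: (@le_trans _ _ (d' * s * (D2 * x + D2 * 2 + V * (1 + t)))).
  apply: (lin _ _ _ _ _ _ _ _ _ _ hS1 hS2 hS).
  by rewrite ler_wpM2l// !mulr_ge0// ltW.
rewrite -[leRHS]mulrA ler_wpM2l ?mulr_ge0 ?(ltW sq)//.
have lin2 (D W z t' : R) : 0 <= D -> 0 <= W -> 0 <= D * t' -> 0 <= W * z ->
    D * z + D * 2 + W * (1 + t') <= (z + (3 + t')) * (D + W).
  by move=> *; lra.
by apply: lin2 => //; exact: mulr_ge0.
Qed.

End diagonal_increments.

(** * Bilinear forms *)

Section measurability.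
Context d (T : measurableType d) (R : realType) (n : nat).
Variable x : T -> n.-tuple R.
Hypothesis mx : forall i, measurable_fun setT (fun w => tnth (x w) i).

Lemma measurable_sqrtr (f : T -> R) : measurable_fun setT f ->
  measurable_fun setT (fun w => Num.sqrt (f w)).
Proof.
move=> mf.
apply: (@measurableT_comp _ _ _ _ _ _ (Num.sqrt : R -> R)) => //.
by apply: continuous_measurable_fun; exact: sqrt_continuous.
Qed.

Lemma measurable_invr_ge0 (f : T -> R) : (forall w, 0 <= f w) ->
  measurable_fun setT f -> measurable_fun setT (fun w => (f w)^-1).
Proof.
move=> f0 mf; rewrite (_ : (fun _ => _) = fun w => f w `^ (-1)).
  exact: (@measurableT_comp _ _ _ _ _ _ (fun y : R => y `^ (-1))).
by apply/funext => w; rewrite powR_inv1.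
Qed.

Lemma measurable_mulmx_msk m (B : 'M[R]_(m, n)) (J : {set 'I_n}) i :
  measurable_fun setT (fun w => (B *m msk J (x w)) i 0).
Proof.
under eq_fun do rewrite mxE.
apply: measurable_sum => j; apply: measurable_funM => //.
under eq_fun do rewrite mxE.
by case: (j \in J); [exact: mx|exact: measurable_cst].
Qed.

Lemma measurable_nrm m (u : T -> 'cV[R]_m) :
  (forall i, measurable_fun setT (fun w => u w i 0)) ->
  measurable_fun setT (fun w => nrm (u w)).
Proof.
move=> mu; apply: measurable_sqrtr; apply: measurable_sum => i.
exact: measurable_funM.
Qed.

Lemma measurable_dotv m (u v : T -> 'cV[R]_m) :
  (forall i, measurable_fun setT (fun w => u w i 0)) ->
  (forall i, measurable_fun setT (fun w => v w i 0)) ->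
  measurable_fun setT (fun w => dotv (u w) (v w)).
Proof. by move=> mu mv; apply: measurable_sum => i; exact: measurable_funM. Qed.

End measurability.

(** * Conditional moments and increments of decoupled forms *)

Section bilinear.
Context d (T : measurableType d) (R : realType) (P : probability T R) (n : nat).
Variable X : 'I_n -> T -> R.
Hypothesis hX : subgaussian_family P X.

Local Notation xi := (tup X).

Lemma measurable_tup i : measurable_fun setT (fun w => tnth (xi w) i).
Proof.
rewrite (_ : (fun _ => _) = X i); first by case: hX.
by apply/funext => w; rewrite tnth_mktuple.
Qed.

(* Conditionally on the coordinates in J the form is a linear combination of
   the independent coordinates in I, whose coefficient vector has norm at most
   dl times that of the J-factor. When the denominator vanishes, x / 0 = 0. *)
Lemma bilinear_moment m (D M : 'M[R]_(m, n)) (dl : R) (I J : {set 'I_n}) q :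
  (0 < q)%N -> 0 <= dl -> (forall x, nrm (D *m x) <= dl * nrm x) ->
  (forall i, i \in I -> i \notin J) ->
  Ele P (fun w => (`|dotv (D *m msk I (xi w)) (M *m msk J (xi w))| /
                  (dl * nrm (M *m msk J (xi w)))) ^+ q)
        ((khintchine_const R * Num.sqrt q%:R) ^+ q).
Proof.
move=> q0 dl0 Dd IJ; have [mX indX sX iX X0] := hX.
pose c i (t : n.-tuple R) :=
  (D^T *m (M *m msk J t)) i 0 * (dl * nrm (M *m msk J t))^-1.
have mid i : measurable_fun setT (fun t : n.-tuple R => tnth t i).
  exact: measurable_tnth.
have := @khintchine_moment _ _ _ P n X mX indX sX iX X0 I c q q0.
case.
- move=> i; apply: measurable_funM.
    under eq_fun do rewrite mulmxA.
    exact: measurable_mulmx_msk.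
  apply: measurable_invr_ge0; first by move=> t; rewrite mulr_ge0// nrm_ge0.
  apply: measurable_funM => //; apply: measurable_nrm => k.
  exact: measurable_mulmx_msk.
- move=> i t t' iI tt'; rewrite /c (@eq_msk _ _ J t t')// => j jJ.
  by apply: tt'; apply/negP => /IJ; rewrite jJ.
- move=> t; set y := M *m msk J t.
  rewrite (eq_bigr (fun i => (dl * nrm y)^-1 ^+ 2 * (D^T *m y) i 0 ^+ 2));
    last by move=> i _; rewrite /c exprMn mulrC.
  rewrite -mulr_sumr.
  apply: (@le_trans _ _ ((dl * nrm y)^-1 ^+ 2 * nrm (D^T *m y) ^+ 2)).
    rewrite ler_wpM2l ?sqr_ge0// nrm_sqr dotvE [leRHS](bigID (mem I))/= lerDl.
    by apply: sumr_ge0 => j _; exact: sqr_ge0.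
  rewrite -exprMn expr_le1//; last first.
    by rewrite mulr_ge0 ?invr_ge0 ?mulr_ge0 ?nrm_ge0.
  apply: (@le_trans _ _ ((dl * nrm y)^-1 * (dl * nrm y))).
    rewrite ler_wpM2l ?invr_ge0 ?mulr_ge0 ?nrm_ge0//.
    exact: adjoint_bound.
  by have [->|h] := eqVneq (dl * nrm y) 0; rewrite ?mulr0// mulVf.
- move=> m1 p1 E1.
  apply: (Ele_ext (f := fun w => `|\sum_(i in I) c i (xi w) * X i w| ^+ q)) => //.
  move=> w; congr (_ ^+ q).
  rewrite dotv_mulmx_msk.
  set y := M *m msk J (xi w).
  have k0 : 0 <= (dl * nrm y)^-1 by rewrite invr_ge0 mulr_ge0 ?nrm_ge0.
  rewrite -[(_ * _)^-1]ger0_norm// -normrM mulr_suml; congr `|_|.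
  by apply: eq_bigr => i _; rewrite /c -/y tnth_mktuple mulrAC.
Qed.

Variables (m : nat) (Om : finType) (A : Om -> 'M[R]_(m, n)).
Variables (dd : Om -> Om -> R).
Hypothesis dd0 : forall a b, 0 <= dd a b.
Hypothesis ddA : forall a b x, nrm ((A b - A a) *m x) <= dd a b * nrm x.
Variables (I J : {set 'I_n}).
Hypothesis IJ : forall i, i \in I -> i \notin J.

Definition nrm_sup (K : {set 'I_n}) (w : T) : R :=
  \big[Num.max/0]_(a : Om) nrm (A a *m msk K (xi w)).

Definition bilin (a : Om) (w : T) : R :=
  dotv (A a *m msk I (xi w)) (A a *m msk J (xi w)).

Let half (D M : 'M[R]_(m, n)) (dl : R) (K L : {set 'I_n}) w : R :=
  `|dotv (D *m msk K (xi w)) (M *m msk L (xi w))| /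
  (dl * nrm (M *m msk L (xi w))).

(** The increment telescopes into two forms, in each of which only one argument carries the
    difference of matrices. Each is divided by its conditional size, and sqrt q removes the growth
    in Khintchine's inequality. *)
Definition bilin_factor (q : nat) a b w : R :=
  (Num.sqrt q%:R)^-1 * (half (A b - A a) (A b) (dd a b) I J w +
                        half (A b - A a) (A a) (dd a b) J I w).

Definition bilin_const : R := 4 * khintchine_const R.

Lemma nrm_sup_ge K a w : nrm (A a *m msk K (xi w)) <= nrm_sup K w.
Proof.
exact: (le_bigmaxr_seq (fun a => nrm (A a *m msk K (xi w))) (mem_index_enum a)).
Qed.

Lemma nrm_sup_ge0 K w : 0 <= nrm_sup K w. Proof. exact: bigmaxr_ge0. Qed.

Lemma measurable_nrm_sup K : measurable_fun setT (nrm_sup K).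
Proof.
apply: measurable_bigmaxr => a _; apply: measurable_nrm => i.
by apply: measurable_mulmx_msk => j; exact: measurable_tup.
Qed.

Lemma measurable_bilin a : measurable_fun setT (bilin a).
Proof.
by apply: measurable_dotv => i; apply: measurable_mulmx_msk => j;
  exact: measurable_tup.
Qed.

Let mhalf D M dl K L : 0 <= dl -> measurable_fun setT (half D M dl K L).
Proof.
have mm (B : 'M[R]_(m, n)) S i :
    measurable_fun setT (fun w => (B *m msk S (xi w)) i 0).
  by apply: measurable_mulmx_msk => j; exact: measurable_tup.
move=> dl0; apply: measurable_funM.
  by apply: measurableT_comp => //; exact: measurable_dotv.
apply: measurable_invr_ge0; first by move=> w; rewrite mulr_ge0// nrm_ge0.
by apply: measurable_funM => //; exact: measurable_nrm.
Qed.

Let half_ge0 D M dl K L w : 0 <= dl -> 0 <= half D M dl K L w.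
Proof. by move=> dl0; rewrite divr_ge0// mulr_ge0// nrm_ge0. Qed.

Lemma bilin_factor_ge0 q a b w : 0 <= bilin_factor q a b w.
Proof. by rewrite mulr_ge0 ?invr_ge0 ?sqrtr_ge0// addr_ge0// half_ge0. Qed.

Lemma measurable_bilin_factor q a b : measurable_fun setT (bilin_factor q a b).
Proof.
by apply: measurable_funM => //; apply: measurable_funD; exact: mhalf.
Qed.

Lemma bilin_factor_moment q a b : (0 < q)%N ->
  Ele P (fun w => bilin_factor q a b w ^+ q) (bilin_const ^+ q).
Proof.
move=> q0; have sq : 0 < Num.sqrt q%:R :> R by rewrite sqrtr_gt0 ltr0n.
have kc : 0 <= khintchine_const R by rewrite mulr_ge0// expR_ge0.
rewrite (_ : bilin_const = (Num.sqrt q%:R)^-1 * (2 *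
   (khintchine_const R * Num.sqrt q%:R + khintchine_const R * Num.sqrt q%:R)));
  last by rewrite /bilin_const; field; rewrite gt_eqF.
apply: Ele_powZ; first by rewrite invr_ge0 ltW.
apply: Ele_powD => //; try exact: mhalf; try (by move=> w; exact: half_ge0);
  try (by rewrite mulr_ge0// ltW).
- exact: bilinear_moment.
- apply: bilinear_moment => // i iJ; apply/negP => iI.
  by have := IJ iI; rewrite iJ.
Qed.

(** Changing the matrix in one slot at a time gives two forms, one conditioned on each block; this
    is why both block suprema appear. *)
Lemma bilin_increment q a b w : (0 < q)%N ->
  `|bilin b w - bilin a w| <=
  dd a b * Num.sqrt q%:R * bilin_factor q a b w * (nrm_sup I w + nrm_sup J w).
Proof.
move=> q0; have sq : 0 < Num.sqrt q%:R :> R by rewrite sqrtr_gt0 ltr0n.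
have bound (D M : 'M[R]_(m, n)) dl K L : 0 <= dl ->
    (forall x, nrm (D *m x) <= dl * nrm x) ->
    `|dotv (D *m msk K (xi w)) (M *m msk L (xi w))| <=
    dl * half D M dl K L w * nrm (M *m msk L (xi w)).
  move=> dl0 Dd; rewrite /half; set y := M *m _; set u := D *m _.
  (* The quotient [half] is 0 for a zero denominator, but then the form itself vanishes by
     Cauchy-Schwarz. *)
  have [k0|k0] := eqVneq (dl * nrm y) 0; last first.
    have [dn yn] : dl != 0 /\ nrm y != 0.
      by move: k0; rewrite mulf_eq0 negb_or => /andP.
    by rewrite [leRHS](_ : _ = `|dotv u y|)//; field; rewrite dn yn.
  apply: le_trans (norm_dotv_le _ _) _; apply: (@le_trans _ _ 0).
    apply: le_trans (ler_wpM2r (nrm_ge0 y) (Dd _)) _.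
    by rewrite mulrAC k0 mul0r.
  by rewrite !mulr_ge0 ?invr_ge0 ?mulr_ge0 ?nrm_ge0.
have -> : bilin b w - bilin a w =
    dotv ((A b - A a) *m msk I (xi w)) (A b *m msk J (xi w)) +
    dotv ((A b - A a) *m msk J (xi w)) (A a *m msk I (xi w)).
  rewrite /bilin !mulmxBl !dotvDl !dotvNl [dotv (A b *m msk J _) _]dotvC.
  by rewrite [dotv (A a *m msk J _) _]dotvC; ring.
apply: le_trans (ler_normD _ _) _.
have h1 := bound _ (A b) _ I J (dd0 a b) (ddA a b).
have h2 := bound _ (A a) _ J I (dd0 a b) (ddA a b).
apply: le_trans (lerD h1 h2) _.
have -> : dd a b * Num.sqrt q%:R * bilin_factor q a b w =
    dd a b * half (A b - A a) (A b) (dd a b) I J w +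
    dd a b * half (A b - A a) (A a) (dd a b) J I w.
  by rewrite /bilin_factor; field; rewrite gt_eqF.
have hh D M K L : 0 <= dd a b * half D M (dd a b) K L w.
  by rewrite mulr_ge0// half_ge0.
rewrite mulrDl; apply: lerD; apply: ler_wpM2l => //.
- by apply: ler_wpDl; rewrite ?nrm_sup_ge0 ?nrm_sup_ge.
- by apply: ler_wpDr; rewrite ?nrm_sup_ge0 ?nrm_sup_ge.
Qed.

End bilinear.

(** * Absorption *)

Section moment_calculus_more.
Context d (T : measurableType d) (R : realType) (P : probability T R).

Lemma Ele_lim (f : T -> R) (c : R) :
  (forall e, 0 < e -> Ele P f (c + e)) -> Ele P f c.
Proof.
move=> fe; have [mf f0 _] := fe 1 ltr01; split => //.
apply/lee_addgt0Pr => e e0; rewrite -EFinD.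
by case: (fe e e0).
Qed.

(* Weighted AM-GM: 2 f^r h^r <= l f^(2r) + h^(2r) / l, with l = (b / a)^r. *)
Lemma Ele_pow_prod (f h : T -> R) (a b : R) r : 0 < a -> 0 <= b ->
  (0 < r)%N -> measurable_fun setT f -> measurable_fun setT h ->
  (forall w, 0 <= f w) -> (forall w, 0 <= h w) ->
  Ele P (fun w => f w ^+ (2 * r)) (a ^+ (2 * r)) ->
  Ele P (fun w => (h w ^+ 2) ^+ r) ((b ^+ 2) ^+ r) ->
  Ele P (fun w => (f w * h w) ^+ r) ((a * b) ^+ r).
Proof.
move=> a0 b0 r0 mf mh f0 h0 fa hb.
have key l : 0 < l -> Ele P (fun w => (f w * h w) ^+ r)
    (2^-1 * (l * a ^+ (2 * r) + l^-1 * (b ^+ 2) ^+ r)).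
  move=> l0; apply: (Ele_le _ _ _ (lexx _)
     (EleZ (k := 2^-1) _ (EleD (EleZ (ltW l0) fa) (EleZ (k := l^-1) _ hb)))) => //.
  - by apply: measurable_funX; exact: measurable_funM.
  - by move=> w; rewrite exprn_ge0// mulr_ge0.
  - move=> w; rewrite exprMn [(2 * r)%N]mulnC exprM (exprAC _ 2 r).
    move: (f w ^+ r) (h w ^+ r) => x y.
    have := sqr_ge0 (l * x - y) => hl.
    have : 0 <= l^-1 * (l * x - y) ^+ 2 by rewrite mulr_ge0// invr_ge0 ltW.
    have -> : l^-1 * (l * x - y) ^+ 2 = l * x ^+ 2 + l^-1 * y ^+ 2 - 2 * (x * y).
      by field; rewrite gt_eqF.
    by lra.
  - by rewrite invr_ge0 ltW.
have ar0 : 0 < a ^+ r by rewrite exprn_gt0.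
(* For b = 0 the optimal weight would be 0; small positive weights give the bound in the limit. *)
move: b0; rewrite le_eqVlt => /predU1P[b0|b0].
  rewrite -b0 mulr0 expr0n gtn_eqF//=; apply: Ele_lim => e e0.
  have l0 : 0 < 2 * e / a ^+ (2 * r) by rewrite divr_gt0 ?mulr_gt0 ?exprn_gt0.
  apply: Ele_weak (key _ l0).
  rewrite -b0 !expr0n/= gtn_eqF//= mulr0 addr0 divfK ?gt_eqF ?exprn_gt0//.
  by lra.
have br0 : 0 < b ^+ r by rewrite exprn_gt0.
have l0 : 0 < b ^+ r / a ^+ r by rewrite divr_gt0.
apply: Ele_weak (key _ l0).
rewrite -exprM ![(2 * r)%N]mulnC !exprM exprMn.
move: ar0 br0; set x := a ^+ r; set y := b ^+ r => x0 y0.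
rewrite le_eqVlt; apply/orP; left; apply/eqP.
by field; rewrite !gt_eqF.
Qed.

(** Jensen's inequality for dyadic exponents: each doubling of the exponent is one Cauchy-Schwarz
    inequality against the constant 1. *)
Lemma mean_pow_le (I : finType) (y : I -> R) k : (forall i, 0 <= y i) ->
  (#|I|%:R^-1 * \sum_i y i) ^+ (2 ^ k) <= #|I|%:R^-1 * \sum_i y i ^+ (2 ^ k).
Proof.
move=> y0; have i0 : 0 <= #|I|%:R^-1 :> R by rewrite invr_ge0.
elim: k => [|k ih]; first by under [X in _ <= _ * X]eq_bigr do rewrite expr1.
rewrite expnSr exprM.
apply: (@le_trans _ _ ((#|I|%:R^-1 * \sum_i y i ^+ (2 ^ k)) ^+ 2)).
  apply: lerXn2r => //; rewrite nnegrE ?exprn_ge0 ?mulr_ge0 ?sumr_ge0// => i _.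
  exact: exprn_ge0.
rewrite exprMn expr2 -mulrA ler_wpM2l//.
have [I0|I0] := eqVneq (#|I|%:R : R) 0.
  rewrite I0 invr0 mul0r; apply: sumr_ge0 => i _; exact: exprn_ge0.
rewrite mulrC ler_pdivrMr ?lt_def ?I0 ?ler0n// mulrC.
have := cauchy_schwarz_sum xpredT (fun=> 1) (fun i => y i ^+ (2 ^ k)).
under eq_bigr do rewrite mul1r.
under [X in _ <= X * _ -> _]eq_bigr do rewrite expr1n.
rewrite sumr_const /= => /le_trans; apply.
by under [X in _ * X <= _]eq_bigr do rewrite -exprM.
Qed.

Lemma Ele_pow_mean (I : finType) (y : I -> T -> R) (b : R) k : (0 < #|I|)%N ->
  0 <= b -> (forall i, measurable_fun setT (y i)) -> (forall i w, 0 <= y i w) ->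
  (forall i, Ele P (fun w => y i w ^+ (2 ^ k)) (b ^+ (2 ^ k))) ->
  Ele P (fun w => (#|I|%:R^-1 * \sum_i y i w) ^+ (2 ^ k)) (b ^+ (2 ^ k)).
Proof.
move=> I0 b0 my y0 yb; have i0 : 0 <= #|I|%:R^-1 :> R by rewrite invr_ge0.
have H := EleZ i0 (Ele_sum (index_enum I) (Q := xpredT) (fun i _ => yb i)).
apply: (Ele_le _ _ _ _ H).
- apply: measurable_funX; apply: measurable_funM => //.
  exact: measurable_sum.
- by move=> w; rewrite exprn_ge0// mulr_ge0// sumr_ge0.
- by move=> w; exact: mean_pow_le.
- by rewrite sumr_const -[X in _ * X]mulr_natl mulKf// pnatr_eq0 -lt0n.
Qed.

(** The maximum is at most the sum, and 2^r summands contribute only a factor 2 to the r-th root.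
    Hence a chain may begin at level l instead of at a single point. *)
Lemma Ele_pow_bigmax (I : eqType) (s : seq I) (f : I -> T -> R) (b : R) r :
  (0 < r)%N -> 0 <= b -> (size s <= 2 ^ r)%N ->
  (forall i, measurable_fun setT (f i)) -> (forall i w, 0 <= f i w) ->
  (forall i, Ele P (fun w => f i w ^+ r) (b ^+ r)) ->
  Ele P (fun w => (\big[Num.max/0]_(i <- s) f i w) ^+ r) ((2 * b) ^+ r).
Proof.
move=> r0 b0 ss mf f0 fb.
have H := Ele_sum s (Q := xpredT) (fun i _ => fb i).
apply: (Ele_le _ _ _ _ H).
- by apply: measurable_funX; exact: measurable_bigmaxr.
- by move=> w; rewrite exprn_ge0// bigmaxr_ge0.
- move=> w; have s0 : 0 <= \sum_(i <- s) f i w ^+ r.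
    by apply: sumr_ge0 => i _; exact: exprn_ge0.
  rewrite big_seq; apply: (big_ind (fun x => x ^+ r <= _)) => //.
  + by rewrite expr0n gtn_eqF.
  + by move=> x y hx hy; case: (leP x y).
  + move=> i si; apply: (@le_sumr_seq _ _ _ (fun i => f i w ^+ r) i _ si) => j.
    exact: exprn_ge0.
- rewrite big_const_seq count_predT iter_addr_0 -[leLHS]mulr_natl exprMn.
  by rewrite ler_wpM2r ?exprn_ge0// -natrX ler_nat.
Qed.

End moment_calculus_more.

Lemma bigmaxr_le (R : realType) (I : eqType) (s : seq I) (h : I -> R) c :
  0 <= c -> (forall i, h i <= c) -> \big[Num.max/0]_(j <- s) h j <= c.
Proof.
move=> c0 hc; elim: s => [|j s ih]; first by rewrite big_nil.
by rewrite big_cons ge_max hc.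
Qed.

Section bootstrap.
Context d (T : measurableType d) (R : realType) (P : probability T R) (n : nat).
Variable X : 'I_n -> T -> R.
Hypothesis hX : subgaussian_family P X.
Variables (m : nat) (Th : finType) (A : Th -> 'M[R]_(m, n)).
Variables (dist : Th -> Th -> R) (Dinf D2 : R).
Hypothesis dist0 : forall s t, 0 <= dist s t.
Hypothesis distA : forall s t x, nrm ((A t - A s) *m x) <= dist s t * nrm x.
Hypothesis Dinf0 : 0 <= Dinf.
Hypothesis DinfA : forall t x, nrm (A t *m x) <= Dinf * nrm x.
Hypothesis D20 : 0 <= D2.
Hypothesis D2A : forall t, frob2 (A t) <= D2 ^+ 2.
Variables (l N : nat) (s : nat -> seq Th) (pi : nat -> Th -> Th) (g : R).
Hypothesis lN : (l <= N)%N.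
Hypothesis g0 : 0 <= g.
Hypothesis ss : forall k, (l <= k <= N)%N -> (size (s k) <= 2 ^ (2 ^ k))%N.
Hypothesis pis : forall k t, (l <= k <= N)%N -> pi k t \in s k.
Hypothesis piN : forall t, pi N t = t.
Hypothesis pig : forall t,
  \sum_(l <= k < N) Num.sqrt (2 ^+ k) * dist (pi k t) (pi k.+1 t) <= g.

(* The family is extended by the zero matrix, at distance Dinf, from which a
   second chain starts. *)
Definition opt_mx (a : option Th) : 'M[R]_(m, n) := if a is Some t then A t else 0.

Definition opt_dist (a b : option Th) : R :=
  match a, b with
  | Some s, Some t => dist s t
  | None, None => 0
  | _, _ => Dinf
  end.

(** The jump from the zero matrix at level l costs sqrt(2^l) [Dinf]. The remaining links are delayed
    by one level, which at most doubles their weights. *)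
Definition chain_weight : R := Num.sqrt (2 ^+ l) * Dinf + 2 * g.

Local Notation r := (2 ^ l.+1)%N.

Lemma opt_dist_ge0 a b : 0 <= opt_dist a b.
Proof. by case: a b => [a|] [b|] /=. Qed.

Lemma opt_distA a b x :
  nrm ((opt_mx b - opt_mx a) *m x) <= opt_dist a b * nrm x.
Proof.
case: a b => [a|] [b|] /=; rewrite ?subr0 ?sub0r//; last by rewrite mul0mx nrm0 mul0r.
rewrite mulNmx (_ : nrm (- _) = nrm (A a *m x))//.
by rewrite /nrm dotvNl dotvNr opprK.
Qed.

Lemma opt_frob2 a : frob2 (opt_mx a) <= D2 ^+ 2.
Proof.
case: a => [a|] /=; first exact: D2A.
rewrite /frob2 big1 ?sqr_ge0// => i _; rewrite big1// => j _.
by rewrite mxE expr0n.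
Qed.

Lemma chain_weight_ge0 : 0 <= chain_weight.
Proof. by rewrite addr_ge0 ?mulr_ge0 ?sqrtr_ge0. Qed.

Section chains.
Variables (F : option Th -> T -> R) (H : T -> R).
Variables (Y : nat -> option Th -> option Th -> T -> R) (c : R).
Hypothesis c0 : 0 < c.
Hypothesis H0 : forall w, 0 <= H w.
Hypothesis Y0 : forall q a b w, 0 <= Y q a b w.
Hypothesis mY : forall q a b, measurable_fun setT (Y q a b).
Hypothesis Yc : forall q a b, (0 < q)%N ->
  Ele P (fun w => Y q a b w ^+ q) (c ^+ q).
Hypothesis FY : forall q a b w, (0 < q)%N ->
  `|F b w - F a w| <= opt_dist a b * Num.sqrt q%:R * Y q a b w * H w.

(** Running from [pi l t] to [t] inside the family, this chain avoids the jump from zero and has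
    weight [g] alone. *)
Lemma inner_chain : exists W : T -> R, [/\ forall w, 0 <= W w,
  measurable_fun setT W,
  Ele P (fun w => W w ^+ (2 * r)) ((16 * c) ^+ (2 * r)) &
  forall t w, `|F (Some t) w - F (Some (pi l t)) w| <= g * W w * H w].
Proof.
have := @chaining _ T R P Th (option Th) l N F opt_dist H Y c g
  (fun k => map Some (s k)) (fun k t => Some (pi k t)) lN c0 opt_dist_ge0 H0 Y0
  mY Yc FY.
case.
- by move=> k kN; rewrite size_map; exact: ss.
- by move=> k t kN; rewrite mem_map; [exact: pis|move=> ? ? []].
- by move=> t; exact: pig.
- move=> W [W0 mW WM WF]; exists W; split => //.
  by move=> t w; have := WF t w; rewrite piN.
Qed.

(** At level l only [None] is allowed, and level k + 1 uses the points of [s k]. As the process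
    vanishes at [None], a bound on increments becomes a bound on the process. *)
Lemma zero_chain : (forall w, F None w = 0) ->
  exists W : T -> R, [/\ forall w, 0 <= W w,
  measurable_fun setT W,
  Ele P (fun w => W w ^+ (2 * r)) ((16 * c) ^+ (2 * r)) &
  forall a w, `|F a w| <= chain_weight * W w * H w].
Proof.
move=> F0.
have := @chaining _ T R P Th (option Th) l N.+1 F opt_dist H Y c chain_weight
  (fun k => if (k <= l)%N then [:: None] else map Some (s k.-1))
  (fun k t => if (k <= l)%N then None else Some (pi k.-1 t))
  (leqW lN) c0 opt_dist_ge0 H0 Y0 mY Yc FY.
case.
- move=> k /andP[lk kN]; case: (leqP k l) => [_|]; first by rewrite expn_gt0.
  case: k lk kN => // k lk kN klt; rewrite size_map/=.
  apply: (@leq_trans (2 ^ (2 ^ k))); last by rewrite leq_exp2l// leq_exp2l.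
  by apply: ss; rewrite -ltnS klt -ltnS.
- move=> k t /andP[lk kN]; case: (leqP k l) => [_|]; first by rewrite mem_head.
  case: k lk kN => // k lk kN klt; rewrite mem_map/=; last by move=> ? ? [].
  by apply: pis; rewrite -ltnS klt -ltnS.
- move=> t; rewrite big_ltn ?ltnS// leqnn ltnn /= big_add1/=; apply: lerD => //.
  have h : \sum_(l <= k < N) Num.sqrt (2 ^+ k.+1) *
      opt_dist (if (k.+1 <= l)%N then None else Some (pi k t))
               (if (k.+2 <= l)%N then None else Some (pi k.+1 t)) <=
      2 * \sum_(l <= k < N) Num.sqrt (2 ^+ k) * dist (pi k t) (pi k.+1 t).
    rewrite mulr_sumr; apply: ler_sum_nat => k /andP[lk kN].
    have -> : (k < l)%N = false by apply/negbTE; rewrite -leqNgt.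
    have -> : (k.+1 < l)%N = false by apply/negbTE; rewrite -leqNgt leqW.
    rewrite /= mulrA ler_wpM2r//.
    rewrite -[leRHS]ger0_norm ?mulr_ge0 ?sqrtr_ge0// -sqrtr_sqr ler_sqrt ?sqr_ge0//.
    rewrite exprMn sqr_sqrtr ?exprn_ge0// exprS ler_wpM2r ?exprn_ge0//.
    by rewrite expr2; lra.
  by apply: le_trans h _; rewrite ler_wpM2l.
- move=> W [W0 mW WM WF]; exists W; split => //.
  case=> [t|] w; last first.
    by rewrite F0 normr0 !mulr_ge0// chain_weight_ge0.
  have := WF t w; rewrite leqnn ltnNge lN/= piN.
  by rewrite F0 subr0.
Qed.

End chains.

Local Notation AO := opt_mx.
Local Notation ddO := opt_dist.
Local Notation v i := (second_moment P (X i)).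
Local Notation gz := chain_weight.
Local Notation V2 := (diag_sup X AO).
Local Notation NN := (nrm_sup X AO).
Local Notation xi := (tup X).

Let mX i : measurable_fun setT (X i). Proof. by case: hX. Qed.

Let r_gt0 : (0 < r)%N. Proof. by rewrite expn_gt0. Qed.

Lemma diag_const_gt0 : 0 < diag_const R.
Proof.
by rewrite mulr_gt0// addr_gt0// mulr_gt0// bernstein_const_gt0.
Qed.

Lemma bilin_const_gt0 : 0 < bilin_const R.
Proof. by rewrite mulr_gt0// mulr_gt0// expR_gt0. Qed.

Lemma diag_inner_chain : exists W : T -> R, [/\ forall w, 0 <= W w,
  measurable_fun setT W,
  Ele P (fun w => W w ^+ (2 * r)) ((16 * diag_const R) ^+ (2 * r)) &
  forall t w, `|diag_dev P X AO (Some t) w - diag_dev P X AO (Some (pi l t)) w|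
    <= g * W w * (D2 + Num.sqrt (V2 w))].
Proof.
apply: (@inner_chain _ _ (diag_factor P X AO ddO D2)).
- exact: diag_const_gt0.
- by move=> w; rewrite addr_ge0 ?sqrtr_ge0.
- by move=> q a b w; apply: diag_factor_ge0 => //; exact: opt_dist_ge0.
- by move=> q a b; exact: measurable_diag_factor.
- move=> q a b q0; apply: diag_factor_moment => //.
  + exact: opt_dist_ge0.
  + exact: opt_distA.
  + exact: opt_frob2.
- move=> q a b w q0; apply: diag_increment => //.
  + exact: opt_dist_ge0.
  + exact: opt_distA.
  + exact: opt_frob2.
Qed.

Lemma diag_dev_None w : diag_dev P X AO None w = 0.
Proof.
apply: big1 => i _; rewrite [colsq _ _]big1 ?mul0r// => k _.
by rewrite mxE expr0n.
Qed.

Lemma diag_zero_chain : exists W : T -> R, [/\ forall w, 0 <= W w,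
  measurable_fun setT W,
  Ele P (fun w => W w ^+ (2 * r)) ((16 * diag_const R) ^+ (2 * r)) &
  forall a w, `|diag_dev P X AO a w| <= gz * W w * (D2 + Num.sqrt (V2 w))].
Proof.
apply: (@zero_chain _ _ (diag_factor P X AO ddO D2)).
- exact: diag_const_gt0.
- by move=> w; rewrite addr_ge0 ?sqrtr_ge0.
- by move=> q a b w; apply: diag_factor_ge0 => //; exact: opt_dist_ge0.
- by move=> q a b; exact: measurable_diag_factor.
- move=> q a b q0; apply: diag_factor_moment => //.
  + exact: opt_dist_ge0.
  + exact: opt_distA.
  + exact: opt_frob2.
- move=> q a b w q0; apply: diag_increment => //.
  + exact: opt_dist_ge0.
  + exact: opt_distA.
  + exact: opt_frob2.
- exact: diag_dev_None.
Qed.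

(** With u = gz W and y = sqrt V2, the inequality y^2 <= D2^2 + u (D2 + y) gives y^2 <= 3 D2^2 + 2
    u^2. The outer 2 is the cost of adding the two terms. *)
Definition diag_sup_const : R := 2 * (3 + 2 * (16 * diag_const R) ^+ 2).

Lemma diag_sup_const_ge1 : 1 <= diag_sup_const.
Proof. by rewrite /diag_sup_const; have := sqr_ge0 (16 * diag_const R); lra. Qed.

(* V2 <= D2^2 + gz W (D2 + sqrt V2) pointwise; the last term is absorbed. *)
Lemma diag_sup_moment :
  Ele P (fun w => V2 w ^+ r) ((diag_sup_const * (D2 + gz) ^+ 2) ^+ r).
Proof.
have [_ _ sX _ _] := hX.
have [W [W0 mW WM hW]] := diag_zero_chain.
have gz0 := chain_weight_ge0.
have pt w : V2 w <= 3 * D2 ^+ 2 + 2 * gz ^+ 2 * W w ^+ 2.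
  have V0 : 0 <= V2 w by exact: diag_sup_ge0.
  have h : V2 w <= D2 ^+ 2 + gz * W w * (D2 + Num.sqrt (V2 w)).
    apply: bigmaxr_le => [|a].
      apply: addr_ge0; first exact: sqr_ge0.
      by rewrite !mulr_ge0// addr_ge0 ?sqrtr_ge0.
    have -> : \sum_i colsq (AO a) i * X i w ^+ 2 =
        diag_dev P X AO a w + \sum_i colsq (AO a) i * v i.
      by rewrite -big_split; apply: eq_bigr => i _ /=; rewrite mulrBr subrK.
    rewrite addrC; apply: lerD; last by apply: ler_normlW; exact: hW.
    apply: le_trans (opt_frob2 a); rewrite -sum_colsq; apply: ler_sum => i _.
    by rewrite ler_piMr ?colsq_ge0// second_moment_le1.
  have := sqr_sqrtr V0; move: h; set y := Num.sqrt _ => h <-.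
  move: h; rewrite -{1}(sqr_sqrtr V0) -/y; set u := gz * W w => h.
  rewrite -mulrA -exprMn -/u; have := sqr_ge0 (u - y); have := sqr_ge0 (u - D2).
  by rewrite !expr2 in h *; lra.
have q1 : 0 <= 3 * D2 ^+ 2 by apply: mulr_ge0 => //; exact: sqr_ge0.
have q2 y : 0 <= 2 * gz ^+ 2 * y ^+ 2.
  by apply: mulr_ge0; [apply: mulr_ge0 => //|]; exact: sqr_ge0.
have H : Ele P (fun w => (3 * D2 ^+ 2 + 2 * gz ^+ 2 * W w ^+ 2) ^+ r)
   ((2 * (3 * D2 ^+ 2 + 2 * gz ^+ 2 * (16 * diag_const R) ^+ 2)) ^+ r).
  apply: Ele_powD => //.
  - by apply: measurable_funM => //; exact: measurable_funX.
  - by apply: Ele_cst; exact: exprn_ge0.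
  - apply: Ele_powZ; first by rewrite mulr_ge0 ?sqr_ge0.
    by rewrite -exprM; apply: Ele_ext WM => // w; rewrite -exprM.
apply: Ele_pow_le H.
- exact: (measurable_diag_sup hX).
- by move=> w; rewrite diag_sup_ge0 pt.
- rewrite mulr_ge0 ?addr_ge0//= -[leRHS]mulrA ler_wpM2l//.
  set k := (16 * _) ^+ 2; have k0 : 0 <= k by exact: sqr_ge0.
  have hDg := mulr_ge0 D20 gz0; have hD := sqr_ge0 D2; have hg := sqr_ge0 gz.
  have h1 := mulr_ge0 k0 hDg; have h2 := mulr_ge0 k0 hD.
  move: hDg hD hg h1 h2; rewrite !expr2 => *.
  by lra.
Qed.

Section bilinear_chains.
Variables I J : {set 'I_n}.
Hypothesis IJ : forall i, i \in I -> i \notin J.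

Lemma bilin_inner_chain : exists W : T -> R, [/\ forall w, 0 <= W w,
  measurable_fun setT W,
  Ele P (fun w => W w ^+ (2 * r)) ((16 * bilin_const R) ^+ (2 * r)) &
  forall t w, `|bilin X AO I J (Some t) w - bilin X AO I J (Some (pi l t)) w|
    <= g * W w * (NN I w + NN J w)].
Proof.
apply: (@inner_chain _ _ (bilin_factor X AO ddO I J)).
- exact: bilin_const_gt0.
- by move=> w; rewrite addr_ge0 ?nrm_sup_ge0.
- by move=> q a b w; apply: bilin_factor_ge0; exact: opt_dist_ge0.
- by move=> q a b; apply: (measurable_bilin_factor hX); exact: opt_dist_ge0.
- move=> q a b q0; apply: bilin_factor_moment => //.
  + exact: opt_dist_ge0.
  + exact: opt_distA.
- move=> q a b w q0; apply: bilin_increment => //.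
  + exact: opt_dist_ge0.
  + exact: opt_distA.
Qed.

Lemma bilin_zero_chain : exists W : T -> R, [/\ forall w, 0 <= W w,
  measurable_fun setT W,
  Ele P (fun w => W w ^+ (2 * r)) ((16 * bilin_const R) ^+ (2 * r)) &
  forall a w, `|bilin X AO I J a w| <= gz * W w * (NN I w + NN J w)].
Proof.
apply: (@zero_chain _ _ (bilin_factor X AO ddO I J)).
- exact: bilin_const_gt0.
- by move=> w; rewrite addr_ge0 ?nrm_sup_ge0.
- by move=> q a b w; apply: bilin_factor_ge0; exact: opt_dist_ge0.
- by move=> q a b; apply: (measurable_bilin_factor hX); exact: opt_dist_ge0.
- move=> q a b q0; apply: bilin_factor_moment => //.
  + exact: opt_dist_ge0.
  + exact: opt_distA.
- move=> q a b w q0; apply: bilin_increment => //.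
  + exact: opt_dist_ge0.
  + exact: opt_distA.
- by move=> w; rewrite /bilin !mul0mx dotv0l.
Qed.

End bilinear_chains.

(** Absorption presupposes a finite moment. The bound depends on n and r, but its size disappears in
    the iteration. *)
Lemma nrm_sup_finite : exists2 M : R, 0 <= M &
  forall I, Ele P (fun w => (NN I w ^+ 2) ^+ r) M.
Proof.
have [_ indX sX _ _] := hX.
pose S w := \sum_(i in [set: 'I_n]%SET) X i w ^+ 2.
have S0 w : 0 <= S w by apply: sumr_ge0 => i _; exact: sqr_ge0.
have H := EleZ (k := (D2 ^+ 2) ^+ r * r`!%:R) _
  (mgf_sum_squares mX indX sX [set: 'I_n]%SET).
have k0 : 0 <= (D2 ^+ 2) ^+ r * r`!%:R :> R.
  by rewrite mulr_ge0// exprn_ge0// sqr_ge0.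
exists ((D2 ^+ 2) ^+ r * r`!%:R * 2 ^+ #|[set: 'I_n]%SET|).
  by rewrite mulr_ge0// exprn_ge0.
move=> I; apply: (Ele_le _ _ _ (lexx _) (H k0)).
- apply: measurable_funX; apply: measurable_funX.
  exact: (measurable_nrm_sup hX).
- by move=> w; rewrite exprn_ge0// sqr_ge0.
- move=> w; rewrite -mulrA.
  apply: (@le_trans _ _ ((D2 ^+ 2) ^+ r * S w ^+ r)); last first.
    rewrite ler_wpM2l ?exprn_ge0 ?sqr_ge0//.
    exact: expr_le_fact_expR.
  have DS0 : 0 <= D2 ^+ 2 * S w by apply: mulr_ge0 => //; exact: sqr_ge0.
  rewrite -exprMn; apply: lerXn2r; rewrite ?nnegrE ?sqr_ge0//.
  rewrite -(sqr_sqrtr DS0).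
  apply: lerXn2r; rewrite ?nnegrE ?sqrtr_ge0 ?nrm_sup_ge0//.
  apply: bigmaxr_le => [|a]; first exact: sqrtr_ge0.
  rewrite ler_sqrt// dotvE; apply: le_trans (ler_wpM2r (S0 w) (opt_frob2 a)).
  rewrite /frob2 mulr_suml; apply: ler_sum => k _.
  rewrite mxE; apply: le_trans (cauchy_schwarz_sum _ _ _) _.
  apply: ler_wpM2l; first by apply: sumr_ge0 => j _; exact: sqr_ge0.
  rewrite /S [leRHS](eq_bigl xpredT); last by move=> i; rewrite inE.
  apply: ler_sum => i _; rewrite mxE; case: ifP => _.
    by rewrite tnth_mktuple.
  by rewrite expr0n/= sqr_ge0.
Qed.

(** Two splittings of sums cost 4, and one more factor 2 is slack: since r >= 2, it turns the new
    term into a quarter of the target. The 512 is the weight of the chaining term after AM-GM. *)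
Definition nrm_sup_const : R :=
  8 * (diag_sup_const + 512 * (16 * bilin_const R) ^+ 2).

Lemma nrm_sup_const_ge0 : 0 <= nrm_sup_const.
Proof.
rewrite /nrm_sup_const; have := diag_sup_const_ge1.
by have := sqr_ge0 (16 * bilin_const R); lra.
Qed.

Local Notation setsn := {set 'I_n}.

Let card_sets : #|{: setsn}| = (2 ^ n)%N.
Proof. by rewrite -cardsT -powersetT card_powerset cardsT card_ord. Qed.

(* One round of the bootstrap: decoupling bounds N_I^2 by the diagonal, a
   chaining term and a small multiple of the N_J^2 themselves. *)
Let improve (M : R) : 0 <= M ->
  (forall I, Ele P (fun w => (NN I w ^+ 2) ^+ r) M) ->
  forall I, Ele P (fun w => (NN I w ^+ 2) ^+ r)
    (4^-1 * (nrm_sup_const * (D2 + gz) ^+ 2) ^+ r + M / 2).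
Proof.
move=> M0 hM I; have gz0 := chain_weight_ge0.
have mNN K : measurable_fun setT (NN K) := measurable_nrm_sup hX AO K.
have disj (J : setsn) i : i \in (I :&: J)%SET -> i \notin (I :\: J)%SET.
  by rewrite !inE => /andP[_ ->].
have /choice[W hW] := fun J => bilin_zero_chain (disj J).
have W0 J w : 0 <= W J w by case: (hW J).
have mW J : measurable_fun setT (W J) by case: (hW J).
have N0 K w : 0 <= NN K w := nrm_sup_ge0 X AO K w.
(* For each of the two block norms n, 4 u n <= (16 u)^2 + (n/8)^2 with u = gz W; this gives 512 = 2
   * 16^2 and the weight 1/64. After all splittings that weight leaves 2M / 16^r, well below M /
   2. *)
pose a := 512 * gz ^+ 2.
have a0 : 0 <= a by apply: mulr_ge0; [exact: ler0n|exact: sqr_ge0].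
pose U w := #|{: setsn}|%:R^-1 * \sum_J a * W J w ^+ 2.
pose Q J w := 64^-1 * (NN (I :&: J)%SET w ^+ 2 + NN (I :\: J)%SET w ^+ 2).
have aW0 J w : 0 <= a * W J w ^+ 2 by apply: mulr_ge0 => //; exact: sqr_ge0.
have U0 w : 0 <= U w by rewrite mulr_ge0 ?invr_ge0// sumr_ge0.
have Q0 J w : 0 <= Q J w by rewrite mulr_ge0// addr_ge0// sqr_ge0.
pose meanQ w := #|{: setsn}|%:R^-1 * \sum_J Q J w.
have meanQ0 w : 0 <= meanQ w by rewrite mulr_ge0 ?invr_ge0// sumr_ge0.
have V20 w : 0 <= V2 w := diag_sup_ge0 X AO w.
have mV2 : measurable_fun setT V2 := measurable_diag_sup hX AO.
have mU : measurable_fun setT U.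
  apply: measurable_funM => //; apply: measurable_sum => J.
  by apply: measurable_funM => //; exact: measurable_funX.
have mQ J : measurable_fun setT (Q J).
  by apply: measurable_funM => //; apply: measurable_funD; exact: measurable_funX.
have mmQ : measurable_fun setT meanQ.
  by apply: measurable_funM => //; exact: measurable_sum.
have pt w : NN I w ^+ 2 <= (V2 w + U w) + meanQ w.
  have S0 : 0 <= V2 w + U w + meanQ w by rewrite !addr_ge0.
  rewrite -(sqr_sqrtr S0).
  apply: lerXn2r; rewrite ?nnegrE ?sqrtr_ge0//.
  apply: bigmaxr_le => [|b]; first exact: sqrtr_ge0.
  rewrite -[leLHS](ger0_norm (nrm_ge0 _)) -sqrtr_sqr ler_sqrt// decoupling -addrA.
  apply: lerD.
    apply: le_trans (diag_sup_ge X AO b w).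
    rewrite [leRHS](bigID (mem I))/= -[leLHS]addr0; apply: lerD.
      by apply: ler_sum => i _; rewrite tnth_mktuple.
    by apply: sumr_ge0 => i _; rewrite mulr_ge0 ?colsq_ge0 ?sqr_ge0.
  rewrite /U /meanQ -mulrDr -big_split/= card_sets natrX.
  rewrite [4 / _]mulrC -mulrA ler_wpM2l ?invr_ge0 ?exprn_ge0//.
  rewrite mulr_sumr; apply: ler_sum => J _.
  have [_ _ _ /(_ b w) h] := hW J.
  have {}h := ler_normlW h.
  rewrite /Q /a; move: h; rewrite /bilin.
  move: (dotv _ _) (NN _ w) (NN _ w) => D n1 n2.
  move: (W J w) => y h.
  have := sqr_ge0 (gz * y * 16 - n1 / 8); have := sqr_ge0 (gz * y * 16 - n2 / 8).
  by move: h; rewrite !expr2; lra.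
have E1 : Ele P (fun w => (V2 w + U w) ^+ r)
    ((2 * (diag_sup_const * (D2 + gz) ^+ 2 + a * (16 * bilin_const R) ^+ 2)) ^+ r).
  apply: Ele_powD => //.
  - apply: mulr_ge0; last exact: sqr_ge0.
    by rewrite (le_trans ler01)// diag_sup_const_ge1.
  - by apply: mulr_ge0 => //; exact: sqr_ge0.
  - exact: diag_sup_moment.
  - apply: Ele_pow_mean => //.
    + by rewrite card_sets expn_gt0.
    + by apply: mulr_ge0 => //; exact: sqr_ge0.
    + by move=> J; apply: measurable_funM => //; exact: measurable_funX.
    + move=> J; apply: Ele_powZ => //; have [_ _ WM _] := hW J.
      by rewrite -exprM; apply: Ele_ext WM => // w; rewrite -exprM.
have E2 : Ele P (fun w => meanQ w ^+ r) (32^-1 ^+ r * (2 * M)).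
  have H J : Ele P (fun w => Q J w ^+ r) (32^-1 ^+ r * (M + M)).
    apply: (Ele_le _ _ _ _ (EleZ (k := 32^-1 ^+ r) _
       (EleD (hM (I :&: J)%SET) (hM (I :\: J)%SET)))).
    + exact: measurable_funX.
    + by move=> w; rewrite exprn_ge0.
    + move=> w; rewrite /Q (_ : 64^-1 = 32^-1 * 2^-1); last by field.
      rewrite -mulrA exprMn ler_wpM2l ?exprn_ge0//.
      rewrite exprMn; apply: le_trans (ler_wpM2l _ (exprD_le r (sqr_ge0 _) (sqr_ge0 _))) _.
        by rewrite exprn_ge0.
      by rewrite exprVn mulKf// expf_neq0.
    + exact: lexx.
    + by rewrite exprn_ge0.
  have i0 : 0 <= #|{: setsn}|%:R^-1 :> R by rewrite invr_ge0.
  have H2 := EleZ i0 (Ele_sum (index_enum {: setsn}) (Q := xpredT) (fun J _ => H J)).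
  apply: (Ele_le _ _ _ _ H2).
  - exact: measurable_funX.
  - by move=> w; rewrite exprn_ge0.
  - by move=> w; apply: mean_pow_le.
  - rewrite sumr_const -[X in _ * X]mulr_natl mulKf.
      by rewrite ler_wpM2l ?exprn_ge0//; lra.
    by rewrite pnatr_eq0 card_sets -lt0n expn_gt0.
apply: (Ele_le _ _ _ _ (EleZ (k := 2 ^+ r) _ (EleD E1 E2))).
- by apply: measurable_funX; exact: measurable_funX.
- by move=> w; rewrite exprn_ge0// sqr_ge0.
- move=> w; apply: le_trans (exprD_le _ (addr_ge0 (V20 w) (U0 w)) (meanQ0 w)).
  by apply: lerXn2r; rewrite ?nnegrE ?sqr_ge0 ?addr_ge0.
- rewrite mulrDr; apply: lerD.
    set rho := D2 + gz; set k := (16 * bilin_const R) ^+ 2.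
    have k0 : 0 <= k by exact: sqr_ge0.
    have rho0 : 0 <= rho := addr_ge0 D20 gz0.
    have gr : gz ^+ 2 <= rho ^+ 2.
      by apply: lerXn2r; rewrite ?nnegrE// lerDr.
    have kk : k * gz ^+ 2 <= k * rho ^+ 2 by rewrite ler_wpM2l.
    have d0 : 0 <= diag_sup_const * rho ^+ 2.
      apply: mulr_ge0; last exact: sqr_ge0.
      by rewrite (le_trans ler01)// diag_sup_const_ge1.
    have ak : 0 <= a * k by exact: mulr_ge0.
    apply: (@le_trans _ _ ((2^-1 * (nrm_sup_const * rho ^+ 2)) ^+ r)).
      rewrite -exprMn; apply: lerXn2r; rewrite ?nnegrE.
      + by rewrite mulr_ge0// mulr_ge0// addr_ge0.
      + rewrite mulr_ge0// mulr_ge0 ?sqr_ge0//; exact: nrm_sup_const_ge0.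
      + by rewrite /nrm_sup_const -/k /a; lra.
    rewrite exprMn ler_wpM2r//.
      by rewrite exprn_ge0// mulr_ge0 ?sqr_ge0// nrm_sup_const_ge0.
    (* As r >= 2, the spare factor 1/2 inside the r-th power is worth at least 1/4 outside. *)
    rewrite (_ : 4^-1 = 2^-1 ^+ 2 :> R); last by rewrite expr2; field.
    apply: ler_wiXn2l; rewrite ?invr_ge0// ?invf_le1 ?ler1n//.
    by rewrite -[X in (X <= _)%N]expn1 leq_exp2l.
  rewrite mulrA -exprMn (_ : 2 * 32^-1 = 16^-1); last by field.
  have : 16^-1 ^+ r <= 16^-1 ^+ 1 :> R.
    apply: ler_wiXn2l; rewrite ?invr_ge0// ?invf_le1 ?ler1n//.
  move=> /(ler_wpM2r (mulr_ge0 (ler0n R 2) M0)); rewrite expr1.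
  by move=> /le_trans; apply; lra.
- by rewrite exprn_ge0.
Qed.

(** After k rounds the moment is at most b + M / 2^k, because b/4 + b/2 <= b; the rounds run over
    all subsets simultaneously, and k tends to infinity. *)
Lemma nrm_sup_moment I :
  Ele P (fun w => (NN I w ^+ 2) ^+ r) ((nrm_sup_const * (D2 + gz) ^+ 2) ^+ r).
Proof.
have [M M0 hM] := nrm_sup_finite.
set b := (nrm_sup_const * (D2 + gz) ^+ 2) ^+ r.
have b0 : 0 <= b.
  by rewrite exprn_ge0// mulr_ge0 ?sqr_ge0// nrm_sup_const_ge0.
have iter k : forall I, Ele P (fun w => (NN I w ^+ 2) ^+ r) (b + M / 2 ^+ k).
  elim: k => [|k ih] I'; first by apply: Ele_weak (hM I'); rewrite divr1 lerDr.
  apply: Ele_weak (improve _ ih I').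
    have -> : M / 2 ^+ k.+1 = M / 2 ^+ k / 2.
      by rewrite exprS; field; rewrite expf_neq0.
    by rewrite -/b; move: (M / _) => c; lra.
  by rewrite addr_ge0// divr_ge0// exprn_ge0.
apply: Ele_lim => e e0.
have [k hk] : exists k, M / 2 ^+ k <= e.
  have := archi_boundP (divr_ge0 M0 (ltW e0)); set k := Num.bound _ => hk.
  exists k; rewrite ler_pdivrMr ?exprn_gt0// mulrC -ler_pdivrMr//.
  apply: le_trans (ltW hk) _; rewrite -natrX ler_nat ltnW//.
  exact: ltn_expl.
by apply: Ele_weak (iter k I); rewrite lerD2l.
Qed.

End bootstrap.

(** * Deviation of a real family *)

Section gram.
Context d (T : measurableType d) (R : realType) (P : probability T R) (n : nat).
Variable X : 'I_n -> T -> R.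
Hypothesis hX : subgaussian_family P X.
Variables (m : nat) (B : 'M[R]_(m, n)) (Dinf D4 : R) (l : nat).
Hypothesis Dinf0 : 0 <= Dinf.
Hypothesis DinfB : forall x, nrm (B *m x) <= Dinf * nrm x.
Hypothesis D40 : 0 <= D4.
Hypothesis D4B : frob2 (B^T *m B) <= D4 ^+ 2.

Local Notation r := (2 ^ l.+1)%N.
Local Notation xi := (tup X).

(** The 2 is sqrt(2r) / sqrt(2^l). Adding 1 to [nrm_sup_const] dominates its square root, by c <= (c
    + 1)^2. *)
Definition gram_const : R :=
  2 * khintchine_const R * (nrm_sup_const R + 1).

Lemma gram_const_ge0 : 0 <= gram_const.
Proof.
rewrite !mulr_ge0 ?addr_ge0 ?expR_ge0//.
exact: nrm_sup_const_ge0.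
Qed.

(* Conditionally on the J-coordinates the form is a linear combination of the
   others, with coefficients B^T B x_J; the norm of the latter is controlled by
   the bootstrap applied to the single matrix B^T B. *)
Lemma gram_moment (I J : {set 'I_n}) : (forall i, i \in I -> i \notin J) ->
  Ele P (fun w => `|dotv (B *m msk I (xi w)) (B *m msk J (xi w))| ^+ r)
    ((gram_const * (Num.sqrt r%:R * D4 + r%:R * Dinf ^+ 2)) ^+ r).
Proof.
move=> IJ; pose G := B^T *m B.
have GD x : nrm (G *m x) <= Dinf ^+ 2 * nrm x.
  rewrite -mulmxA; apply: le_trans (adjoint_bound Dinf0 DinfB _) _.
  by rewrite expr2 -mulrA ler_wpM2l.
have D20 : 0 <= Dinf ^+ 2 by exact: sqr_ge0.
have r0 : (0 < r)%N by rewrite expn_gt0.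
have kn := nrm_sup_const_ge0 R.
have kc : 0 < khintchine_const R by rewrite mulr_gt0// expR_gt0.
have HN : Ele P (fun w => (nrm_sup X (opt_mx (fun _ : unit => G)) J w ^+ 2) ^+ r)
    ((nrm_sup_const R * (D4 + chain_weight (Dinf ^+ 2) l 0) ^+ 2) ^+ r).
  (* A family with one member: all distances and [g] are 0, and the chain has no link. For B^T B the
     Frobenius norm is at most [D4] and the operator norm at most the square of [Dinf]. *)
  apply: (@nrm_sup_moment _ T R P n X hX n unit (fun=> G) (fun _ _ => 0)
    (Dinf ^+ 2) D4 _ _ D20 (fun=> GD) D40 (fun=> D4B) l l (fun=> [:: tt])
    (fun _ t => t) 0 (leqnn l) (lexx 0)) => //.
  - by move=> _ _ x; rewrite subrr mul0mx nrm0 mul0r.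
  - by move=> k _; rewrite /= expn_gt0.
  - by rewrite big_geq.
pose s2 : R := Num.sqrt (2 ^+ l).
have rho : D4 + chain_weight (Dinf ^+ 2) l 0 = D4 + s2 * Dinf ^+ 2.
  by rewrite /chain_weight mulr0 addr0.
rewrite rho in HN.
pose b := (nrm_sup_const R + 1) * (D4 + s2 * Dinf ^+ 2).
have s20 : 0 <= s2 by exact: sqrtr_ge0.
have rho0 : 0 <= D4 + s2 * Dinf ^+ 2 by rewrite addr_ge0// mulr_ge0.
have b0 : 0 <= b by rewrite mulr_ge0// addr_ge0.
have mid K (C : 'M[R]_n) i : measurable_fun setT (fun w => (C *m msk K (xi w)) i 0).
  by apply: measurable_mulmx_msk => j; exact: (measurable_tup hX).
have mG : measurable_fun setT (fun w => nrm (G *m msk J (xi w))).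
  exact: measurable_nrm.
have HG : Ele P (fun w => (nrm (G *m msk J (xi w)) ^+ 2) ^+ r) ((b ^+ 2) ^+ r).
  apply: Ele_pow_le HN.
  - exact: measurable_funX.
  - move=> w; rewrite sqr_ge0/=.
    apply: lerXn2r; rewrite ?nnegrE ?nrm_ge0 ?nrm_sup_ge0//.
    exact: (nrm_sup_ge X (opt_mx (fun _ : unit => G)) J (Some tt) w).
  - have q0 := sqr_ge0 (D4 + s2 * Dinf ^+ 2).
    rewrite /b exprMn mulr_ge0//= ler_wpM2r//.
    by have := sqr_ge0 (nrm_sup_const R); rewrite !expr2; lra.
have D1 x : nrm ((1%:M : 'M[R]_n) *m x) <= 1 * nrm x by rewrite mul1mx mul1r.
have r20 : (0 < 2 * r)%N by rewrite muln_gt0.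
(* Khintchine is applied to <x_I, G x_J> with the identity as first matrix, at order 2r to leave
   room for the product with |G x_J|. *)
have HY := @bilinear_moment _ _ _ P n X hX n 1%:M G 1 I J (2 * r) r20 ler01 D1 IJ.
set Y := (fun w => `|dotv (1%:M *m msk I (xi w)) (G *m msk J (xi w))| /
                  (1 * nrm (G *m msk J (xi w)))) in HY.
have mY : measurable_fun setT Y.
  apply: measurable_funM; first by apply: measurableT_comp => //; exact: measurable_dotv.
  apply: measurable_invr_ge0; first by move=> w; rewrite mul1r nrm_ge0.
  by apply: measurable_funM.
have Y0 w : 0 <= Y w by rewrite divr_ge0// mul1r nrm_ge0.
have a0 : 0 < khintchine_const R * Num.sqrt (2 * r)%:R.
  by rewrite mulr_gt0// sqrtr_gt0 ltr0n.
have HP := Ele_pow_prod a0 b0 r0 mY mG Y0 (fun w => nrm_ge0 _) HY HG.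
apply: Ele_pow_le HP.
- apply: measurableT_comp => //; apply: measurable_dotv => i;
    by apply: measurable_mulmx_msk => j; exact: (measurable_tup hX).
- move=> w; rewrite normr_ge0/=.
  rewrite [dotv (B *m _) _]dotv_mulmxl mulmxA -/G.
  rewrite /Y mul1mx mul1r; set y := G *m _; set x := msk I _.
  have [y0|y0] := eqVneq (nrm y) 0; last by rewrite divfK.
  by rewrite y0 mulr0 (nrm_eq0 y0) dotvC dotv0l normr0.
- rewrite mulr_ge0 ?(ltW a0)//= /b /gram_const.
  set k := khintchine_const R; set c := nrm_sup_const R.
  have rE : Num.sqrt (2 * r)%:R = 2 * s2 :> R.
    rewrite -expnS natrX -[l.+2]addn2 exprD sqrtrM ?exprn_ge0//.
    by rewrite sqrtr_sqr ger0_norm// mulrC.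
  have s2r : s2 <= Num.sqrt r%:R.
    rewrite /s2 natrX ler_sqrt ?exprn_ge0//.
    by rewrite ler_eXn2l ?ltr1n.
  have s2s2 : s2 * s2 <= r%:R.
    rewrite -expr2 sqr_sqrtr ?exprn_ge0// natrX.
    by rewrite ler_eXn2l ?ltr1n.
  rewrite rE (_ : k * (2 * s2) * ((c + 1) * (D4 + s2 * Dinf ^+ 2)) =
    2 * k * (c + 1) * (s2 * D4 + s2 * s2 * Dinf ^+ 2)); last by ring.
  apply: ler_wpM2l; first by rewrite !mulr_ge0 ?(ltW kc)// addr_ge0.
  by apply: lerD; apply: ler_wpM2r.
Qed.

End gram.

Section core.
Context d (T : measurableType d) (R : realType) (P : probability T R) (n : nat).
Variable X : 'I_n -> T -> R.
Hypothesis hX : subgaussian_family P X.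
Variables (m : nat) (Th : finType) (A : Th -> 'M[R]_(m, n)).
Variables (dist : Th -> Th -> R) (Dinf D2 D4 : R).
Hypothesis dist0 : forall s t, 0 <= dist s t.
Hypothesis distA : forall s t x, nrm ((A t - A s) *m x) <= dist s t * nrm x.
Hypothesis Dinf0 : 0 <= Dinf.
Hypothesis DinfA : forall t x, nrm (A t *m x) <= Dinf * nrm x.
Hypothesis D20 : 0 <= D2.
Hypothesis D2A : forall t, frob2 (A t) <= D2 ^+ 2.
Hypothesis D40 : 0 <= D4.
Hypothesis D4A : forall t, frob2 ((A t)^T *m A t) <= D4 ^+ 2.
Variables (l N : nat) (s : nat -> seq Th) (pi : nat -> Th -> Th) (g : R).
Hypothesis lN : (l <= N)%N.
Hypothesis g0 : 0 <= g.
Hypothesis ss : forall k, (l <= k <= N)%N -> (size (s k) <= 2 ^ (2 ^ k))%N.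
Hypothesis pis : forall k t, (l <= k <= N)%N -> pi k t \in s k.
Hypothesis piN : forall t, pi N t = t.
Hypothesis pig : forall t,
  \sum_(l <= k < N) Num.sqrt (2 ^+ k) * dist (pi k t) (pi k.+1 t) <= g.

Local Notation r := (2 ^ l.+1)%N.
Local Notation v i := (second_moment P (X i)).
Local Notation AO := (opt_mx A).
Local Notation V2 := (diag_sup X AO).
Local Notation NN := (nrm_sup X AO).
Local Notation xi := (tup X).
Local Notation setsn := {set 'I_n}.

Definition deviation_sup (w : T) : R := \big[Num.max/0]_(t : Th)
  `|nrm (A t *m \col_i X i w) ^+ 2 - \sum_i colsq (A t) i * v i|.

(** The four inner terms belong to the chained and the level-l parts of the diagonal and of the
    bilinear forms. The factor 8 is the decoupling factor 4 times a splitting factor 2. *)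
Definition core_const : R :=
  2 * (2 * (3 * (16 * diag_const R) * (4 + 4 * diag_sup_const R) +
            2 * bernstein_const R) +
       8 * (3 * (16 * bilin_const R) * (8 * nrm_sup_const R + 1) +
            2 * gram_const R)).

Let rho : R := D2 + chain_weight Dinf l g.
(** The scale of a single matrix in the r-th moment. As [D4] bounds the Frobenius norm of a Gram
    matrix, it corresponds to the square of the S^4 norm. *)
Let beta : R := Num.sqrt r%:R * D4 + r%:R * Dinf ^+ 2.
Let Gam : R := g ^+ 2 + D2 * g + Num.sqrt r%:R * D4 + r%:R * Dinf ^+ 2.

Let r_gt0 : (0 < r)%N. Proof. by rewrite expn_gt0. Qed.
Let rR : 0 < r%:R :> R. Proof. by rewrite ltr0n. Qed.
Let rho0 : 0 <= rho.
Proof. by apply: addr_ge0 => //; exact: chain_weight_ge0. Qed.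
Let rD0 : 0 <= r%:R * Dinf ^+ 2.
Proof. by apply: mulr_ge0 (sqr_ge0 _); exact: ltW. Qed.
Let beta0 : 0 <= beta.
Proof. by apply: addr_ge0 => //; rewrite mulr_ge0 ?sqrtr_ge0. Qed.
Let mX i : measurable_fun setT (X i). Proof. by case: hX. Qed.

Let beta_Gam : beta <= Gam.
Proof. by rewrite /Gam -addrA lerDr addr_ge0 ?sqr_ge0// mulr_ge0. Qed.

(** The only mixed term is g sqrt(2^l) [Dinf]; AM-GM splits it into g^2 and 2^l Dinf^2, both of
    which occur in [Gam]. *)
Let grho_Gam : g * rho <= 3 * Gam.
Proof.
rewrite /rho /chain_weight /Gam.
have h1 : Num.sqrt (2 ^+ l) ^+ 2 <= r%:R :> R.
  by rewrite sqr_sqrtr ?exprn_ge0// natrX ler_eXn2l ?ltr1n.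
have h2 := ler_wpM2r (sqr_ge0 Dinf) h1.
have h3 : 0 <= Num.sqrt r%:R * D4 by rewrite mulr_ge0 ?sqrtr_ge0.
have h4 := mulr_ge0 D20 g0.
move: h2 h3 rD0; set q := Num.sqrt (2 ^+ l); set z := Num.sqrt r%:R.
move: (r%:R : R) => rr h2 h3 h5.
have h6 := sqr_ge0 (g - q * Dinf); have h7 := sqr_ge0 g.
have h8 := sqr_ge0 (q * Dinf).
have e1 : (q * Dinf) ^+ 2 = q ^+ 2 * Dinf ^+ 2 by rewrite exprMn.
have e2 : (g - q * Dinf) ^+ 2 = g ^+ 2 - 2 * (g * (q * Dinf)) + (q * Dinf) ^+ 2 by ring.
rewrite e2 e1 in h6.
have -> : g * (D2 + (q * Dinf + 2 * g)) = D2 * g + g * (q * Dinf) + 2 * g ^+ 2 by ring.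
by lra.
Qed.

(** The chain factor has moments of order 2r and the square of D2 + sqrt V2 has moments of order r,
    so the product has moments of order r. The constant 4 + 4 c dominates the square root of 4 + 4
    c. *)
Let dT1 : exists W : T -> R, [/\ forall w, 0 <= W w,
  measurable_fun setT W,
  Ele P (fun w => W w ^+ r)
   ((3 * (16 * diag_const R) * (4 + 4 * diag_sup_const R) * Gam) ^+ r) &
  forall t w, `|diag_dev P X AO (Some t) w - diag_dev P X AO (Some (pi l t)) w|
    <= W w].
Proof.
have [W [W0 mW WM hW]] :=
  diag_inner_chain hX dist0 distA Dinf0 DinfA D20 D2A lN ss pis piN pig.
have mV2 : measurable_fun setT V2 := measurable_diag_sup hX AO.
have mh : measurable_fun setT (fun w => D2 + Num.sqrt (V2 w)).
  by apply: measurable_funD => //; exact: measurable_sqrtr.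
have h0 w : 0 <= D2 + Num.sqrt (V2 w) by rewrite addr_ge0 ?sqrtr_ge0.
have c1 := diag_sup_const_ge1 R.
have b0 : 0 <= (4 + 4 * diag_sup_const R) * rho by rewrite mulr_ge0//; lra.
have HV := diag_sup_moment hX dist0 distA Dinf0 DinfA D20 D2A lN g0 ss pis piN pig.
have Hh : Ele P (fun w => ((D2 + Num.sqrt (V2 w)) ^+ 2) ^+ r)
    ((((4 + 4 * diag_sup_const R) * rho) ^+ 2) ^+ r).
  have q0 : 0 <= diag_sup_const R * rho ^+ 2.
    by apply: mulr_ge0 (sqr_ge0 _); lra.
  have H : Ele P (fun w => (2 * (D2 ^+ 2 + V2 w)) ^+ r)
      ((2 * (2 * (D2 ^+ 2 + diag_sup_const R * rho ^+ 2))) ^+ r).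
    apply: Ele_powZ => //; apply: Ele_powD => //.
    - by move=> w; exact: sqr_ge0.
    - by move=> w; exact: diag_sup_ge0.
    - exact: sqr_ge0.
    - by apply: Ele_cst; rewrite exprn_ge0// sqr_ge0.
  apply: Ele_pow_le H.
  - exact: measurable_funX.
  - move=> w; rewrite sqr_ge0/=.
    have V0 := diag_sup_ge0 X AO w; rewrite -{2}(sqr_sqrtr V0).
    by have := sqr_ge0 (D2 - Num.sqrt (V2 w)); rewrite !expr2; lra.
  - rewrite !mulr_ge0//=; last by rewrite addr_ge0// sqr_ge0.
    have : D2 ^+ 2 <= rho ^+ 2.
      by apply: lerXn2r; rewrite ?nnegrE// lerDl chain_weight_ge0.
    rewrite exprMn; move: (diag_sup_const R) c1 (sqr_ge0 rho) => c c1.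
    move: (rho ^+ 2) (D2 ^+ 2) => x y x0 yx.
    have : 0 <= c * x by apply: mulr_ge0 => //; lra.
    have : 0 <= c ^+ 2 * x by apply: mulr_ge0 => //; exact: sqr_ge0.
    by rewrite sqrrD exprMn; lra.
have a0 : 0 < 16 * diag_const R by rewrite mulr_gt0// diag_const_gt0.
have HP := Ele_pow_prod a0 b0 r_gt0 mW mh W0 h0 WM Hh.
exists (fun w => g * (W w * (D2 + Num.sqrt (V2 w)))); split.
- by move=> w; rewrite !mulr_ge0.
- by apply: measurable_funM => //; exact: measurable_funM.
- apply: Ele_pow_le (Ele_powZ g0 HP).
  + by apply: measurable_funM => //; exact: measurable_funM.
  + by move=> w; rewrite lexx andbT !mulr_ge0.
  + apply/andP; split.
      by apply: mulr_ge0 => //; apply: mulr_ge0 => //; exact: ltW.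
    rewrite (_ : g * _ = (16 * diag_const R) * (4 + 4 * diag_sup_const R) * (g * rho));
      last by ring.
    rewrite (_ : 3 * _ * _ * Gam = (16 * diag_const R) * (4 + 4 * diag_sup_const R) *
      (3 * Gam)); last by ring.
    by rewrite ler_wpM2l// mulr_ge0 ?(ltW a0)//; lra.
- by move=> t w; rewrite mulrA; exact: hW.
Qed.

(** As for the diagonal, a chain factor is multiplied by a random norm; here the bootstrap supplies
    the moments of the two block suprema. *)
Let dT3 (I J : setsn) : (forall i, i \in I -> i \notin J) ->
  exists W : T -> R, [/\ forall w, 0 <= W w,
  measurable_fun setT W,
  Ele P (fun w => W w ^+ r)
   ((3 * (16 * bilin_const R) * (8 * nrm_sup_const R + 1) * Gam) ^+ r) &
  forall t w, `|bilin X AO I J (Some t) w - bilin X AO I J (Some (pi l t)) w|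
    <= W w].
Proof.
move=> IJ; have [W [W0 mW WM hW]] :=
  bilin_inner_chain hX dist0 distA Dinf0 DinfA lN ss pis piN pig IJ.
have mN K : measurable_fun setT (NN K) := measurable_nrm_sup hX AO K.
have mh : measurable_fun setT (fun w => NN I w + NN J w).
  exact: measurable_funD.
have h0 w : 0 <= NN I w + NN J w by rewrite addr_ge0 ?nrm_sup_ge0.
have c1 := nrm_sup_const_ge0 R.
have b0 : 0 <= (8 * nrm_sup_const R + 1) * rho by rewrite mulr_ge0//; lra.
have HN K := nrm_sup_moment hX dist0 distA Dinf0 DinfA D20 D2A lN g0 ss pis piN pig K.
have Hh : Ele P (fun w => ((NN I w + NN J w) ^+ 2) ^+ r)
    ((((8 * nrm_sup_const R + 1) * rho) ^+ 2) ^+ r).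
  have q0 : 0 <= nrm_sup_const R * rho ^+ 2.
    by apply: mulr_ge0 (sqr_ge0 _).
  have H : Ele P (fun w => (2 * (NN I w ^+ 2 + NN J w ^+ 2)) ^+ r)
      ((2 * (2 * (nrm_sup_const R * rho ^+ 2 + nrm_sup_const R * rho ^+ 2))) ^+ r).
    apply: Ele_powZ => //; apply: Ele_powD => //;
      by [exact: measurable_funX|move=> w; exact: sqr_ge0].
  apply: Ele_pow_le H.
  - exact: measurable_funX.
  - move=> w; rewrite sqr_ge0/=.
    by have := sqr_ge0 (NN I w - NN J w); rewrite !expr2; lra.
  - rewrite !mulr_ge0 ?addr_ge0//=.
    rewrite exprMn; move: (nrm_sup_const R) c1 (sqr_ge0 rho) => c c1.
    move: (rho ^+ 2) => x x0.
    have : 0 <= c * x by exact: mulr_ge0.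
    have : 0 <= c ^+ 2 * x by apply: mulr_ge0 => //; exact: sqr_ge0.
    by rewrite sqrrD exprMn expr1n; lra.
have a0 : 0 < 16 * bilin_const R by rewrite mulr_gt0// bilin_const_gt0.
have HP := Ele_pow_prod a0 b0 r_gt0 mW mh W0 h0 WM Hh.
exists (fun w => g * (W w * (NN I w + NN J w))); split.
- by move=> w; rewrite !mulr_ge0.
- by apply: measurable_funM => //; exact: measurable_funM.
- apply: Ele_pow_le (Ele_powZ g0 HP).
  + by apply: measurable_funM => //; exact: measurable_funM.
  + by move=> w; rewrite lexx andbT !mulr_ge0.
  + apply/andP; split.
      by apply: mulr_ge0 => //; apply: mulr_ge0 => //; exact: ltW.
    rewrite (_ : g * _ = (16 * bilin_const R) * (8 * nrm_sup_const R + 1) * (g * rho));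
      last by ring.
    rewrite (_ : 3 * _ * _ * Gam = (16 * bilin_const R) * (8 * nrm_sup_const R + 1) *
      (3 * Gam)); last by ring.
    by rewrite ler_wpM2l// mulr_ge0 ?(ltW a0)//; lra.
- by move=> t w; rewrite mulrA; exact: hW.
Qed.

Let size_sl : (size (s l) <= 2 ^ r)%N.
Proof.
apply: leq_trans (ss _) _; first by rewrite leqnn.
by rewrite leq_exp2l// leq_exp2l.
Qed.

Let T2 w := \big[Num.max/0]_(t <- s l) `|diag_dev P X AO (Some t) w|.

(** Bernstein at scale [beta]: its linear condition uses the operator norm of the columns, its
    quadratic one the S^4 norm. The union over level l costs a factor 2. *)
Let HT2 : Ele P (fun w => T2 w ^+ r) ((2 * bernstein_const R * Gam) ^+ r).
Proof.
have [_ indX sX iX X0] := hX.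
have bc := ltW (bernstein_const_gt0 R).
have mD t : measurable_fun setT (fun w => `|diag_dev P X AO (Some t) w|).
  by apply: measurableT_comp => //; exact: measurable_diag_dev.
have H t : Ele P (fun w => `|diag_dev P X AO (Some t) w| ^+ r)
    ((bernstein_const R * beta) ^+ r).
  have E w : diag_dev P X AO (Some t) w =
      \sum_(i in [set: 'I_n]%SET) colsq (A t) i * (X i w ^+ 2 - v i).
    by apply: eq_bigl => i; rewrite inE.
  under eq_fun do rewrite E.
  apply: bernstein_moment => //.
  - move=> i _; rewrite ger0_norm ?colsq_ge0// /beta -[leLHS]add0r.
    apply: lerD; first by rewrite mulr_ge0 ?sqrtr_ge0.
    by rewrite ler_wpM2l ?(ltW rR)// colsq_le.
  - rewrite (eq_bigl xpredT); last by move=> i; rewrite inE.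
    apply: (@le_trans _ _ (r%:R * D4 ^+ 2)).
      rewrite ler_wpM2l ?(ltW rR)//.
      exact: le_trans (sum_colsq_sqr_le _) (D4A t).
    rewrite -[X in X * _]sqr_sqrtr ?(ltW rR)// -exprMn.
    by apply: lerXn2r; rewrite ?nnegrE ?mulr_ge0 ?sqrtr_ge0// lerDl.
have HM := Ele_pow_bigmax r_gt0 (mulr_ge0 bc beta0) size_sl mD
  (fun t w => normr_ge0 _) H.
apply: Ele_pow_le HM.
- by apply: measurable_bigmaxr => t _.
- by move=> w; rewrite lexx andbT bigmaxr_ge0.
- apply/andP; split; first by apply: mulr_ge0 => //; exact: mulr_ge0.
  by rewrite -[leRHS]mulrA ler_wpM2l// ler_wpM2l.
Qed.

Let T4 (I J : setsn) w := \big[Num.max/0]_(t <- s l) `|bilin X AO I J (Some t) w|.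

Let HT4 (I J : setsn) : (forall i, i \in I -> i \notin J) ->
  Ele P (fun w => T4 I J w ^+ r) ((2 * gram_const R * Gam) ^+ r).
Proof.
move=> IJ; have gc := gram_const_ge0 R.
have mD t : measurable_fun setT (fun w => `|bilin X AO I J (Some t) w|).
  by apply: measurableT_comp => //; exact: (measurable_bilin hX).
have H t : Ele P (fun w => `|bilin X AO I J (Some t) w| ^+ r)
    ((gram_const R * beta) ^+ r).
  exact: (gram_moment hX l Dinf0 (DinfA t) D40 (D4A t) IJ).
have HM := Ele_pow_bigmax r_gt0 (mulr_ge0 gc beta0) size_sl mD
  (fun t w => normr_ge0 _) H.
apply: Ele_pow_le HM.
- by apply: measurable_bigmaxr => t _.
- by move=> w; rewrite lexx andbT bigmaxr_ge0.
- apply/andP; split; first by apply: mulr_ge0 => //; exact: mulr_ge0.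
  by rewrite -[leRHS]mulrA ler_wpM2l// ler_wpM2l.
Qed.

(** Decoupling the whole vector gives blocks J and its complement. Diagonal and forms are each
    compared with their values at [pi l t], and Jensen handles the average over J, so that no union
    over the 2^n subsets is taken. *)
Lemma core_moment :
  Ele P (fun w => deviation_sup w ^+ r) ((core_const * Gam) ^+ r).
Proof.
have [W1 [W10 mW1 HW1 hW1]] := dT1.
have disj (J : setsn) i : i \in J -> i \notin (~: J)%SET.
  by rewrite inE negbK.
have /choice[W3 hW3] := fun J => dT3 (disj J).
have W30 J w : 0 <= W3 J w by case: (hW3 J).
have mW3 J : measurable_fun setT (W3 J) by case: (hW3 J).
have mT2 : measurable_fun setT T2.
  apply: measurable_bigmaxr => t _; apply: measurableT_comp => //.
  exact: (measurable_diag_dev hX).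
have mT4 I J : measurable_fun setT (T4 I J).
  apply: measurable_bigmaxr => t _; apply: measurableT_comp => //.
  exact: (measurable_bilin hX).
have T20 w : 0 <= T2 w by exact: bigmaxr_ge0.
have T40 I J w : 0 <= T4 I J w by exact: bigmaxr_ge0.
have card_sets : #|{: setsn}| = (2 ^ n)%N.
  by rewrite -cardsT -powersetT card_powerset cardsT card_ord.
pose Q J w := W3 J w + T4 J (~: J)%SET w.
have Q0 J w : 0 <= Q J w by rewrite addr_ge0.
have mQ J : measurable_fun setT (Q J) by exact: measurable_funD.
pose M w := #|{: setsn}|%:R^-1 * \sum_J Q J w.
have M0 w : 0 <= M w by rewrite mulr_ge0 ?invr_ge0// sumr_ge0.
have mM : measurable_fun setT M.
  by apply: measurable_funM => //; exact: measurable_sum.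
have Gam0 : 0 <= Gam by exact: le_trans beta0 beta_Gam.
have dc := ltW (diag_const_gt0 R); have blc := ltW (bilin_const_gt0 R).
have dsc := le_trans ler01 (diag_sup_const_ge1 R).
have nc := nrm_sup_const_ge0 R; have gc := gram_const_ge0 R.
have bc := ltW (bernstein_const_gt0 R).
set k1 := 3 * (16 * diag_const R) * (4 + 4 * diag_sup_const R) in HW1.
set k3 := 3 * (16 * bilin_const R) * (8 * nrm_sup_const R + 1) in hW3.
have k10 : 0 <= k1.
  apply: mulr_ge0; first by apply: mulr_ge0 => //; exact: mulr_ge0.
  by apply: addr_ge0 => //; exact: mulr_ge0.
have k30 : 0 <= k3.
  apply: mulr_ge0; first by apply: mulr_ge0 => //; exact: mulr_ge0.
  by apply: addr_ge0 => //; exact: mulr_ge0.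
set k2 := 2 * bernstein_const R.
set k4 := 2 * gram_const R.
have k20 : 0 <= k2 by exact: mulr_ge0.
have k40 : 0 <= k4 by exact: mulr_ge0.
have k12 : 0 <= 2 * (k1 * Gam + k2 * Gam).
  by apply: mulr_ge0 => //; apply: addr_ge0; exact: mulr_ge0.
have k34 : 0 <= 2 * (k3 * Gam + k4 * Gam).
  by apply: mulr_ge0 => //; apply: addr_ge0; exact: mulr_ge0.
have HM : Ele P (fun w => M w ^+ r) ((2 * (k3 * Gam + k4 * Gam)) ^+ r).
  apply: Ele_pow_mean => //.
  - by rewrite card_sets expn_gt0.
  - move=> J; have [_ _ H3 _] := hW3 J.
    apply: Ele_powD => //; try exact: mulr_ge0.
    exact: HT4 (disj J).
have H12 : Ele P (fun w => (W1 w + T2 w) ^+ r) ((2 * (k1 * Gam + k2 * Gam)) ^+ r).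
  by apply: Ele_powD => //; exact: mulr_ge0.
have H : Ele P (fun w => ((W1 w + T2 w) + 4 * M w) ^+ r)
    ((2 * (2 * (k1 * Gam + k2 * Gam) + 4 * (2 * (k3 * Gam + k4 * Gam)))) ^+ r).
  apply: Ele_powD => //.
  - exact: measurable_funD.
  - exact: measurable_funM.
  - by move=> w; rewrite addr_ge0.
  - by move=> w; rewrite mulr_ge0.
  - exact: mulr_ge0.
  - exact: Ele_powZ.
apply: Ele_pow_le H.
- apply: measurable_bigmaxr => t _; apply: measurableT_comp => //.
  apply: measurable_funB => //; apply: measurable_funX.
  apply: measurable_nrm => i; under eq_fun do rewrite mxE.
  apply: measurable_sum => j; apply: measurable_funM => //.
  by rewrite (_ : (fun _ => _) = X j)//; apply/funext => w; rewrite mxE.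
- move=> w; rewrite bigmaxr_ge0/=.
  apply: bigmaxr_le => [|t]; first by rewrite !addr_ge0// mulr_ge0.
  have pl : pi l t \in s l by apply: pis; rewrite leqnn.
  have -> : nrm (A t *m \col_i X i w) ^+ 2 - \sum_i colsq (A t) i * v i =
      diag_dev P X AO (Some t) w +
      4 * (#|{: setsn}|%:R^-1 * \sum_J bilin X AO J (~: J)%SET (Some t) w).
    have -> : \col_i X i w = msk [set: 'I_n]%SET (xi w).
      by apply/matrixP => i j; rewrite !mxE inE tnth_mktuple.
    rewrite decoupling addrAC; congr (_ + _).
      rewrite (eq_bigl xpredT); last by move=> i; rewrite inE.
      rewrite -sumrB; apply: eq_bigr => i _.
      by rewrite tnth_mktuple mulrBr.
    rewrite card_sets natrX mulrA; congr (_ * _).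
    by apply: eq_bigr => J _; rewrite finset.setTI finset.setTD.
  apply: le_trans (ler_normD _ _) _; apply: lerD.
    rewrite -[X in `|X|](subrK (diag_dev P X AO (Some (pi l t)) w)).
    apply: le_trans (ler_normD _ _) _; apply: lerD; first exact: hW1.
    exact: (le_bigmaxr_seq (fun t => `|diag_dev P X AO (Some t) w|) pl).
  rewrite normrM ger0_norm// ler_wpM2l//.
  rewrite normrM ger0_norm ?invr_ge0// ler_wpM2l ?invr_ge0//.
  apply: le_trans (ler_norm_sum _ _ _) _; apply: ler_sum => J _.
  rewrite -[X in `|X|](subrK (bilin X AO J (~: J)%SET (Some (pi l t)) w)).
  apply: le_trans (ler_normD _ _) _; apply: lerD.
    by have [_ _ _ h] := hW3 J; exact: h.
  exact: (le_bigmaxr_seq (fun t => `|bilin X AO J (~: J)%SET (Some t) w|) pl).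
- apply/andP; split.
    by apply: mulr_ge0 => //; apply: addr_ge0 => //; exact: mulr_ge0.
  rewrite (_ : 2 * _ = core_const * Gam)//.
  by rewrite /core_const -/k1 -/k2 -/k3 -/k4; ring.
Qed.

End core.

(** * Real and complex matrices *)

Section euclidean_more.
Variable R : realType.

Lemma nrmD m (u v : 'cV[R]_m) : nrm (u + v) <= nrm u + nrm v.
Proof.
have n0 : 0 <= nrm u + nrm v by rewrite addr_ge0 ?nrm_ge0.
rewrite -[leRHS](ger0_norm n0) -sqrtr_sqr ler_sqrt ?sqr_ge0//.
rewrite sqrrD !nrm_sqr dotvDl !dotvDr (dotvC v u).
by have := ler_normlW (norm_dotv_le u v); lra.
Qed.

Lemma nrmN m (u : 'cV[R]_m) : nrm (- u) = nrm u.
Proof. by rewrite /nrm dotvNl dotvNr opprK. Qed.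

Lemma nrmZ m (u : 'cV[R]_m) (a : R) : 0 <= a -> nrm (a *: u) = a * nrm u.
Proof.
move=> a0; rewrite /nrm (_ : dotv _ _ = a ^+ 2 * dotv u u).
  by rewrite sqrtrM ?sqr_ge0// sqrtr_sqr ger0_norm.
by rewrite /dotv mulr_sumr; apply: eq_bigr => i _; rewrite !mxE; ring.
Qed.

End euclidean_more.

Section realify.
Variable R : realType.
Local Notation C := R[i].

(** Stacking real and imaginary parts preserves |A x| for real x and leaves the n independent
    coordinates untouched. *)
Definition realify m n (A : 'M[C]_(m, n)) : 'M[R]_(m + m, n) :=
  col_mx (map_mx (@complex.Re R) A) (map_mx (@complex.Im R) A).

Definition cplx n (x : 'cV[R]_n) : 'cV[C]_n := map_mx (real_complex R) x.

Lemma ReD (x y : C) : complex.Re (x + y) = complex.Re x + complex.Re y.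
Proof. by case: x; case: y. Qed.

Lemma ImD (x y : C) : complex.Im (x + y) = complex.Im x + complex.Im y.
Proof. by case: x; case: y. Qed.

Lemma Re_sum I (s : seq I) (Q : pred I) (F : I -> C) :
  complex.Re (\sum_(i <- s | Q i) F i) = \sum_(i <- s | Q i) complex.Re (F i).
Proof. by elim/big_rec2 : _ => // i x y _ <-; rewrite ReD. Qed.

Lemma Im_sum I (s : seq I) (Q : pred I) (F : I -> C) :
  complex.Im (\sum_(i <- s | Q i) F i) = \sum_(i <- s | Q i) complex.Im (F i).
Proof. by elim/big_rec2 : _ => // i x y _ <-; rewrite ImD. Qed.

Lemma normc_sqr (z : C) :
  Normc.normc z ^+ 2 = complex.Re z ^+ 2 + complex.Im z ^+ 2.
Proof. by case: z => a b /=; rewrite sqr_sqrtr// addr_ge0 ?sqr_ge0. Qed.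

Lemma norm2_realify m (u : 'cV[C]_m) : norm2 u = nrm (realify u).
Proof.
rewrite /norm2 /nrm; congr Num.sqrt; rewrite dotvE big_split_ord/= -big_split/=.
by apply: eq_bigr => i _; rewrite col_mxEu col_mxEd !mxE normc_sqr.
Qed.

Lemma realifyD m n (A B : 'M[C]_(m, n)) : realify (A + B) = realify A + realify B.
Proof.
rewrite /realify add_col_mx; congr col_mx; apply/matrixP => i j; rewrite !mxE.
  exact: ReD.
exact: ImD.
Qed.

Lemma realifyN m n (A : 'M[C]_(m, n)) : realify (- A) = - realify A.
Proof.
by rewrite /realify opp_col_mx; congr col_mx; apply/matrixP => i j; rewrite !mxE;
  case: (A i j).
Qed.

Lemma realifyB m n (A B : 'M[C]_(m, n)) : realify (A - B) = realify A - realify B.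
Proof. by rewrite realifyD realifyN. Qed.

Lemma realify_mul m n (A : 'M[C]_(m, n)) (x : 'cV[R]_n) :
  realify (A *m cplx x) = realify A *m x.
Proof.
rewrite /realify mul_col_mx; congr col_mx; apply/matrixP => i j; rewrite !mxE.
  rewrite Re_sum; apply: eq_bigr => k _; rewrite !mxE ord1.
  by case: (A i k) => a b /=; rewrite mulr0 subr0.
rewrite Im_sum; apply: eq_bigr => k _; rewrite !mxE ord1.
by case: (A i k) => a b /=; rewrite mulr0 add0r.
Qed.

Lemma norm2_mul_cplx m n (A : 'M[C]_(m, n)) (x : 'cV[R]_n) :
  norm2 (A *m cplx x) = nrm (realify A *m x).
Proof. by rewrite norm2_realify realify_mul. Qed.

Lemma norm2_cplx n (x : 'cV[R]_n) : norm2 (cplx x) = nrm x.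
Proof.
rewrite /norm2 /nrm dotvE; congr Num.sqrt; apply: eq_bigr => i _.
by rewrite normc_sqr !mxE /= expr0n/= addr0.
Qed.

Lemma norm2_ge0 n (x : 'cV[C]_n) : 0 <= norm2 x.
Proof. exact: sqrtr_ge0. Qed.

Lemma norm2D n (x y : 'cV[C]_n) : norm2 (x + y) <= norm2 x + norm2 y.
Proof. by rewrite !norm2_realify realifyD nrmD. Qed.

Lemma norm2N n (x : 'cV[C]_n) : norm2 (- x) = norm2 x.
Proof. by rewrite !norm2_realify realifyN nrmN. Qed.

Lemma norm20 n : norm2 (0 : 'cV[C]_n) = 0.
Proof.
rewrite norm2_realify (_ : realify 0 = 0) ?nrm0//.
have := realifyB (0 : 'cV[C]_n) 0.
by rewrite !subrr.
Qed.

Lemma normc_le_norm2 n (x : 'cV[C]_n) i : Normc.normc (x i 0) <= norm2 x.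
Proof.
have c0 : 0 <= Normc.normc (x i 0) by case: (x i 0) => a b; exact: sqrtr_ge0.
rewrite -[leLHS](ger0_norm c0) -sqrtr_sqr ler_sqrt; last first.
  by apply: sumr_ge0 => j _; exact: sqr_ge0.
rewrite (bigD1 i)//= lerDl.
by apply: sumr_ge0 => j _; exact: sqr_ge0.
Qed.

Lemma normc_sum n (F : 'I_n -> C) :
  Normc.normc (\sum_i F i) <= \sum_i Normc.normc (F i).
Proof.
elim/big_rec2 : _ => [|i x y _ h]; first by rewrite /= expr0n/= addr0 sqrtr0.
by apply: le_trans (le_normcD _ _) _; rewrite lerD2l.
Qed.

Let opset m n (A : 'M[C]_(m, n)) :=
  [set norm2 (A *m x) | x in [set x : 'cV[C]_n | norm2 x <= 1]].

(** A real [sup] is meaningful only for nonempty sets bounded above; on the unit ball every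
    coordinate has modulus at most 1, so absolute row sums give a bound. *)
Lemma opnorm_has_sup m n (A : 'M[C]_(m, n)) : has_sup (opset A).
Proof.
split; first by exists (norm2 (A *m 0)); exists 0 => //=; rewrite norm20.
exists (Num.sqrt (\sum_k (\sum_j Normc.normc (A k j)) ^+ 2)) => _ [x /= x1 <-].
have nn (z : C) : 0 <= Normc.normc z by case: z => a b; exact: sqrtr_ge0.
rewrite ler_sqrt; last by apply: sumr_ge0 => k _; exact: sqr_ge0.
apply: ler_sum => k _; apply: lerXn2r; rewrite ?nnegrE ?sumr_ge0//.
rewrite mxE; apply: le_trans (normc_sum _) _; apply: ler_sum => j _.
by rewrite Normc.normcM ler_piMr// (le_trans (normc_le_norm2 _ _)).
Qed.

Lemma opnorm_ge m n (A : 'M[C]_(m, n)) x : norm2 x <= 1 ->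
  norm2 (A *m x) <= opnorm A.
Proof.
move=> x1; apply: sup_upper_bound; first exact: opnorm_has_sup.
by exists x.
Qed.

Lemma opnorm_ge0 m n (A : 'M[C]_(m, n)) : 0 <= opnorm A.
Proof. by apply: le_trans (norm2_ge0 _) (@opnorm_ge _ _ A 0 _); rewrite norm20. Qed.

Lemma opnormD m n (A B : 'M[C]_(m, n)) : opnorm (A + B) <= opnorm A + opnorm B.
Proof.
apply: sup_le_ub; first by case: (opnorm_has_sup (A + B)).
move=> _ [x /= x1 <-]; rewrite mulmxDl; apply: le_trans (norm2D _ _) _.
by apply: lerD; exact: opnorm_ge.
Qed.

Lemma opnormN m n (A : 'M[C]_(m, n)) : opnorm (- A) = opnorm A.
Proof.
rewrite /opnorm; congr sup; apply/seteqP.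
by split => _ [x /= x1 <-]; exists x => //; rewrite mulNmx norm2N.
Qed.

Lemma nrm_realify_le m n (A : 'M[C]_(m, n)) (x : 'cV[R]_n) :
  nrm (realify A *m x) <= opnorm A * nrm x.
Proof.
have [x0|x0] := eqVneq (nrm x) 0.
  by rewrite (nrm_eq0 x0) mulmx0 !nrm0 mulr0.
have xp : 0 < nrm x by rewrite lt_def x0 nrm_ge0.
rewrite -ler_pdivrMr// mulrC -nrmZ ?invr_ge0 ?nrm_ge0// scalemxAr -norm2_mul_cplx.
by apply: opnorm_ge; rewrite norm2_cplx nrmZ ?invr_ge0 ?nrm_ge0// mulVf.
Qed.

Lemma d_infty_ge0 m n (A B : 'M[C]_(m, n)) : 0 <= d_infty A B.
Proof. exact: opnorm_ge0. Qed.

Lemma d_infty_sym m n (A B : 'M[C]_(m, n)) : d_infty A B = d_infty B A.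
Proof. by rewrite /d_infty -opnormN opprB. Qed.

Lemma d_infty_triangle m n (A B D : 'M[C]_(m, n)) :
  d_infty A B <= d_infty A D + d_infty D B.
Proof.
by rewrite /d_infty; apply: le_trans (opnormD _ _); rewrite addrA subrK.
Qed.

End realify.

(** * Schatten norms of order 2 and 4 as Frobenius norms *)

Section schatten_norms.
Local Open Scope sesquilinear_scope.
Variable R : realType.
Local Notation C := R[i].

Let conj_mul (z : C) : z * Num.conj z = (Normc.normc z ^+ 2)%:C.
Proof.
by rewrite -normCK (_ : `|z| = (Normc.normc z)%:C) ?rmorphXn.
Qed.

Lemma mulmx_conj_diag m n (B : 'M[C]_(m, n)) i :
  (B *m B ^t*) i i = (\sum_k Normc.normc (B i k) ^+ 2)%:C.
Proof.
rewrite mxE rmorph_sum; apply: eq_bigr => k _.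
by rewrite !mxE conj_mul.
Qed.

Variables (m n : nat) (A : 'M[C]_(m, n)).
Let M : 'M[C]_n := A ^t* *m A.

Let MH : M ^t* = M.
Proof. by rewrite /M trmx_mul map_mxM trmxCK. Qed.

Let M_normal : M \is normalmx.
Proof. by apply/normalmxP; rewrite MH. Qed.

Let U := spectralmx M.
Let D := spectral_diag M.

Let ME : M = invmx U *m diag_mx D *m U.
Proof. exact/orthomx_spectralP. Qed.

Let Uunit : U \in unitmx. Proof. exact: spectral_unit. Qed.

(** The i-th eigenvalue is the squared norm of the i-th row of U times the adjoint of A. The sign
    matters because real powers have their usual meaning only on nonnegative bases. *)
Let D_ge0 i : 0 <= D 0 i.
Proof.
have -> : D 0 i = ((U *m A ^t*) *m (U *m A ^t*) ^t*) i i.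
  rewrite trmx_mul map_mxM trmxCK -!mulmxA [A ^t* *m _]mulmxA -/M.
  rewrite -(invmx_unitary (spectral_unitarymx M)) -/U ME.
  by rewrite !mulmxA mulmxV// mul1mx mulmxK// mxE eqxx mulr1n.
rewrite mulmx_conj_diag ler0c.
by apply: sumr_ge0 => k _; exact: sqr_ge0.
Qed.

Let DE i : D 0 i = (complex.Re (D 0 i))%:C.
Proof. by have := ger0_Im (D_ge0 i); case: (D 0 i) => a b /= ->. Qed.

Let Re_D_ge0 i : 0 <= complex.Re (D 0 i).
Proof. by have := D_ge0 i; rewrite DE ler0c. Qed.

Let mulmx_conj_invmx k (V B : 'M[C]_k) : V \in unitmx ->
  (invmx V *m B *m V) *m (invmx V *m B *m V) = invmx V *m (B *m B) *m V.
Proof. by move=> Vu; rewrite !mulmxA mulmxK. Qed.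

Let psdmx_powR1 : psdmx_powR M 1 = M.
Proof.
transitivity (invmx U *m diag_mx D *m U); last by rewrite -ME.
rewrite /psdmx_powR -/U -/D (_ : map_mx _ D = D); first by [].
by apply/matrixP => i j; rewrite ord1 !mxE powRr1 -?DE.
Qed.

Let psdmx_powR2 : psdmx_powR M 2 = M *m M.
Proof.
transitivity ((invmx U *m diag_mx D *m U) *m (invmx U *m diag_mx D *m U)); last first.
  by rewrite -ME.
rewrite (mulmx_conj_invmx _ Uunit) /psdmx_powR -/U -/D.
rewrite (_ : diag_mx (map_mx _ D) = diag_mx D *m diag_mx D).
  by apply: f_equal2; first apply: f_equal2.
apply/matrixP => i j; rewrite mul_diag_mx !mxE.
rewrite (powR_mulrn 2)//; have [->|ij] := eqVneq i j; last by rewrite mulr0.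
by rewrite !mulr1n [in RHS]DE -rmorphM/= expr2.
Qed.

Lemma frob2_realify : frob2 (realify A) = schatten 2 A ^+ 2.
Proof.
rewrite /schatten divff// -/M psdmx_powR1.
have trE : complex.Re (\tr M) = frob2 (realify A).
  rewrite /mxtrace Re_sum /frob2 big_split_ord/= -big_split/=.
  under [RHS]eq_bigr do rewrite -big_split/=.
  rewrite exchange_big/=; apply: eq_bigr => i _.
  have -> : M i i = (\sum_k Normc.normc (A k i) ^+ 2)%:C.
    rewrite mxE rmorph_sum; apply: eq_bigr => k _.
    by rewrite !mxE mulrC conj_mul.
  rewrite /=; apply: eq_bigr => k _.
  by rewrite col_mxEu col_mxEd !mxE normc_sqr.
rewrite trE -powR_mulrn ?powR_ge0// -powRrM mulVf// powRr1//.
by apply: sumr_ge0 => i _; apply: sumr_ge0 => j _; exact: sqr_ge0.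
Qed.

(** The real Gram matrix is the real part of M, the adjoint of A times A, while the S^4 norm to the
    fourth power is Tr M^2, the sum of all |M_ij|^2. Dropping imaginary parts leaves an
    inequality. *)
Lemma frob2_gram_realify :
  frob2 ((realify A)^T *m realify A) <= (schatten 4 A ^+ 2) ^+ 2.
Proof.
have gramE : (realify A)^T *m realify A = map_mx (@complex.Re R) M.
  rewrite /realify tr_col_mx mul_row_col.
  apply/matrixP => i j; rewrite !mxE -big_split/= Re_sum.
  apply: eq_bigr => k _; rewrite !mxE.
  by case: (A k i) => a b; case: (A k j) => c e /=; rewrite mulNr opprK.
rewrite /schatten (_ : 4 / 2 = 2); last by lra.
rewrite -/M psdmx_powR2.
have trE : complex.Re (\tr (M *m M)) = \sum_i \sum_j Normc.normc (M i j) ^+ 2.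
  rewrite /mxtrace Re_sum; apply: eq_bigr => i _.
  by rewrite -{2}MH mulmx_conj_diag.
rewrite trE -exprM -powR_mulrn ?powR_ge0// -powRrM mulVf// powRr1; last first.
  by apply: sumr_ge0 => i _; apply: sumr_ge0 => j _; exact: sqr_ge0.
rewrite gramE; apply: ler_sum => i _; apply: ler_sum => j _.
by rewrite normc_sqr mxE lerDl sqr_ge0.
Qed.

End schatten_norms.

Lemma schatten_ge0 (R : realType) m n (q : R) (A : 'M[R[i]]_(m, n)) :
  0 <= schatten q A.
Proof. exact: powR_ge0. Qed.

Lemma sup_finite_ge (R : realType) (T : choiceType) (S : set T) (f : T -> R) x :
  finite_set S -> S x -> f x <= sup [set f y | y in S].
Proof.
move=> /finite_seqP[s ->] xs; apply: sup_upper_bound; last by exists x.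
split; first by exists (f x); exists x.
exists (\big[Num.max/0]_(y <- s) `|f y|) => _ [y ys <-].
apply: le_trans (le_bigmaxr_seq (fun y => `|f y|) ys).
exact: ler_norm.
Qed.

(** * Normalization *)

Section quadratic_expectation.
Context d (T : measurableType d) (R : realType) (P : probability T R) (n : nat).
Variable X : 'I_n -> T -> R.
Hypothesis hX : subgaussian_family P X.

Local Notation v i := (second_moment P (X i)).

Let mX i : measurable_fun setT (X i). Proof. by case: hX. Qed.

Let affine_sqr i (c y : R) :
  (\int[P]_w ((c * X i w + y) ^+ 2)%:E = (c ^+ 2 * v i + y ^+ 2)%:E)%E.
Proof.
have [_ _ sX iX X0] := hX.
have i2 : P.-integrable setT (EFin \o (fun w => X i w ^+ 2)).
  apply/integrableP; split; first exact/measurable_EFinP/measurable_funX.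
  under eq_integral do rewrite /= ger0_norm ?sqr_ge0//.
  by rewrite second_momentE// ltry.
have iZ (k : R) (f : T -> R) : P.-integrable setT (EFin \o f) ->
    P.-integrable setT (EFin \o (fun w => k * f w)).
  move=> h; rewrite (_ : _ \o _ = fun w => (k%:E * (f w)%:E)%E)//.
  exact: integrableZl.
have ZE (k : R) (f : T -> R) : P.-integrable setT (EFin \o f) ->
    (\int[P]_w (k * f w)%:E = k%:E * \int[P]_w (f w)%:E)%E.
  by move=> h; under eq_integral do rewrite EFinM; rewrite integralZl.
have DE (f g : T -> R) : P.-integrable setT (EFin \o f) ->
    P.-integrable setT (EFin \o g) ->
    (\int[P]_w (f w + g w)%:E = \int[P]_w (f w)%:E + \int[P]_w (g w)%:E)%E.
  by move=> hf hg; exact: (integralD_EFin measurableT hf hg).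
have iD (f g : T -> R) : P.-integrable setT (EFin \o f) ->
    P.-integrable setT (EFin \o g) ->
    P.-integrable setT (EFin \o (fun w => f w + g w)).
  move=> hf hg; rewrite (_ : _ \o _ = fun w => ((f w)%:E + (g w)%:E)%E)//.
  exact: integrableD.
have i0 : P.-integrable setT (EFin \o (fun=> y ^+ 2 : R)).
  exact: finite_measure_integrable_cst.
have E w : (c * X i w + y) ^+ 2 = c ^+ 2 * X i w ^+ 2 + ((2 * c * y) * X i w + y ^+ 2).
  by ring.
under eq_integral do rewrite E.
rewrite DE; [|exact: iZ|by apply: iD => //; exact: iZ].
rewrite DE//; last exact: iZ.
rewrite (ZE (c ^+ 2) (fun w => X i w ^+ 2) i2) (ZE (2 * c * y) (X i))//.
rewrite second_momentE// X0 mule0 add0e integral_cst//.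
rewrite [X in (_ + _ * X)%E](_ : _ = 1%E); last exact: probability_setT.
by rewrite mule1.
Qed.

Let msum (I : {set 'I_n}) (c : 'I_n -> R) :
  measurable_fun setT (fun w => \sum_(i in I) c i * X i w).
Proof. by apply: measurable_sum_set => i; exact: measurable_funM. Qed.

(** Resampling one coordinate replaces the product of two variables by an affine function of that
    coordinate, whose linear term has mean zero; the induction thus sees only nonnegative
    integrands. *)
Lemma second_moment_linear (I : {set 'I_n}) (c : 'I_n -> R) :
  (\int[P]_w ((\sum_(i in I) c i * X i w) ^+ 2)%:E =
   (\sum_(i in I) c i ^+ 2 * v i)%:E)%E.
Proof.
have [_ indX _ _ _] := hX.
move: {2}#|I| (erefl #|I|) => k; elim: k I => [|k ih] I.
  move=> /cards0_eq ->; rewrite big_set0.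
  under eq_integral do rewrite big_set0 expr0n/=.
  by rewrite integral0.
move=> cI; have /card_gt0P[i0 i0I] : (0 < #|I|)%N by rewrite cI.
have {}ih := ih (I :\ i0)%SET.
have /ih {}ih : #|(I :\ i0)%SET| = k.
  by have := cardsD1 i0 I; rewrite i0I cI add1n => -[].
pose f (t : n.-tuple R) := (\sum_(i in I) c i * tnth t i) ^+ 2.
have mf : measurable_fun setT f.
  apply: measurable_funX.
  rewrite (_ : (fun _ => _) =
    fun t : n.-tuple R => \sum_(i <- enum I) c i * tnth t i).
    apply: measurable_sum => i; apply: measurable_funM => //.
    exact: measurable_tnth.
  by apply/funext => t; rewrite big_enum.
transitivity (\int[P]_w (EFin \o f) [tuple X i w | i < n])%E.
  apply: eq_integral => w _; rewrite /= /f; congr ((_ ^+ 2)%:E).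
  by apply: eq_bigr => i _; rewrite tnth_mktuple.
rewrite (integral_indep_copy mX indX [set i0]%SET); last 2 first.
- exact/measurable_EFinP.
- by move=> t; rewrite lee_fin sqr_ge0.
have E w2 : (\int[P]_w1 (EFin \o f)
      [tuple if i \in [set i0]%SET then X i w1 else X i w2 | i < n] =
    (c i0 ^+ 2 * v i0)%:E + ((\sum_(i in I :\ i0) c i * X i w2) ^+ 2)%:E)%E.
  rewrite -EFinD -affine_sqr; apply: eq_integral => w1 _.
  rewrite /= /f (big_setD1 i0 i0I)/= tnth_mktuple inE eqxx.
  congr ((_ + _) ^+ 2)%:E.
  rewrite (eq_bigr (fun i => c i * X i w2))// => i.
  by rewrite in_setD1 tnth_mktuple inE => /andP[/negbTE ->].
have v0 : 0 <= c i0 ^+ 2 * v i0 by rewrite mulr_ge0 ?sqr_ge0// second_moment_ge0//; case: hX.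
under eq_integral do rewrite E.
rewrite ge0_integralD//; last 2 first.
- by move=> w _; rewrite lee_fin sqr_ge0.
- by apply/measurable_EFinP; exact: measurable_funX.
rewrite ih integral_cst//.
rewrite [X in (_ * X + _)%E](_ : _ = 1%E); last exact: probability_setT.
by rewrite mule1 -EFinD (big_setD1 i0 i0I).
Qed.

(** The expectation is that of the diagonal part alone, so the off-diagonal forms are already
    centred. *)
Lemma quadratic_expectation m (B : 'M[R]_(m, n)) :
  (\int[P]_w (nrm (B *m \col_i X i w) ^+ 2)%:E =
   (\sum_i colsq B i * v i)%:E)%E.
Proof.
have E w : nrm (B *m \col_i X i w) ^+ 2 =
    \sum_k (\sum_(i in [set: 'I_n]%SET) B k i * X i w) ^+ 2.
  rewrite nrm_sqr dotvE; apply: eq_bigr => k _; rewrite mxE; congr (_ ^+ 2).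
  by apply: eq_big => i; rewrite ?inE// mxE.
under eq_integral do rewrite E -sumEFin.
rewrite ge0_integral_sum//; last 2 first.
- by move=> k; apply/measurable_EFinP; exact: measurable_funX.
- by move=> k w _; rewrite lee_fin sqr_ge0.
under eq_bigr do rewrite second_moment_linear.
rewrite sumEFin; congr EFin.
under [RHS]eq_bigr do rewrite mulr_suml.
by rewrite exchange_big/=; apply: eq_bigl => i; rewrite inE.
Qed.

End quadratic_expectation.

Section normalization.
Context d (T : measurableType d) (R : realType) (P : probability T R) (n : nat).
Variable xi : 'I_n -> {RV P >-> R}.
Hypothesis indxi : independent_RVs xi.
Hypothesis xi0 : forall i, ('E_P[xi i] = 0)%E.
Variable a : R.
Hypothesis a0 : 0 < a.
Hypothesis xia : forall i, (psi2_norm P (xi i) < a%:E)%E.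

Definition scaled i w : R := xi i w / a.

Let mscaled i : measurable_fun setT (scaled i).
Proof. by apply: measurable_funM => //; exact: measurable_cst. Qed.

(** The infimum may not be attained, but the strict bound by [a] yields an admissible b below [a],
    and the exponential moment decreases in the scale. *)
Lemma scaled_exp_moment i : Ele P (fun w => expR (scaled i w ^+ 2)) 2.
Proof.
have mE (b : R) : measurable_fun setT (fun w => expR (`|xi i w| ^+ 2 / b ^+ 2)).
  apply: (@measurableT_comp _ _ _ _ _ _ (@expR R)); first exact: measurable_expR.
  apply: measurable_funM => //; apply: measurable_funX.
  exact: measurableT_comp.
have [_ [b [b0 hb] <-] ba] := ereal_inf_lt (xia i).
rewrite lte_fin in ba.
have H : Ele P (fun w => expR (`|xi i w| ^+ 2 / b ^+ 2)) 2.
  split => //; move: hb; rewrite unlock.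
  case: (integral _ _ _) => [r| |]; rewrite ?leNye//.
  by rewrite -EFinB !lee_fin; lra.
apply: Ele_le H => //.
- apply: (@measurableT_comp _ _ _ _ _ _ (@expR R)); first exact: measurable_expR.
  exact: measurable_funX.
- move=> w; rewrite ler_expR real_normK ?num_real// /scaled exprMn exprVn.
  rewrite ler_wpM2l ?sqr_ge0// lef_pV2 ?posrE ?exprn_gt0//.
  by apply: lerXn2r; rewrite ?nnegrE ?ltW.
Qed.

Lemma scaled_family : subgaussian_family P scaled.
Proof.
have iX i : P.-integrable setT (EFin \o scaled i).
  apply/integrableP; split; first exact/measurable_EFinP.
  have [mE E0 E2] := scaled_exp_moment i.
  apply: (@le_lt_trans _ _ 2%:E); last exact: ltry.
  apply: le_trans E2; apply: ge0_le_integral => //.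
  - by apply: measurableT_comp => //; exact/measurable_EFinP.
  - exact/measurable_EFinP.
  - move=> w _; rewrite /= lee_fin; apply: le_trans (expR_ge1Dx _).
    have := sqr_ge0 (`|scaled i w| - 1).
    rewrite -(real_normK (num_real (scaled i w))).
    by have := sqr_ge0 `|scaled i w|; set y := `|_|; rewrite !expr2; lra.
split => //.
- move=> J B mB.
  have mB' i : measurable ((fun y : R => y / a) @^-1` B i).
    rewrite -[X in measurable X]setTI.
    by apply: measurable_funM => //; exact: measurable_cst.
  exact: (indxi J mB').
- exact: scaled_exp_moment.
- move=> i; have := xi0 i; rewrite unlock => h.
  rewrite /scaled; under eq_integral do rewrite mulrC EFinM.
  rewrite integralZl//; first by rewrite h mule0.
  have ai : P.-integrable setT (fun w => a%:E * (scaled i w)%:E)%E.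
    by apply: (integrableZl measurableT a); exact: iX.
  rewrite (_ : (fun w => a%:E * (scaled i w)%:E)%E = fun w => (xi i w)%:E) in ai => //.
  by apply/funext => w; rewrite -EFinM /scaled mulrCA divff ?gt_eqF// mulr1.
Qed.

Lemma norm2_rvec m (A : 'M[R[i]]_(m, n)) w :
  norm2 (A *m rvec xi w) ^+ 2 =
  a ^+ 2 * nrm (realify A *m \col_i scaled i w) ^+ 2.
Proof.
have -> : rvec xi w = cplx (a *: \col_i scaled i w).
  apply/matrixP => i j; rewrite !mxE /scaled mulrC divfK// gt_eqF//.
by rewrite norm2_mul_cplx -scalemxAr nrmZ ?ltW// exprMn.
Qed.

Lemma expectation_norm2 m (A : 'M[R[i]]_(m, n)) :
  fine 'E_P[(fun w => norm2 (A *m rvec xi w) ^+ 2)] =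
  a ^+ 2 * \sum_i colsq (realify A) i * second_moment P (scaled i).
Proof.
rewrite unlock; under eq_integral do rewrite norm2_rvec EFinM.
rewrite ge0_integralZl_EFin ?sqr_ge0//.
- by rewrite (quadratic_expectation scaled_family).
- by move=> w _; rewrite lee_fin sqr_ge0.
- apply/measurable_EFinP/measurable_funX/measurable_nrm => i.
  under eq_fun do rewrite mxE.
  apply: measurable_sum => j; apply: measurable_funM => //.
  by rewrite (_ : (fun _ => _) = scaled j)//; apply/funext => w; rewrite mxE.
Qed.

Variables (m : nat) (s : seq 'M[R[i]]_(m, n)).
Hypothesis s0 : [set` s] !=set0.

Definition family_mx (t : seq_sub s) : 'M[R]_(m + m, n) := realify (ssval t).

Lemma sup_deviationE w :
  sup_deviation [set` s] xi w = a ^+ 2 * deviation_sup P scaled family_mx w.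
Proof.
have E (A : 'M[R[i]]_(m, n)) : `| norm2 (A *m rvec xi w) ^+ 2
             - fine 'E_P[(fun w' => norm2 (A *m rvec xi w') ^+ 2)] | =
    a ^+ 2 * `|nrm (realify A *m \col_i scaled i w) ^+ 2 -
      \sum_i colsq (realify A) i * second_moment P (scaled i)|.
  by rewrite norm2_rvec expectation_norm2 -mulrBr normrM [`|a ^+ 2|](ger0_norm (sqr_ge0 a)).
have a2 : 0 <= a ^+ 2 by exact: sqr_ge0.
apply/eqP; rewrite eq_le; apply/andP; split.
  apply: sup_le_ub; first by case: s0 => A As; exists (`| norm2 (A *m rvec xi w) ^+ 2
             - fine 'E_P[(fun w' => norm2 (A *m rvec xi w') ^+ 2)] |), A.
  move=> _ [A As <-]; rewrite E ler_wpM2l//.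
  exact: (le_bigmaxr_seq (fun t : seq_sub s =>
    `|nrm (family_mx t *m \col_i scaled i w) ^+ 2 -
      \sum_i colsq (family_mx t) i * second_moment P (scaled i)|)
    (mem_index_enum (SeqSub As))).
rewrite mulrC -ler_pdivlMr ?exprn_gt0//.
have f0 (A : 'M[R[i]]_(m, n)) : A \in s ->
    a ^+ 2 * `|nrm (realify A *m \col_i scaled i w) ^+ 2 -
      \sum_i colsq (realify A) i * second_moment P (scaled i)| <=
    sup_deviation [set` s] xi w.
  move=> As; rewrite -E.
  apply: (@sup_finite_ge _ _ _ (fun A => `| norm2 (A *m rvec xi w) ^+ 2
     - fine 'E_P[(fun w' => norm2 (A *m rvec xi w') ^+ 2)] |) A) => //.
  exact: finite_seq.
apply: bigmaxr_le => [|t].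
  case: s0 => A As; rewrite divr_ge0//; apply: le_trans (f0 A As).
  by rewrite mulr_ge0.
rewrite ler_pdivlMr ?exprn_gt0// mulrC; apply: f0; exact: ssvalP.
Qed.

End normalization.

(** * From moments to tails *)

Lemma powR_mono (R : realType) (p x y : R) :
  0 <= p -> 0 <= x -> x <= y -> x `^ p <= y `^ p.
Proof.
by move=> p0 x0 xy; apply: ge0_ler_powR => //; rewrite nnegrE// (le_trans x0).
Qed.

Section real_moments.
Context d (T : measurableType d) (R : realType) (P : probability T R).
Variable S : T -> R.
Hypothesis S0 : forall w, 0 <= S w.
Hypothesis mS : measurable_fun setT S.

Let mSp p : measurable_fun setT (fun w => S w `^ p).
Proof. exact: (@measurableT_comp _ _ _ _ _ _ (fun y : R => y `^ p)). Qed.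

(** Pointwise, S^p <= b^p (1 + (S/b)^r), by cases S <= b and S > b, so the expectation is at most 2
    b^p and 2^(1/p) <= 2. Taking b slightly above B keeps it positive. *)
Lemma moment_powR_le (r : nat) (p B : R) : 0 <= B -> 1 <= p -> p <= r%:R ->
  Ele P (fun w => S w ^+ r) (B ^+ r) ->
  ('E_P[(fun w => (S w `^ p)%R)] `^ (p^-1)%R <= (2 * B)%R%:E)%E.
Proof.
move=> B0 p1 pr Sr; have p0 : 0 < p by exact: lt_le_trans p1.
apply/lee_addgt0Pr => e e0; rewrite -EFinD.
pose b := B + e / 2; have b0 : 0 < b by rewrite ltr_wpDl// divr_gt0.
have bp : 0 < b `^ p by rewrite powR_gt0.
have H : Ele P (fun w => S w `^ p) (b `^ p * (1 + b ^- r * B ^+ r)).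
  have i0 : 0 <= b ^- r by rewrite invr_ge0 exprn_ge0// ltW.
  apply: (Ele_le _ _ _ (lexx _)
    (EleZ (ltW bp) (EleD (Ele_cst P (@ler01 R)) (EleZ i0 Sr)))).
  - exact: mSp.
  - by move=> w; exact: powR_ge0.
  - move=> w; have [Sb|bS] := leP (S w) b.
      apply: (@le_trans _ _ (b `^ p)).
        by apply: powR_mono => //; exact: ltW.
      by rewrite ler_peMr ?(ltW bp)// lerDl mulr_ge0// exprn_ge0.
    have Sb1 : 1 <= S w / b by rewrite ler_pdivlMr// mul1r ltW.
    rewrite -{1}(divfK (lt0r_neq0 b0) (S w)) mulrC powRM ?(ltW b0)//; last first.
      by rewrite (le_trans ler01).
    rewrite ler_wpM2l ?(ltW bp)//.
    apply: (@le_trans _ _ ((S w / b) `^ r%:R)); first exact: ler_powR.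
    rewrite powR_mulrn; last by rewrite (le_trans ler01).
    by rewrite expr_div_n mulrC lerDr.
have {H}[_ _ H] := H.
have Bb : b ^- r * B ^+ r <= 1.
  rewrite mulrC ler_pdivrMr ?exprn_gt0// mul1r.
  apply: lerXn2r; rewrite ?nnegrE ?(ltW b0)//.
  by rewrite /b lerDl divr_ge0// ltW.
have E2 : ('E_P[(fun w => (S w `^ p)%R)] <= (2 * b `^ p)%R%:E)%E.
  rewrite unlock; apply: le_trans H _; rewrite lee_fin mulrC ler_wpM2r ?(ltW bp)//.
  by move: Bb; lra.
have E0 : (0 <= 'E_P[(fun w => (S w `^ p)%R)])%E.
  by apply: expectation_ge0 => w; exact: powR_ge0.
move: E0 E2; case: ('E_P[_])%E => [x| |]//; rewrite !lee_fin => x0 xb.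
apply: (@le_trans _ _ ((2 * b `^ p) `^ p^-1)).
  by apply: powR_mono => //; rewrite invr_ge0 ltW.
rewrite powRM ?(ltW bp)// -powRrM mulfV ?gt_eqF// powRr1 ?(ltW b0)//.
apply: (@le_trans _ _ (2 * b)); last by rewrite /b mulrDr mulrC [2 * (e / 2)]mulrC divfK// mulrC.
rewrite ler_wpM2r ?(ltW b0)//.
apply: (@le_trans _ _ (2 `^ 1)); last by rewrite powRr1.
apply: ler_powR => //; first by rewrite ler1n.
by rewrite invf_le1.
Qed.

(** Markov's inequality for the p-th power at the threshold e B: the quotient of the p-th powers is
    exactly e^(-p). *)
Lemma tail_of_moment (p B : R) : 0 <= B -> 1 <= p ->
  ('E_P[(fun w => (S w `^ p)%R)] `^ (p^-1)%R <= B%:E)%E ->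
  (P [set w | (expR 1 * B < S w)%R] <= (expR (- p))%:E)%E.
Proof.
move=> B0 p1 EB; have p0 : 0 < p by exact: lt_le_trans p1.
have Em : (\int[P]_w (S w `^ p)%R%:E <= (B `^ p)%R%:E)%E.
  have E0 : (0 <= 'E_P[(fun w => (S w `^ p)%R)])%E.
    by apply: expectation_ge0 => w; exact: powR_ge0.
  move: E0 EB; rewrite unlock; case: (integral _ _ _) => [x| |]//.
    rewrite !lee_fin => x0 xB.
    rewrite -[leLHS](powRr1 x0) -(mulVf (lt0r_neq0 p0)) powRrM.
    by apply: powR_mono => //; [exact: ltW|exact: powR_ge0].
  by rewrite poweRyr// gt_eqF// invr_gt0.
have mA c : measurable [set w | c < S w].
  rewrite [X in measurable X](_ : _ = [set: T] `&` S @^-1` `]c, +oo[%classic).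
    exact: mS.
  by rewrite setTI; apply/seteqP; split => w /=; rewrite in_itv/= andbT.
(* For B = 0 there is nothing to divide by; then S vanishes almost everywhere. *)
move: B0; rewrite le_eqVlt => /predU1P[B0|B0].
  rewrite -B0 powR0 ?gt_eqF// in Em; rewrite -B0 mulr0.
  have I0 : (\int[P]_w `|(S w `^ p)%R%:E| = 0)%E.
    apply/eqP; rewrite eq_le integral_ge0// andbT.
    under eq_integral do rewrite /= ger0_norm ?powR_ge0//.
    exact: Em.
  have /(ae_eq_integral_abs P measurableT) : measurable_fun setT (fun w => (S w `^ p)%R%:E).
    exact/measurable_EFinP.
  case=> /(_ I0) [N [mN N0 hN]] _.
  apply: (@le_trans _ _ 0%E); last by rewrite lee_fin expR_ge0.
  rewrite -N0; apply: le_measure; rewrite ?inE//.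
  move=> w /= Sw; apply: hN => /= /(_ Logic.I) [] /eqP.
  by rewrite powR_eq0 gt_eqF.
have c0 : 0 < expR 1 * B by rewrite mulr_gt0// expR_gt0.
have cp : 0 < (expR 1 * B) `^ p by rewrite powR_gt0.
have M : (((expR 1 * B) `^ p)%R%:E * P [set w | (expR 1 * B < S w)%R] <= (B `^ p)%R%:E)%E.
  apply: le_trans Em.
  rewrite -integral_cst//.
  apply: (@le_trans _ _ (\int[P]_(w in [set w | (expR 1 * B < S w)%R]) (S w `^ p)%R%:E)%E).
    apply: ge0_le_integral => //.
    + by move=> w _; rewrite lee_fin ltW.
    + by apply: measurable_funTS; exact/measurable_EFinP.
    + by move=> w /= /ltW Sw; rewrite lee_fin; apply: powR_mono => //; exact: ltW.
  apply: ge0_subset_integral => //; first exact/measurable_EFinP.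
  by move=> w _; rewrite lee_fin powR_ge0.
move: M; rewrite muleC -lee_pdivlMr// => /le_trans; apply.
rewrite lee_fin powRM ?expR_ge0 ?(ltW B0)// -expRM mul1r.
by rewrite invfM mulrCA mulfV ?mulr1 ?gt_eqF ?powR_gt0// expRN.
Qed.

End real_moments.

Section cardinality.
Variables (T : choiceType) (s : seq T).

Lemma size_le_card (u : seq (seq_sub s)) (B : set T) k : uniq u ->
  (forall t, t \in u -> B (ssval t)) -> (B #<= `I_k)%card -> (size u <= k)%N.
Proof.
move=> uu uB Bk; case: u uu uB => [//|t0 u'] uu uB.
rewrite -card_le_II; apply: card_le_trans Bk.
set u := t0 :: u' in uu uB *.
have inj : {in `I_(size u) &, injective (fun i => ssval (nth t0 u i))}.
  move=> i j; rewrite !inE => iu ju /val_inj /eqP.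
  by rewrite nth_uniq// => /eqP.
rewrite -(card_le_eql (inj_card_eq inj)).
apply: subset_card_le => _ [i /= iu <-]; apply: uB; exact: mem_nth.
Qed.

End cardinality.

Section nearest.
Variables (R : realType) (T : choiceType) (s : seq T) (dd : T -> T -> R).

Lemma dist_to_attained (B : set T) x : B `<=` [set` s] -> B !=set0 ->
  exists t : seq_sub s, B (ssval t) /\ dd x (ssval t) <= dist_to dd x B.
Proof.
move=> Bs [y By]; have ys := Bs _ By.
pose Q (t : seq_sub s) := `[< B (ssval t) >].
have Qy : Q (SeqSub ys) by apply/asboolP.
case: (arg_minP (fun t => dd x (ssval t)) Qy) => t /asboolP Bt tmin.
exists t; split => //; apply: lb_le_inf; first by exists (dd x y), y.
move=> _ [z Bz <-]; have zs := Bs _ Bz.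
by apply: (tmin (SeqSub zs)); apply/asboolP.
Qed.

End nearest.

(** * Admissible sequences *)

Section family_bounds.
Variables (R : realType) (m n : nat) (s : seq 'M[R[i]]_(m, n)).
Hypothesis s0 : [set` s] !=set0.

Lemma Delta_bar_infty_ge A : A \in s -> opnorm A <= Delta_bar_infty [set` s].
Proof. by move=> As; apply: sup_finite_ge => //; exact: finite_seq. Qed.

Lemma Delta_bar_infty_ge0 : 0 <= Delta_bar_infty [set` s].
Proof.
by case: s0 => A As; apply: le_trans (opnorm_ge0 A) (Delta_bar_infty_ge As).
Qed.

Lemma Delta_bar_ge q A : A \in s -> schatten q A <= Delta_bar q [set` s].
Proof. by move=> As; apply: sup_finite_ge => //; exact: finite_seq. Qed.

Lemma Delta_bar_ge0 q : 0 <= Delta_bar q [set` s].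
Proof.
by case: s0 => A As; apply: le_trans (schatten_ge0 q A) (Delta_bar_ge q As).
Qed.

End family_bounds.

Lemma dist_to_ge0 (R : realType) m n (A : 'M[R[i]]_(m, n)) B :
  B !=set0 -> 0 <= dist_to (@d_infty R m n) A B.
Proof.
move=> [D BD]; apply: lb_le_inf; first by exists (d_infty A D), D.
by move=> _ [E _ <-]; exact: d_infty_ge0.
Qed.

Lemma powR2_half (R : realType) k : (2 : R) `^ (k%:R / 2) = Num.sqrt (2 ^+ k).
Proof.
have p0 : 0 <= (2 : R) `^ (k%:R / 2) by exact: powR_ge0.
rewrite -[LHS](ger0_norm p0) -sqrtr_sqr; congr Num.sqrt.
by rewrite -powR_mulrn// -powRrM divfK// powR_mulrn.
Qed.

Lemma core_const_ge0 (R : realType) : 0 <= core_const R.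
Proof.
have dc := ltW (diag_const_gt0 R); have blc := ltW (bilin_const_gt0 R).
have dsc := le_trans ler01 (diag_sup_const_ge1 R).
have nc := nrm_sup_const_ge0 R; have gc := gram_const_ge0 R.
have bc := ltW (bernstein_const_gt0 R).
rewrite /core_const.
by repeat first [exact: ler0n | assumption | apply: mulr_ge0 | apply: addr_ge0].
Qed.

Lemma quadratic_scale (R : realType) (x y z w : R) :
  0 <= y -> 0 <= z -> 0 <= w ->
  0 <= (2 * x) ^+ 2 + 2 * y + z + w <= 4 * (x ^+ 2 + y + z + w).
Proof.
move=> y0 z0 w0; have x0 : 0 <= x * x by rewrite -expr2 sqr_ge0.
by apply/andP; split; lra.
Qed.

Section moments.
Context d (T : measurableType d) (R : realType) (P : probability T R) (n : nat).
Variable xi : 'I_n -> {RV P >-> R}.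
Hypothesis indxi : independent_RVs xi.
Hypothesis xi0 : forall i, ('E_P[xi i] = 0)%E.
Variable a : R.
Hypothesis a0 : 0 < a.
Hypothesis xia : forall i, (psi2_norm P (xi i) < a%:E)%E.
Variables (m : nat) (s : seq 'M[R[i]]_(m, n)).
Hypothesis s0 : [set` s] !=set0.

Local Notation cA := [set` s].
Local Notation D2 := (Delta_bar 2 cA).
Local Notation D4 := (Delta_bar 4 cA ^+ 2).
Local Notation Dinf := (Delta_bar_infty cA).
Local Notation dist := (fun A B : seq_sub s => d_infty (ssval B) (ssval A)).

Lemma measurable_sup_deviation : measurable_fun setT (sup_deviation cA xi).
Proof.
rewrite (_ : sup_deviation cA xi = fun w => a ^+ 2 *
    deviation_sup P (scaled xi a) (family_mx (s := s)) w); last first.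
  by apply/funext => w; exact: sup_deviationE.
apply: measurable_funM => //; apply: measurable_bigmaxr => t _.
have [mX _ _ _ _] := scaled_family indxi xi0 a0 xia.
apply: measurableT_comp => //.
apply: measurable_funB => //; apply: measurable_funX.
apply: measurable_nrm => i; under eq_fun do rewrite mxE.
apply: measurable_sum => j; apply: measurable_funM => //.
by rewrite (_ : (fun _ => _) = scaled xi a j)//; apply/funext => w; rewrite mxE.
Qed.

Lemma sup_deviation_ge0 w : 0 <= sup_deviation cA xi w.
Proof.
by rewrite (sup_deviationE indxi xi0 a0 xia s0) mulr_ge0 ?sqr_ge0// bigmaxr_ge0.
Qed.

Lemma chain_moment l N (sq : nat -> seq (seq_sub s))
    (pi : nat -> seq_sub s -> seq_sub s) (g : R) :
  (l <= N)%N -> 0 <= g ->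
  (forall k, (l <= k <= N)%N -> (size (sq k) <= 2 ^ (2 ^ k))%N) ->
  (forall k t, (l <= k <= N)%N -> pi k t \in sq k) ->
  (forall t, pi N t = t) ->
  (forall t, \sum_(l <= k < N)
     Num.sqrt (2 ^+ k) * dist (pi k t) (pi k.+1 t) <= g) ->
  let r := (2 ^ l.+1)%N in
  Ele P (fun w => sup_deviation cA xi w ^+ r)
    ((a ^+ 2 * (core_const R * (g ^+ 2 + D2 * g + Num.sqrt r%:R * D4 +
                                r%:R * Dinf ^+ 2))) ^+ r).
Proof.
move=> lN g0 ss pis piN pig r.
have hX := scaled_family indxi xi0 a0 xia.
have dist0 (A B : seq_sub s) : 0 <= dist A B by exact: d_infty_ge0.
have distA (A B : seq_sub s) x :
    nrm ((family_mx B - family_mx A) *m x) <= dist A B * nrm x.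
  by rewrite /family_mx -realifyB; exact: nrm_realify_le.
have Dinf0 : 0 <= Dinf by exact: Delta_bar_infty_ge0.
have DinfA (A : seq_sub s) x : nrm (family_mx A *m x) <= Dinf * nrm x.
  apply: le_trans (nrm_realify_le _ _) _.
  apply: ler_wpM2r; first exact: nrm_ge0.
  by apply: Delta_bar_infty_ge; exact: ssvalP.
have D20 : 0 <= D2 by exact: Delta_bar_ge0.
have D2A (A : seq_sub s) : frob2 (family_mx A) <= D2 ^+ 2.
  rewrite frob2_realify; apply: lerXn2r; rewrite ?nnegrE ?schatten_ge0//.
  by apply: Delta_bar_ge; exact: ssvalP.
have D40 : 0 <= D4 by exact: sqr_ge0.
have D4A (A : seq_sub s) :
    frob2 ((family_mx A)^T *m family_mx A) <= D4 ^+ 2.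
  apply: le_trans (frob2_gram_realify _) _.
  apply: lerXn2r; rewrite ?nnegrE ?sqr_ge0//.
  apply: lerXn2r; rewrite ?nnegrE.
  - exact: schatten_ge0.
  - exact: Delta_bar_ge0.
  - by apply: Delta_bar_ge; exact: ssvalP.
have H := core_moment hX dist0 distA Dinf0 DinfA D20 D2A D40 D4A lN g0 ss pis piN pig.
apply: Ele_ext (Ele_powZ (sqr_ge0 a) H) => // w.
by rewrite (sup_deviationE indxi xi0 a0 xia s0).
Qed.

Let pick (B : set 'M[R[i]]_(m, n)) (t : seq_sub s) : seq_sub s :=
  if pselect (exists u : seq_sub s, B (ssval u) /\
    d_infty (ssval t) (ssval u) <= dist_to (@d_infty R m n) (ssval t) B) is left h
  then projT1 (cid h) else t.

Let pickP B t : B `<=` cA -> B !=set0 -> B (ssval (pick B t)) /\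
  d_infty (ssval t) (ssval (pick B t)) <= dist_to (@d_infty R m n) (ssval t) B.
Proof.
move=> Bs Bn; rewrite /pick; case: pselect => [h|]; first by case: cid.
by case; exact: dist_to_attained.
Qed.

(* The chain follows nearest points of the admissible sequence and jumps to the
   matrix itself once the whole family is allowed. *)
Lemma admissible_moment l (cAn : nat -> set 'M[R[i]]_(m, n)) (G : R) :
  admissible cA cAn ->
  (forall A N, A \in s -> \sum_(l <= k < N)
     2 `^ (k%:R / 2) * dist_to (@d_infty R m n) A (cAn k) <= G) ->
  let r := (2 ^ l.+1)%N in
  Ele P (fun w => sup_deviation cA xi w ^+ r)
    ((a ^+ 2 * (core_const R * (4 * (G ^+ 2 + D2 * G + Num.sqrt r%:R * D4 +
                                r%:R * Dinf ^+ 2)))) ^+ r).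
Proof.
move=> [AnA An0 A0 Ak] hG r.
(* Level N + 1 admits 2^(2^(N+1)) points, more than the size of the family, so the chain can end at
   the matrix itself. *)
pose N := maxn l (size (enum {: seq_sub s})).
pose pi k t := if (k <= N)%N then pick (cAn k) t else t.
pose sq k := if (k <= N)%N then [seq t <- enum {: seq_sub s} | `[< cAn k (ssval t) >]]
  else enum {: seq_sub s}.
pose del k (t : seq_sub s) := dist_to (@d_infty R m n) (ssval t) (cAn k).
have del0 k t : 0 <= del k t by exact: dist_to_ge0.
have lN : (l <= N)%N by exact: leq_maxl.
have G0 : 0 <= G.
  by case: s0 => A As; have := hG A l As; rewrite big_geq.
have pid k t : (k <= N)%N -> d_infty (ssval t) (ssval (pi k t)) <= del k t.
  by move=> kN; rewrite /pi kN; have [] := pickP t (@AnA k) (An0 k).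
(* The weight 2 G comes from the triangle inequality through [t]: a link costs its distances at
   levels k and k + 1, and sqrt(2^k) <= sqrt(2^(k+1)), so each of the two sums is at most G. *)
have H := @chain_moment l N.+1 sq pi (2 * G) (leqW lN).
have {}H := H (mulr_ge0 (ler0n _ 2) G0).
have cc0 := core_const_ge0 R.
have {}H : Ele P (fun w => sup_deviation cA xi w ^+ r)
    ((a ^+ 2 * (core_const R * ((2 * G) ^+ 2 + D2 * (2 * G) +
      Num.sqrt r%:R * D4 + r%:R * Dinf ^+ 2))) ^+ r).
  apply: H.
  - move=> k /andP[lk kN1]; rewrite /sq; case: (leqP k N) => kN.
      apply: (@size_le_card _ s _ (cAn k)).
      + by rewrite filter_uniq// enum_uniq.
      + by move=> t; rewrite mem_filter => /andP[/asboolP].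
      + case: k {lk kN kN1} => [|k]; last exact: Ak.
        by rewrite (card_le_eql A0) card_le_II expn_gt0.
    have -> : k = N.+1 by apply/eqP; rewrite eqn_leq kN1 kN.
    apply: leq_trans (leq_maxr l _) _; rewrite -/N.
    apply: leq_trans (ltnW (ltn_expl _ (ltnSn 1))) _.
    by rewrite leq_exp2l// ltnW// ltnW// ltn_expl.
  - move=> k t /andP[lk kN1]; rewrite /sq /pi; case: (leqP k N) => kN.
      rewrite mem_filter mem_enum andbT; apply/asboolP.
      by have [] := pickP t (@AnA k) (An0 k).
    by rewrite mem_enum.
  - by move=> t; rewrite /pi ltnn.
  - move=> t; rewrite big_nat_recr//=.
    have last : Num.sqrt (2 ^+ N) * d_infty (ssval (pi N.+1 t)) (ssval (pi N t)) <=
        Num.sqrt (2 ^+ N) * del N t.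
      rewrite ler_wpM2l ?sqrtr_ge0// {1}/pi ltnn.
      exact: pid.
    have step : \sum_(l <= k < N) Num.sqrt (2 ^+ k) *
        d_infty (ssval (pi k.+1 t)) (ssval (pi k t)) <=
        \sum_(l <= k < N) Num.sqrt (2 ^+ k) * del k t +
        \sum_(l <= k < N) Num.sqrt (2 ^+ k.+1) * del k.+1 t.
      rewrite -big_split/=; apply: ler_sum_nat => k /andP[lk kN].
      apply: (@le_trans _ _ (Num.sqrt (2 ^+ k) * (del k t + del k.+1 t))).
        rewrite ler_wpM2l ?sqrtr_ge0//.
        apply: le_trans (d_infty_triangle _ _ (ssval t)) _.
        rewrite addrC d_infty_sym [X in _ + X <= _]d_infty_sym.
        by apply: lerD; [rewrite d_infty_sym; apply: pid; exact: ltnW|exact: pid].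
      rewrite mulrDr lerD2l ler_wpM2r// ler_sqrt ?exprn_ge0//.
      by rewrite ler_eXn2l ?ltr1n.
    have tot M : \sum_(l <= k < M) Num.sqrt (2 ^+ k) * del k t <= G.
      apply: le_trans (hG (ssval t) M (ssvalP t)).
      by apply: ler_sum => k _; rewrite powR2_half.
    have shift : \sum_(l <= k < N) Num.sqrt (2 ^+ k.+1) * del k.+1 t <= G.
      apply: le_trans (tot N.+1).
      rewrite [leRHS]big_ltn ?ltnS// big_add1/= lerDr.
      by rewrite mulr_ge0 ?sqrtr_ge0.
    have := tot N.+1; rewrite big_nat_recr//=.
    have -> : 2 * G = G + G by ring.
    move=> tot1; apply: le_trans (lerD step last) _.
    rewrite addrAC; apply: lerD => //.
have sr0 : 0 <= Num.sqrt r%:R * D4 by apply: mulr_ge0; rewrite ?sqrtr_ge0 ?sqr_ge0.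
have rd0 : 0 <= r%:R * Dinf ^+ 2 by apply: mulr_ge0; rewrite ?sqr_ge0.
have dG0 : 0 <= D2 * G by apply: mulr_ge0 => //; exact: Delta_bar_ge0.
have /andP[L0 LU] := quadratic_scale G dG0 sr0 rd0.
rewrite (mulrCA 2) in L0 LU.
apply: Ele_weak H; apply: lerXn2r; rewrite ?nnegrE.
- by apply: mulr_ge0; [exact: sqr_ge0|exact: mulr_ge0].
- apply: mulr_ge0; first exact: sqr_ge0.
  by apply: mulr_ge0 => //; exact: le_trans LU.
- by apply: ler_wpM2l; [exact: sqr_ge0|apply: ler_wpM2l].
Qed.

End moments.

(** * Finiteness and monotonicity of the gamma functional *)

Section gamma_finite.
Variables (R : realType) (T : choiceType) (s : seq T) (dd : T -> T -> R).
Hypothesis s0 : [set` s] !=set0.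
Hypothesis dd0 : forall x y, 0 <= dd x y.
Hypothesis ddxx : forall x, dd x x = 0.

Local Notation cA := [set` s].
Local Notation term cAn x k := (2 `^ (k%:R / 2) * dist_to dd x (cAn k) : R).

Let dist_le x B y : B y -> dist_to dd x B <= dd x y.
Proof.
by move=> By; apply: inf_lbound; [exists 0 => _ [z _ <-]; exact: dd0|exists y].
Qed.

Let dist0 x B : B !=set0 -> 0 <= dist_to dd x B.
Proof.
move=> [y By]; apply: lb_le_inf; first by exists (dd x y), y.
by move=> _ [z _ <-]; exact: dd0.
Qed.

Let term0 cAn x k : admissible cA cAn -> (0 <= (term cAn x k)%:E)%E.
Proof.
by move=> [_ An0 _ _]; rewrite lee_fin; apply: mulr_ge0;
  [exact: powR_ge0|exact: dist0].
Qed.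

Lemma gamma2_from_ge0 l : (0 <= gamma2_from l cA dd)%E.
Proof.
apply: le_ereal_inf_tmp => _ [cAn adm <-]; case: s0 => x xs.
apply: (@le_trans _ _ (\sum_(l <= k <oo) (term cAn x k)%:E)%E).
  by apply: nneseries_ge0 => k _ _; exact: term0.
by apply: ereal_sup_ubound; exists x.
Qed.

Lemma gamma2_from_le l : (gamma2_from l cA dd <= gamma2 cA dd)%E.
Proof.
apply: le_ereal_inf_tmp => _ [cAn adm <-].
apply: le_trans; first by apply: ereal_inf_lbound; exists cAn.
apply: ge_ereal_sup => _ [x xs <-].
apply: (@le_trans _ _ (\sum_(0 <= k <oo) (term cAn x k)%:E)%E); last first.
  by apply: ereal_sup_ubound; exists x.
apply: lime_le; first by apply: is_cvg_nneseries => k _ _; exact: term0.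
apply: nearW => N; apply: (le_trans _ (@nneseries_lim_ge _ _ xpredT 0 N _)).
  rewrite [leLHS](big_nat_widenl l 0)//= [leLHS]big_mkcond.
  apply: lee_sum => k _; case: ifP => // _; exact: term0.
by move=> k _ _; exact: term0.
Qed.

(** The strict inequality produces an actual admissible sequence, and nonnegative terms make every
    partial sum at most the value of the series. *)
Lemma gamma2_from_lt_witness l (G : R) : (gamma2_from l cA dd < G%:E)%E ->
  exists2 cAn, admissible cA cAn &
  forall x N, x \in s -> \sum_(l <= k < N) term cAn x k <= G.
Proof.
move=> /ereal_inf_lt[_ [cAn adm <-] /ltW H]; exists cAn => // x N xs.
rewrite -lee_fin -sumEFin; apply: le_trans H.
apply: (@le_trans _ _ (\sum_(l <= k <oo) (term cAn x k)%:E)%E).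
  by apply: nneseries_lim_ge => k _ _; exact: term0.
by apply: ereal_sup_ubound; exists x.
Qed.

(** One point serves up to level K, the cardinality of the family, and the whole family afterwards;
    it is allowed there because K < k < 2^(2^k). The distances then vanish and the series is a
    finite sum. *)
Lemma gamma2_lty : (gamma2 cA dd < +oo)%E.
Proof.
have [x0 x0s] := s0.
have [K cK] : finite_set cA by exact: finite_seq.
pose cAn k : set T := if (K < k)%N then cA else [set x0].
have adm : admissible cA cAn.
  split.
  - by move=> k; rewrite /cAn; case: ifP => // _ x /= ->.
  - by move=> k; rewrite /cAn; case: ifP => // _; exists x0.
  - by rewrite /cAn ltn0; exact: card_set1.
  - move=> k k1; rewrite /cAn; case: ifP => Kk; last first.
      rewrite (card_le_eql card_set1).
      by rewrite card_le_II expn_gt0.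
    rewrite (card_le_eql cK) card_le_II; apply: leq_trans (ltnW Kk) _.
    by apply: ltnW; apply: ltn_trans (ltn_expl _ _) (ltn_expl _ _).
pose D := \sum_(x <- s) dd x x0.
have D0 : 0 <= D by apply: sumr_ge0.
pose h k : R := if (k <= K)%N then 2 `^ (k%:R / 2) * D else 0.
have h0 k : 0 <= h k by rewrite /h; case: ifP => // _; rewrite mulr_ge0 ?powR_ge0.
have th x k : x \in s -> term cAn x k <= h k.
  move=> xs; rewrite /h; case: leqP => kK.
    rewrite ler_wpM2l ?powR_ge0// /cAn ltnNge kK/=.
    by apply: le_trans (dist_le _ (erefl x0)) _; exact: (@le_sumr_seq _ _ s (dd^~ x0)).
  have : dist_to dd x (cAn k) <= 0.
    by rewrite -(ddxx x); apply: dist_le; rewrite /cAn kK.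
  by move=> /(ler_wpM2l (powR_ge0 2 (k%:R / 2))); rewrite mulr0.
apply: (@le_lt_trans _ _ (\sum_(0 <= k < K.+1) h k)%:E); last exact: ltry.
apply: le_trans; first by apply: ereal_inf_lbound; exists cAn.
apply: ge_ereal_sup => _ [x xs <-].
apply: lime_le; first by apply: is_cvg_nneseries => k _ _; exact: term0.
apply: nearW => N; rewrite sumEFin lee_fin.
apply: (@le_trans _ _ (\sum_(0 <= k < N) h k)).
  by apply: ler_sum => k _; exact: th.
rewrite (big_nat_widen 0 N (N + K.+1))//= ?leq_addr//.
rewrite (big_nat_widen 0 K.+1 (N + K.+1))//= ?leq_addl//.
rewrite big_mkcond [leRHS]big_mkcond; apply: ler_sum => k _.
by rewrite ltnS /h; case: ifP => // _; case: ifP => // kK; have := h0 k; rewrite /h kK.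
Qed.

End gamma_finite.

Lemma dyadic_exponent (R : realType) (p : R) : 1 <= p ->
  let r := (2 ^ (Num.truncn (ln p / ln 2)).+1)%N in p <= r%:R /\ r%:R <= 2 * p.
Proof.
move=> p1 r; have p0 : 0 < p by exact: lt_le_trans p1.
have l2 : 0 < ln (2 : R) by rewrite ln_gt0// ltr1n.
have q0 : 0 <= ln p / ln 2 by apply: divr_ge0; [exact: ln_ge0|exact: ltW].
have /andP[lq ql] := truncn_itv q0.
have pE : p = 2 `^ (ln p / ln 2).
  by rewrite /powR pnatr_eq0/= divfK ?gt_eqF// lnK.
rewrite /r; set l := Num.truncn _ in lq ql *; split.
  by rewrite natrX -powR_mulrn// [leLHS]pE; apply: ler_powR (ltW ql); rewrite ler1n.
rewrite expnS natrM natrX ler_wpM2l// -powR_mulrn// [leRHS]pE.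
by apply: ler_powR lq; rewrite ler1n.
Qed.

(** On [0, 1], e^2 <= e makes the error linear in [e], which replaces a continuity argument when the
    strict bounds are relaxed. *)
Lemma quadratic_perturbation (R : realFieldType) (x y d z : R) :
  0 <= x -> 0 <= y -> 0 <= d -> 0 <= z ->
  exists2 M, 0 <= M & forall e, 0 <= e <= 1 ->
  (x + e) ^+ 2 * ((y + e) ^+ 2 + d * (y + e) + z) <=
  x ^+ 2 * (y ^+ 2 + d * y + z) + e * M.
Proof.
move=> x0 y0 d0 z0.
pose Q := y ^+ 2 + d * y + z; pose u := 2 * x + 1; pose v := 2 * y + 1 + d.
have dy : 0 <= d * y by exact: mulr_ge0.
have Q0 : 0 <= Q by rewrite /Q !addr_ge0 ?sqr_ge0.
have u0 : 0 <= u by rewrite /u addr_ge0// mulr_ge0.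
have v0 : 0 <= v by rewrite /v !addr_ge0// mulr_ge0.
have t0 : 0 <= x ^+ 2 by exact: sqr_ge0.
have uv0 : 0 <= u * v by exact: mulr_ge0.
exists (x ^+ 2 * v + u * Q + u * v).
  by apply: addr_ge0 => //; apply: addr_ge0; exact: mulr_ge0.
move=> e /andP[e0 e1].
have ee : e ^+ 2 <= e by rewrite expr2 ler_piMl.
have X : (x + e) ^+ 2 <= x ^+ 2 + e * u by move: ee; rewrite /u !expr2; lra.
have Y : (y + e) ^+ 2 + d * (y + e) + z <= Q + e * v.
  by move: ee; rewrite /Q /v !expr2; lra.
apply: le_trans (ler_pM (sqr_ge0 _) _ X Y) _.
  have e2 : 0 <= d * e by exact: mulr_ge0.
  by rewrite mulrDr !addr_ge0 ?sqr_ge0.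
rewrite -/Q; move: Q0 uv0 ee t0; move: (x ^+ 2) => t Q0 uv0 ee t0.
have : 0 <= (e - e ^+ 2) * (u * v) by apply: mulr_ge0; rewrite // subr_ge0.
rewrite expr2; lra.
Qed.

Lemma exponent_scale (R : rcfType) (p r x D E : R) : 0 <= p -> r <= 2 * p ->
  0 <= x -> 0 <= D -> 0 <= E ->
  x + Num.sqrt r * D + r * E <= 2 * (x + (Num.sqrt p * D + p * E)).
Proof.
move=> p0 rp x0 D0 E0.
have s : Num.sqrt r <= 2 * Num.sqrt p.
  apply: (@le_trans _ _ (Num.sqrt (2 ^+ 2 * p))).
    by rewrite ler_wsqrtr// (le_trans rp)// ler_wpM2r// -natrX ler_nat.
  by rewrite sqrtrM ?sqr_ge0// sqrtr_sqr ger0_norm.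
have := ler_wpM2r D0 s; have := ler_wpM2r E0 rp; lra.
Qed.

Lemma constant_bound (R : realFieldType) (k c y z : R) :
  0 <= k * c -> y <= 2 * z -> 2 * (k * (c * (4 * y))) <= 16 * c * (k * z).
Proof. by move=> kc /(ler_wpM2l kc); lra. Qed.

Section gamma_moments.
Context d (T : measurableType d) (R : realType) (P : probability T R) (n : nat).
Variable xi : 'I_n -> {RV P >-> R}.
Hypothesis indxi : independent_RVs xi.
Hypothesis xi0 : forall i, ('E_P[xi i] = 0)%E.
Variables (m : nat) (s : seq 'M[R[i]]_(m, n)).
Hypothesis s0 : [set` s] !=set0.

Local Notation cA := [set` s].
Local Notation D2 := (Delta_bar 2 cA).
Local Notation D4 := (Delta_bar 4 cA ^+ 2).
Local Notation Dinf := (Delta_bar_infty cA).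

(** The factors of 16 are 2 for passing from order r to order p, 4 for doubling the chain weight,
    and 2 for r <= 2p. Adding 1 makes the constant positive. *)
Definition moment_const : R := 16 * core_const R + 1.

Lemma moment_const_ge1 : 1 <= moment_const.
Proof. by rewrite lerDr; apply: mulr_ge0 => //; exact: core_const_ge0. Qed.

(** An arbitrary bound [g] is allowed, so that the tail estimate can insert the full gamma
    functional. The proof works with K + e and g + e, strictly above the infima, and removes e at
    the end. *)
Lemma moment_of_gamma (p K g : R) : 1 <= p -> 0 <= K -> 0 <= g ->
  (forall i, (psi2_norm P (xi i) <= K%:E)%E) ->
  (gamma2p p cA (@d_infty R m n) <= g%:E)%E ->
  ('E_P[(fun w => (sup_deviation cA xi w `^ p)%R)] `^ (p^-1)%R <=
   (moment_const * (K ^+ 2 * (g ^+ 2 + D2 * g +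
      (Num.sqrt p * D4 + p * Dinf ^+ 2))))%:E)%E.
Proof.
move=> p1 K0 g0 xiK pg; have p0 : 0 <= p by exact: le_trans p1.
have D20 : 0 <= D2 by exact: Delta_bar_ge0.
have D40 : 0 <= D4 by exact: sqr_ge0.
have Di0 : 0 <= Dinf ^+ 2 by exact: sqr_ge0.
pose z := Num.sqrt p * D4 + p * Dinf ^+ 2.
have z0 : 0 <= z.
  by apply: addr_ge0; apply: mulr_ge0 => //; exact: sqrtr_ge0.
have C1 := moment_const_ge1; have C0 : 0 < moment_const by exact: lt_le_trans C1.
have cc0 := core_const_ge0 R.
apply/lee_addgt0Pr => h h0; rewrite -EFinD.
have [M M0 HM] := quadratic_perturbation K0 g0 D20 z0.
have M1 : 0 < M + 1 by rewrite ltr_wpDl.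
(* Small enough that the perturbation error, multiplied by the constant, is at most [h]. *)
pose e := Num.min 1 (h / (moment_const * (M + 1))).
have e0 : 0 < e by rewrite lt_min ltr01/= divr_gt0// mulr_gt0.
have e1 : e <= 1 by rewrite ge_min lexx.
have eM : moment_const * (e * M) <= h.
  apply: (@le_trans _ _ (moment_const * (e * (M + 1)))).
    by apply: ler_wpM2l; rewrite ?(ltW C0)//; apply: ler_wpM2l; rewrite ?(ltW e0)// lerDl.
  by rewrite mulrCA -ler_pdivlMr ?mulr_gt0// ge_min lexx orbT.
have a0 : 0 < K + e by rewrite ltr_wpDl.
have xia i : (psi2_norm P (xi i) < (K + e)%:E)%E.
  by apply: le_lt_trans (xiK i) _; rewrite lte_fin ltrDl.
have gG : (gamma2p p cA (@d_infty R m n) < (g + e)%:E)%E.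
  by apply: le_lt_trans pg _; rewrite lte_fin ltrDl.
have [cAn adm hG] := gamma2_from_lt_witness (@d_infty_ge0 R m n) gG.
have := admissible_moment indxi xi0 a0 xia s0 adm hG.
have [] := dyadic_exponent p1; set r := (2 ^ _)%N => pr rp H.
have G0 : 0 <= g + e by rewrite addr_ge0// ltW.
have x0 : 0 <= (g + e) ^+ 2 + D2 * (g + e).
  by apply: addr_ge0; [exact: sqr_ge0|exact: mulr_ge0].
apply: le_trans (moment_powR_le _ _ _ p1 pr H) _.
- by move=> w; exact: (sup_deviation_ge0 indxi xi0 a0 xia s0).
- exact: (measurable_sup_deviation indxi xi0 a0 xia s0).
- apply: mulr_ge0; first exact: sqr_ge0.
  apply: mulr_ge0 => //; apply: mulr_ge0 => //.
  apply: addr_ge0; last exact: mulr_ge0.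
  apply: addr_ge0; first exact: x0.
  by apply: mulr_ge0 => //; exact: sqrtr_ge0.
rewrite lee_fin.
apply: (@le_trans _ _ (moment_const * ((K + e) ^+ 2 *
    ((g + e) ^+ 2 + D2 * (g + e) + z)))).
  apply: (@le_trans _ _ (16 * core_const R * ((K + e) ^+ 2 *
      ((g + e) ^+ 2 + D2 * (g + e) + z)))).
    have := exponent_scale p0 rp x0 D40 Di0.
    rewrite -/z; set Y := _ + r%:R * _; set Z := _ + z => YZ.
    exact: (constant_bound (mulr_ge0 (sqr_ge0 (K + e)) cc0) YZ).
  apply: ler_wpM2r; last by rewrite /moment_const lerDl.
  by apply: mulr_ge0; [exact: sqr_ge0|exact: addr_ge0].
have e01 : 0 <= e <= 1 by rewrite ltW.
apply: le_trans (ler_wpM2l (ltW C0) (HM _ e01)) _.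
by rewrite mulrDr lerD2l.
Qed.

End gamma_moments.

Section psi2_vec.
Context d (T : measurableType d) (R : realType) (P : probability T R) (n : nat).
Variable xi : 'I_n -> {RV P >-> R}.
Hypothesis sg : forall i, subgaussian P (xi i).

Lemma psi2_norm_ge0 (X : T -> R) : (0 <= psi2_norm P X)%E.
Proof.
by apply: le_ereal_inf_tmp => _ [a [a0 _] <-]; rewrite lee_fin ltW.
Qed.

Lemma psi2_norm_vecP : exists K : R, [/\ 0 <= K, psi2_norm_vec xi = K%:E &
  forall i, (psi2_norm P (xi i) <= K%:E)%E].
Proof.
have [v0 voo] : (0 <= psi2_norm_vec xi /\ psi2_norm_vec xi < +oo)%E.
  apply: (big_ind (fun x : \bar R => 0 <= x /\ x < +oo)%E).
  - by rewrite lexx ltry.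
  - by move=> x y [x0 xoo] [y0 yoo]; rewrite le_max x0 gt_max xoo yoo.
  - by move=> i _; split; [exact: psi2_norm_ge0|exact: sg].
have vE : psi2_norm_vec xi = (fine (psi2_norm_vec xi))%:E.
  by rewrite fineK// ge0_fin_numE.
exists (fine (psi2_norm_vec xi)); split => //; first exact: fine_ge0.
by move=> i; rewrite -vE; exact: le_bigmax.
Qed.

End psi2_vec.

Theorem theorem6p5 (R : realType) :
  exists c C C' : R, [/\ 0 < c, 0 < C, 0 < C' &
  forall (d : measure_display) (T : measurableType d) (P : probability T R)
    (m n : nat) (cA : set 'M[R[i]]_(m, n)) (xi : 'I_n -> {RV P >-> R}),
    finite_set cA -> cA !=set0 ->
    independent_RVs xi ->
    (forall i, 'E_P[xi i] = 0)%E ->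
    (forall i, subgaussian P (xi i)) ->
    (forall p : R, 1 <= p ->
      ('E_P[(fun w => (sup_deviation cA xi w `^ p)%R)] `^ (p^-1)%R <=
       C'%:E * psi2_norm_vec xi ^+ 2 *
         (gamma2p p cA (@d_infty R m n) ^+ 2
          + (Delta_bar 2 cA)%:E * gamma2p p cA (@d_infty R m n)
          + (Num.sqrt p * Delta_bar 4 cA ^+ 2)%:E
          + (p * Delta_bar_infty cA ^+ 2)%:E))%E) /\
    (forall u : R, 1 <= u ->
      (P [set w | (C%:E * psi2_norm_vec xi ^+ 2 *
                     (gamma2 cA (@d_infty R m n) ^+ 2
                      + (Delta_bar 2 cA)%:E * gamma2 cA (@d_infty R m n))
                   + c%:E * psi2_norm_vec xi ^+ 2 *
                     (Num.sqrt u * Delta_bar 4 cA ^+ 2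
                      + u * Delta_bar_infty cA ^+ 2)%:E
                   < (sup_deviation cA xi w)%:E)%E] <=
       (expR (- u))%:E)%E)].
Proof.
pose C' := moment_const R; pose C := expR 1 * C'.
have C'0 : 0 < C' by apply: lt_le_trans (moment_const_ge1 R).
have C0 : 0 < C by rewrite mulr_gt0// expR_gt0.
(* Both tail constants are e times the moment constant; the factor e is the threshold in Markov's
   inequality. *)
exists C, C, C'; split => // d T P m n cA xi /finite_seqP[s ->] s0 ind xi0 sg.
have [K [K0 -> xiK]] := psi2_norm_vecP sg.
have D0 := @d_infty_ge0 R m n.
have Dxx (A : 'M[R[i]]_(m, n)) : d_infty A A = 0.
  apply/eqP; rewrite eq_le D0 andbT /d_infty subrr.
  apply: sup_le_ub; first by case: (opnorm_has_sup (0 : 'M[R[i]]_(m, n))).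
  by move=> _ [x _ <-]; rewrite mul0mx norm20.
have g2oo := gamma2_lty s0 D0 Dxx.
(* For a finite family the functionals are real numbers, so the inequalities in extended reals
   reduce to real ones. *)
have gfin l : exists2 g : R, (0 <= g) &
      (gamma2_from l [set` s] (@d_infty R m n) = g%:E).
  have gl0 := gamma2_from_ge0 s0 D0 l.
  have E : gamma2_from l [set` s] (@d_infty R m n) =
      (fine (gamma2_from l [set` s] (@d_infty R m n)))%:E.
    by rewrite fineK// ge0_fin_numE// (le_lt_trans (gamma2_from_le s D0 l)).
  by exists (fine (gamma2_from l [set` s] (@d_infty R m n))) => //; exact: fine_ge0.
split => [p p1|u u1].
  have [g g0 gE] := gfin (Num.truncn (ln p / ln 2)).
  have gp : (gamma2p p [set` s] (@d_infty R m n) <= g%:E)%E by rewrite -gE.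
  rewrite [gamma2p _ _ _]gE.
  apply: le_trans (moment_of_gamma ind xi0 s0 p1 K0 g0 xiK gp) _.
  by rewrite -!EFin_expe -!EFinM lee_fin mulrA addrA.
have [g g0 gE] := gfin 0.
have gup : (gamma2p u [set` s] (@d_infty R m n) <= g%:E)%E.
  by rewrite -gE; exact: gamma2_from_le.
have H := moment_of_gamma ind xi0 s0 u1 K0 g0 xiK gup.
have B0 : 0 <= moment_const R * (K ^+ 2 * (g ^+ 2 + Delta_bar 2 [set` s] * g +
    (Num.sqrt u * Delta_bar 4 [set` s] ^+ 2 + u * Delta_bar_infty [set` s] ^+ 2))).
  apply: mulr_ge0; first exact: ltW.
  apply: mulr_ge0; first exact: sqr_ge0.
  have u0 : 0 <= u by exact: le_trans u1.
  apply: addr_ge0; apply: addr_ge0; rewrite ?sqr_ge0//.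
  - by apply: mulr_ge0 => //; exact: Delta_bar_ge0.
  - by apply: mulr_ge0; [exact: sqrtr_ge0|exact: sqr_ge0].
  - by apply: mulr_ge0 => //; exact: sqr_ge0.
have xia i : (psi2_norm P (xi i) < (K + 1)%:E)%E.
  by apply: le_lt_trans (xiK i) _; rewrite lte_fin ltrDl.
have a0 : 0 < K + 1 by rewrite ltr_wpDl.
have mS := measurable_sup_deviation ind xi0 a0 xia s0.
have := tail_of_moment mS B0 u1 H; set E := (X in P X) => PE.
rewrite (_ : gamma2 _ _ = g%:E)// (_ : [set w | _] = E)//.
rewrite /E; apply: eq_set => w; rewrite -!EFin_expe -!EFinM lte_fin.
by rewrite /C -!mulrA -!mulrDr.
Qed.
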